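(* Let $\Pi=[c_1,c_2,\dots,c_n,c_1]$ ($n\ge 3$) be a positively oriented Jordan polygon with distinct vertices $c_1,\dots,c_n\in\mathbb{C}$, bounding the domain $D$. Then there exist real numbers $0=t_0<t_1<\dots<t_n=2\pi$ such that the Poisson integral $f$ of the step function $$f(e^{it})=c_k\quad (t_{k-1}<t<t_k),\qquad k=1,\dots,n,$$ is a univalent harmonic mapping of the unit disk $U=\{|z|<1\}$ onto $D$.
   Context: A Jordan polygon is a closed polygonal path that is a simple closed curve; ''positively oriented'' means $D$ lies to the left as the vertices are traversed in the order $c_1,c_2,\dots,c_n,c_1$. The Poisson integral of a bounded function on $\partial U$ is its harmonic extension to $U$. *)

(* Defs.v *)
From Stdlib Require Import Reals Lra Lia Classical ClassicalEpsilon.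
Open Scope R_scope.

Definition Cpt := (R * R)%type.

Definition Cadd (a b : Cpt) : Cpt := (fst a + fst b, snd a + snd b).
Definition Csub (a b : Cpt) : Cpt := (fst a - fst b, snd a - snd b).
Definition Cscale (s : R) (a : Cpt) : Cpt := (s * fst a, s * snd a).
Definition Crot (a : Cpt) : Cpt := (- snd a, fst a).
Definition Cnorm2 (a : Cpt) : R := fst a * fst a + snd a * snd a.

Definition on_seg (a b p : Cpt) : Prop :=
  exists s, 0 <= s <= 1 /\ p = Cadd a (Cscale s (Csub b a)).

(* The closed polygon [c_0, c_1, ..., c_{n-1}, c_0] (0-based vertices);
   edge k joins c k to c ((k+1) mod n). *)
Definition next (n k : nat) : nat := Nat.modulo (S k) n.

Definition on_polygon (n : nat) (c : nat -> Cpt) (p : Cpt) : Prop :=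
  exists k, (k < n)%nat /\ on_seg (c k) (c (next n k)) p.

Definition distinct_vertices (n : nat) (c : nat -> Cpt) : Prop :=
  forall i j, (i < n)%nat -> (j < n)%nat -> i <> j -> c i <> c j.

Definition jordan_polygon (n : nat) (c : nat -> Cpt) : Prop :=
  forall i j p, (i < n)%nat -> (j < n)%nat -> i <> j ->
    on_seg (c i) (c (next n i)) p -> on_seg (c j) (c (next n j)) p ->
    (j = next n i /\ p = c j) \/ (i = next n j /\ p = c i).

Definition joined_off_polygon (n : nat) (c : nat -> Cpt) (z w : Cpt) : Prop :=
  exists g : R -> Cpt,
    continuity (fun s => fst (g s)) /\ continuity (fun s => snd (g s)) /\
    g 0 = z /\ g 1 = w /\
    (forall s, 0 <= s <= 1 -> ~ on_polygon n c (g s)).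

(* The domain D bounded by the polygon: points of the complement whose
   connected component (of the open complement) is bounded. *)
Definition polygon_domain (n : nat) (c : nat -> Cpt) (z : Cpt) : Prop :=
  ~ on_polygon n c z /\
  exists M, forall w, joined_off_polygon n c z w -> Cnorm2 w <= M.

(* Positive orientation: D lies to the left of each edge, i.e. points
   slightly to the left of the midpoint of every edge belong to D. *)
Definition positively_oriented (n : nat) (c : nat -> Cpt) : Prop :=
  forall k, (k < n)%nat ->
    exists delta, 0 < delta /\
      forall eps, 0 < eps < delta ->
        polygon_domain n c
          (Cadd (Cscale (1/2) (Cadd (c k) (c (next n k))))
                (Cscale eps (Crot (Csub (c (next n k)) (c k))))).

(* Total Riemann integral: RiemannInt when integrable, 0 otherwise
   (the value of RiemannInt does not depend on the integrability proof). *)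
Definition RInt (f : R -> R) (a b : R) : R :=
  match excluded_middle_informative (inhabited (Riemann_integrable f a b)) with
  | left H => RiemannInt (epsilon H (fun _ => True))
  | right _ => 0
  end.

Definition poisson_kernel (z : Cpt) (t : R) : R :=
  (1 - Cnorm2 z) / ((cos t - fst z) * (cos t - fst z) + (sin t - snd z) * (sin t - snd z)).

(* Poisson integral of the boundary function t |-> F t = f(e^{it}) *)
Definition poisson_integral (F : R -> Cpt) (z : Cpt) : Cpt :=
  (/ (2 * PI) * RInt (fun t => poisson_kernel z t * fst (F t)) 0 (2 * PI),
   / (2 * PI) * RInt (fun t => poisson_kernel z t * snd (F t)) 0 (2 * PI)).

Definition in_unit_disk (z : Cpt) : Prop := Cnorm2 z < 1.

(* Main.v *)
(* In the upper half-plane, with jumps e_k = c_(k+1) - c_k at the points x_k and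
   the edge from the last vertex to the first one at infinity, the harmonic
   extension is f = c_(n-1) - (1/pi) sum_k e_k arg(z - x_k), and its Jacobian is a
   positive multiple of the cross product of sum_k e_k / |z - x_k|^2 and
   sum_k e_k x_k / |z - x_k|^2.

   Suitable x_k are found by cutting the polygon along a diagonal.  If both parts
   have jump points with positive Jacobian up to the boundary, shrink those of
   the inner part to a small cluster and put the cluster in place of the jump of
   the diagonal in the outer part: the Jacobian of the outer part dominates away
   from the cluster, that of the inner part near it, so positivity persists.  For
   a positively oriented triangle it is automatic.  Positivity does not depend on
   the edge put at infinity, by the inversion x -> -1/x.

   Positivity makes f an orientation preserving local homeomorphism which tends to
   the polygon at the boundary.  So being in the image, and having exactly one
   preimage, are locally constant off the polygon.  In polar coordinates at a
   jump point f extends to a local homeomorphism across the edge, which shows that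
   there is one preimage on the left of the edge if there is none on its right.
   Since the complement of the polygon has only two sides, f is a bijection onto
   the domain. *)

From Coquelicot Require Import Coquelicot.
Require Import Defs.
From Stdlib Require Import Reals Lra Lia Psatz Classical ClassicalEpsilon.
Open Scope R_scope.

(** * Uniform positivity of the Jacobian *)

(** The orientation hypothesis is topological and is not visibly inherited by the two parts of a cut
    polygon. The induction therefore runs on a local condition: a left turn at a vertex where some
    linear functional has its strict minimum over the vertices. A cut through this vertex hands the
    condition on to both parts. Cutting off an ear loses the vertex; then, and again for the given
    polygon, orientation is settled by contradiction: with the wrong turn the mirror image would
    have good jump points, and a set that avoids far away points would have to contain one.
    Positivity of the Jacobian has to be quantitative, because gluing consumes part of it and
    because its limit at a jump point must still be strictly positive for the extension across an
    edge. The bound through [wsum] and 1 + |z|^2 is stable under translation, under z -> -1/z and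
    under gluing. Components of the complement are handled through predicates that are locally
    constant off the polygon ([off_clopen]); these are carried along the edges and around the
    vertices by one-sided neighbourhoods ([germ]). *)

Lemma cross_bound (a1 a2 b1 b2 A B : R) :
  Rabs a1 <= A -> Rabs a2 <= A -> Rabs b1 <= B -> Rabs b2 <= B ->
  - (2 * (A * B)) <= a1 * b2 - a2 * b1.
Proof.
  intros H1 H2 H3 H4.
  assert (P : forall a b, Rabs a <= A -> Rabs b <= B -> Rabs (a * b) <= A * B).
  { intros a b Ha Hb. rewrite Rabs_mult.
    apply Rmult_le_compat; auto using Rabs_pos. }
  pose proof (P _ _ H1 H4) as P1. pose proof (P _ _ H2 H3) as P2.
  apply Rabs_le_between in P1. apply Rabs_le_between in P2. lra.
Qed.

(** Here r is the distance to the jump of the diagonal, u = 1/r, and e is the size of the cluster;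
    au, av and bu, bv are the two sums of the Jacobian over the other outer jumps and over the
    cluster. Seen from r >= K e the cluster acts like the single jump (e1, e2) up to a relative
    error of order e/r, which costs at most half of the outer bound; the cross product of the
    cluster sums is nonnegative and only helps. *)
Lemma glue_scalar_far (C kA d K e r u a b au1 au2 av1 av2 bu1 bu2 bv1 bv2 e1 e2 : R) :
  1 <= C -> 0 < kA -> 0 < d <= 1 -> 1 <= K -> 24 * C ^ 4 <= K * kA ->
  0 < e -> e * (4 * C ^ 3 / d + 2 * C ^ 3) * (1 + / d ^ 2) <= kA / 2 ->
  0 < u -> u * r = 1 -> 0 <= a -> 0 <= b -> K * e <= r ->
  kA * (u ^ 2 + a) <= (1 + r ^ 2) * ((au1 + e1 * u ^ 2) * av2 - (au2 + e2 * u ^ 2) * av1) ->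
  0 <= bu1 * bv2 - bu2 * bv1 ->
  Rabs au1 <= C * a -> Rabs au2 <= C * a -> Rabs av1 <= C * a -> Rabs av2 <= C * a ->
  Rabs bv1 <= C * e * b -> Rabs bv2 <= C * e * b ->
  Rabs (bu1 - e1 * u ^ 2) <= C * e * (r + e) * u ^ 2 * b ->
  Rabs (bu2 - e2 * u ^ 2) <= C * e * (r + e) * u ^ 2 * b ->
  (r <= d -> a <= C) -> b <= C * u ^ 2 ->
  kA / (2 * (1 + C)) * (a + b) <=
    (1 + r ^ 2) * ((au1 + bu1) * (av2 + bv2) - (au2 + bu2) * (av1 + bv1)).
Proof.
  intros HC HkA Hd HK HKk He Hesm Hu Hur Ha Hb Hr HA HB Hau1 Hau2 Hav1 Hav2 Hbv1 Hbv2 Hbu1 Hbu2 Hnear Hfar.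
  assert (Hr0 : 0 < r) by (clear - Hu Hur; nra).
  assert (Her : e <= r) by (clear - HK He Hr; nra).
  pose proof (pow_lt C 3 ltac:(lra)) as C3.
  pose proof (pow_lt C 4 ltac:(lra)) as C4.
  assert (Hu2 : 0 < u ^ 2) by (apply pow_lt; lra).
  assert (Hu3 : 0 < u ^ 3) by (apply pow_lt; lra).
  assert (D1 : C * e * (r + e) * u ^ 2 * b <= 2 * C ^ 2 * e * u ^ 3).
  { apply Rle_trans with (C * e * (2 * r) * u ^ 2 * (C * u ^ 2)).
    - apply Rmult_le_compat; try lra.
      + repeat apply Rmult_le_pos; lra.
      + apply Rmult_le_compat_r; [lra|]. apply Rmult_le_compat_l; [apply Rmult_le_pos|]; lra.
    - right. replace (C * e * (2 * r) * u ^ 2 * (C * u ^ 2)) with (2 * C ^ 2 * e * u ^ 3 * (u * r)) by ring.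
      rewrite Hur. ring. }
  assert (D2 : C * e * b <= C ^ 2 * e * u ^ 2).
  { apply Rle_trans with (C * e * (C * u ^ 2)); [apply Rmult_le_compat_l; [apply Rmult_le_pos|]; lra | right; ring]. }
  pose proof (cross_bound (bu1 - e1 * u ^ 2) (bu2 - e2 * u ^ 2) av1 av2 _ _
     (Rle_trans _ _ _ Hbu1 D1) (Rle_trans _ _ _ Hbu2 D1) Hav1 Hav2) as E1.
  pose proof (cross_bound au1 au2 bv1 bv2 _ _ Hau1 Hau2
     (Rle_trans _ _ _ Hbv1 D2) (Rle_trans _ _ _ Hbv2 D2)) as E2.
  set (S := (au1 + bu1) * (av2 + bv2) - (au2 + bu2) * (av1 + bv1)).
  assert (HS : S >= ((au1 + e1 * u ^ 2) * av2 - (au2 + e2 * u ^ 2) * av1)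
     - (4 * C ^ 3 * a * e * u ^ 3 + 2 * C ^ 3 * a * e * u ^ 2)).
  { unfold S. clear - E1 E2 HB. lra. }
  assert (Herr : (1 + r ^ 2) * (4 * C ^ 3 * a * e * u ^ 3 + 2 * C ^ 3 * a * e * u ^ 2)
                 <= kA / 2 * (u ^ 2 + a)).
  (* For r <= d the error is at most 12 C^4 (e u) u^2, and e u <= 1/K brings it below kA/2 u^2.
     Beyond d it is a multiple of e times [a], absorbed by kA/2 times [a] since e is small. *)
  { destruct (Rle_dec r d) as [Hrd|Hrd].
    - specialize (Hnear Hrd).
      assert (Hu1 : 1 <= u) by (clear - Hu Hur Hrd Hd; nra).
      assert (Heu : K * (e * u) <= 1) by (clear - Hu Hur Hr; nra).
      assert (T1 : 4 * C ^ 3 * a * e * u ^ 3 + 2 * C ^ 3 * a * e * u ^ 2 <= 6 * C ^ 4 * (e * u) * u ^ 2).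
      { apply Rle_trans with (6 * C ^ 3 * a * e * u ^ 3).
        - assert (Q : 0 <= C ^ 3 * a * e * u ^ 2) by (repeat apply Rmult_le_pos; lra).
          replace (u ^ 3) with (u ^ 2 * u) by ring. clear - Q Hu1. nra.
        - replace (6 * C ^ 4 * (e * u) * u ^ 2) with (6 * C ^ 3 * C * e * u ^ 3) by ring.
          apply Rmult_le_compat_r; [lra|]. apply Rmult_le_compat_r; [lra|].
          apply Rmult_le_compat_l; lra. }
      assert (T2 : 1 + r ^ 2 <= 2) by (clear - Hrd Hd Hr0; nra).
      apply Rle_trans with (2 * (6 * C ^ 4 * (e * u) * u ^ 2)).
      + assert (Q2 : 0 <= C ^ 3 * a * e * u ^ 2) by (repeat apply Rmult_le_pos; lra).
        assert (Q3 : 0 <= C ^ 3 * a * e * u ^ 3) by (repeat apply Rmult_le_pos; lra).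
        apply Rmult_le_compat; try lra. pose proof (pow2_ge_0 r). lra.
      + apply Rle_trans with (kA / 2 * u ^ 2); [|apply Rmult_le_compat_l; lra].
        assert (T3 : 24 * C ^ 4 * (e * u) <= kA).
        { apply Rle_trans with (K * kA * (e * u)); [apply Rmult_le_compat_r; [apply Rmult_le_pos|]; lra | clear - Heu HkA; nra]. }
        clear - T3 Hu2. nra.
    - apply Rnot_le_lt in Hrd.
      assert (Hid : 0 < / d) by (apply Rinv_0_lt_compat; lra).
      assert (Hidd : / d * d = 1) by (apply Rinv_l; lra).
      assert (Hud : u <= / d).
      { apply Rmult_le_reg_r with r; [lra|]. rewrite Hur.
        apply Rle_trans with (/ d * d); [lra|]. apply Rmult_le_compat_l; lra. }
      assert (T1 : (1 + r ^ 2) * u ^ 2 <= 1 + / d ^ 2).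
      { replace ((1 + r ^ 2) * u ^ 2) with (u ^ 2 + (u * r) ^ 2) by ring. rewrite Hur.
        replace (/ d ^ 2) with (/ d * / d) by (field; lra). clear - Hu Hud Hid; nra. }
      assert (Q : 0 <= C ^ 3 * a * e) by (repeat apply Rmult_le_pos; lra).
      apply Rle_trans with ((1 + r ^ 2) * u ^ 2 * (a * (e * (4 * C ^ 3 / d + 2 * C ^ 3)))).
      + replace ((1 + r ^ 2) * (4 * C ^ 3 * a * e * u ^ 3 + 2 * C ^ 3 * a * e * u ^ 2)) with
          ((1 + r ^ 2) * u ^ 2 * (C ^ 3 * a * e * (4 * u + 2))) by ring.
        replace (a * (e * (4 * C ^ 3 / d + 2 * C ^ 3))) with (C ^ 3 * a * e * (4 * / d + 2)) by (field; lra).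
        apply Rmult_le_compat_l; [apply Rmult_le_pos; [pose proof (pow2_ge_0 r)|]; lra|]. apply Rmult_le_compat_l; lra.
      + apply Rle_trans with ((1 + / d ^ 2) * (a * (e * (4 * C ^ 3 / d + 2 * C ^ 3)))).
        * apply Rmult_le_compat_r; [|lra].
          replace (a * (e * (4 * C ^ 3 / d + 2 * C ^ 3))) with (C ^ 3 * a * e * (4 * / d + 2)) by (field; lra).
          apply Rmult_le_pos; lra.
        * apply Rle_trans with (kA / 2 * a); [|apply Rmult_le_compat_l; lra].
          replace ((1 + / d ^ 2) * (a * (e * (4 * C ^ 3 / d + 2 * C ^ 3)))) with
           (e * (4 * C ^ 3 / d + 2 * C ^ 3) * (1 + / d ^ 2) * a) by ring.
          apply Rmult_le_compat_r; lra. }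
  assert (Hfin : kA / 2 * (u ^ 2 + a) <= (1 + r ^ 2) * S).
  { assert (0 < 1 + r ^ 2) by (pose proof (pow2_ge_0 r); lra).
    apply Rle_trans with ((1 + r ^ 2) * ((au1 + e1 * u ^ 2) * av2 - (au2 + e2 * u ^ 2) * av1
     - (4 * C ^ 3 * a * e * u ^ 3 + 2 * C ^ 3 * a * e * u ^ 2))).
    - rewrite Rmult_minus_distr_l. lra.
    - apply Rmult_le_compat_l; lra. }
  apply Rle_trans with (kA / 2 * (u ^ 2 + a)); [|exact Hfin].
  replace (kA / (2 * (1 + C)) * (a + b)) with (kA / 2 * ((a + b) / (1 + C))) by (field; lra).
  apply Rmult_le_compat_l; [lra|].
  apply Rmult_le_reg_r with (1 + C); [lra|].
  unfold Rdiv. rewrite Rmult_assoc, Rinv_l by lra.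
  clear - Ha Hfar HC Hu2. nra.
Qed.

(** For r <= K e the cluster wins by its order of magnitude: [b] is at least of order 1/e^2 and the
    Jacobian of the cluster at least of order b/e, while the mixed terms are O(b) and the outer one
    is O(1). *)
Lemma glue_scalar_near (C kB K c e r a b au1 au2 av1 av2 bu1 bu2 bv1 bv2 : R) :
  1 <= C -> 0 < kB -> 1 <= K -> 0 < c ->
  0 < e <= 1 -> e ^ 2 * (1 + K ^ 2) * (2 * C ^ 4) <= c ->
  e * (1 + K ^ 2) * (4 * C ^ 3 + 2) <= kB ->
  0 <= a -> 0 <= b -> 0 < r <= K * e ->
  kB * e * b <= (e ^ 2 + r ^ 2) * (bu1 * bv2 - bu2 * bv1) ->
  Rabs au1 <= C * a -> Rabs au2 <= C * a -> Rabs av1 <= C * a -> Rabs av2 <= C * a ->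
  Rabs bv1 <= C * e * b -> Rabs bv2 <= C * e * b ->
  Rabs bu1 <= C * b -> Rabs bu2 <= C * b ->
  a <= C -> c <= b * (r ^ 2 + e ^ 2) ->
  / (1 + C) * (a + b) <=
    (1 + r ^ 2) * ((au1 + bu1) * (av2 + bv2) - (au2 + bu2) * (av1 + bv1)).
Proof.
  intros HC HkB HK Hc He He1 He2 Ha Hb Hr HB Hau1 Hau2 Hav1 Hav2 Hbv1 Hbv2 Hbu1 Hbu2 HaC Hcb.
  pose proof (pow_lt C 3 ltac:(lra)) as C3.
  assert (C4 : 1 <= C ^ 4) by (apply pow_R1_Rle; lra).
  assert (Hee : 0 < e ^ 2) by nra.
  assert (Hre : e ^ 2 + r ^ 2 <= e ^ 2 * (1 + K ^ 2)) by nra.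
  assert (HK2 : 0 < 1 + K ^ 2) by nra.
  assert (HbC : 2 * C ^ 4 <= b).
  { apply Rmult_le_reg_l with (e ^ 2 * (1 + K ^ 2)); [nra|].
    apply Rle_trans with c; [lra|].
    apply Rle_trans with (b * (r ^ 2 + e ^ 2)); [lra|]. nra. }
  set (J := bu1 * bv2 - bu2 * bv1) in *.
  assert (HJ0 : 0 <= J).
  { apply Rmult_le_reg_l with (e ^ 2 + r ^ 2); [nra|]. rewrite Rmult_0_r.
    apply Rle_trans with (kB * e * b); [|lra]. apply Rmult_le_pos; nra. }
  assert (HJ : (4 * C ^ 3 + 2) * b <= J).
  { apply Rmult_le_reg_l with (e ^ 2 * (1 + K ^ 2)); [nra|].
    apply Rle_trans with (e * kB * b).
    - replace (e ^ 2 * (1 + K ^ 2) * ((4 * C ^ 3 + 2) * b)) with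
        (e * (e * (1 + K ^ 2) * (4 * C ^ 3 + 2)) * b) by ring.
      apply Rmult_le_compat_r; [lra|]. apply Rmult_le_compat_l; lra.
    - apply Rle_trans with ((e ^ 2 + r ^ 2) * J); [lra|]. apply Rmult_le_compat_r; lra. }
  assert (Q : forall x, Rabs x <= C * a -> Rabs x <= C ^ 2) by (intros x Hx; nra).
  assert (Q' : forall x, Rabs x <= C * e * b -> Rabs x <= C * b).
  { intros x Hx. apply Rle_trans with (1 := Hx). apply Rmult_le_compat_r; [lra|]. nra. }
  pose proof (cross_bound _ _ _ _ _ _ (Q _ Hau1) (Q _ Hau2) (Q _ Hav1) (Q _ Hav2)) as E1.
  pose proof (cross_bound _ _ _ _ _ _ (Q _ Hau1) (Q _ Hau2) (Q' _ Hbv1) (Q' _ Hbv2)) as E2.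
  pose proof (cross_bound _ _ _ _ _ _ Hbu1 Hbu2 (Q _ Hav1) (Q _ Hav2)) as E3.
  assert (HS : b <= (au1 + bu1) * (av2 + bv2) - (au2 + bu2) * (av1 + bv1)).
  { replace ((au1 + bu1) * (av2 + bv2) - (au2 + bu2) * (av1 + bv1)) with
     ((au1 * av2 - au2 * av1) + (au1 * bv2 - au2 * bv1) + (bu1 * av2 - bu2 * av1) + J) by (unfold J; ring).
    replace (C ^ 2 * C ^ 2) with (C ^ 4) in E1 by ring.
    replace (C ^ 2 * (C * b)) with (C ^ 3 * b) in E2 by ring.
    replace (C * b * C ^ 2) with (C ^ 3 * b) in E3 by ring.
    lra. }
  apply Rle_trans with b.
  - apply Rmult_le_reg_l with (1 + C); [lra|].
    rewrite <- Rmult_assoc, Rinv_r by lra. clear - Hb HaC HbC C4 HC. nra.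
  - clear - HS Hb. nra.
Qed.

(** The ratio K between the radius that separates the two zones and e is fixed before e: the far
    zone asks for a large K, and a small e then pays for it in the near zone. *)
Lemma glue_scalar (C kA kB d c K0 : R) :
  1 <= C -> 0 < kA -> 0 < kB -> 0 < d <= 1 -> 0 < c ->
  exists e0, 0 < e0 /\ forall e, 0 < e < e0 -> exists k, 0 < k /\
  forall r u a b au1 au2 av1 av2 bu1 bu2 bv1 bv2 e1 e2,
  0 < r -> u * r = 1 -> 0 <= a -> 0 <= b ->
  kA * (u ^ 2 + a) <= (1 + r ^ 2) * ((au1 + e1 * u ^ 2) * av2 - (au2 + e2 * u ^ 2) * av1) ->
  kB * e * b <= (e ^ 2 + r ^ 2) * (bu1 * bv2 - bu2 * bv1) ->
  Rabs au1 <= C * a -> Rabs au2 <= C * a -> Rabs av1 <= C * a -> Rabs av2 <= C * a ->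
  Rabs bv1 <= C * e * b -> Rabs bv2 <= C * e * b ->
  Rabs bu1 <= C * b -> Rabs bu2 <= C * b ->
  Rabs (bu1 - e1 * u ^ 2) <= C * e * (r + e) * u ^ 2 * b ->
  Rabs (bu2 - e2 * u ^ 2) <= C * e * (r + e) * u ^ 2 * b ->
  (r <= d -> a <= C) -> (K0 * e <= r -> b <= C * u ^ 2) -> c <= b * (r ^ 2 + e ^ 2) ->
  k * (a + b) <=
    (1 + r ^ 2) * ((au1 + bu1) * (av2 + bv2) - (au2 + bu2) * (av1 + bv1)).
Proof.
  intros HC HkA HkB Hd Hc.
  set (K := Rmax (Rmax 1 K0) (24 * C ^ 4 / kA)).
  assert (HK1 : 1 <= K) by (eapply Rle_trans; [apply Rmax_l|apply Rmax_l]).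
  assert (HK0 : K0 <= K) by (eapply Rle_trans; [apply Rmax_r|apply Rmax_l]).
  assert (HKk : 24 * C ^ 4 <= K * kA).
  { apply Rle_trans with (24 * C ^ 4 / kA * kA); [right; field; lra|].
    apply Rmult_le_compat_r; [lra|apply Rmax_r]. }
  pose proof (pow_lt C 3 ltac:(lra)) as C3.
  pose proof (pow_lt C 4 ltac:(lra)) as C4.
  assert (Hid : 0 < / d) by (apply Rinv_0_lt_compat; lra).
  assert (Hid2 : 0 < / d ^ 2) by (apply Rinv_0_lt_compat; nra).
  (* Smallness of e required by the far zone beyond d ([M1]), by [b] against the outer term ([M2]),
     and by the Jacobian of the cluster against the mixed terms ([M3]). The further bound d / K puts
     the near zone inside r <= d. *)
  set (M1 := (4 * C ^ 3 / d + 2 * C ^ 3) * (1 + / d ^ 2)).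
  set (M2 := (1 + K ^ 2) * (2 * C ^ 4)).
  set (M3 := (1 + K ^ 2) * (4 * C ^ 3 + 2)).
  assert (HM1 : 0 < M1).
  { unfold M1. apply Rmult_lt_0_compat; [|lra].
    assert (0 < 4 * C ^ 3 / d) by (apply Rmult_lt_0_compat; lra). lra. }
  assert (HM2 : 0 < M2) by (unfold M2; apply Rmult_lt_0_compat; nra).
  assert (HM3 : 0 < M3) by (unfold M3; apply Rmult_lt_0_compat; nra).
  exists (Rmin (Rmin 1 (d / K)) (Rmin (kA / 2 / M1) (Rmin (c / M2) (kB / M3)))).
  split.
  { repeat apply Rmin_glb_lt; try lra; apply Rdiv_lt_0_compat; lra. }
  intros e He.
  assert (T : e < 1 /\ e < d / K /\ e < kA / 2 / M1 /\ e < c / M2 /\ e < kB / M3).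
  { repeat split; (eapply Rlt_le_trans; [apply He|]).
    - eapply Rle_trans; [apply Rmin_l|apply Rmin_l].
    - eapply Rle_trans; [apply Rmin_l|apply Rmin_r].
    - eapply Rle_trans; [apply Rmin_r|apply Rmin_l].
    - eapply Rle_trans; [apply Rmin_r|]. eapply Rle_trans; [apply Rmin_r|apply Rmin_l].
    - eapply Rle_trans; [apply Rmin_r|]. eapply Rle_trans; [apply Rmin_r|apply Rmin_r]. }
  destruct T as (T1 & T2 & T3 & T4 & T5).
  apply Rlt_div_r in T2; [|lra]. apply Rlt_div_r in T3; [|lra].
  apply Rlt_div_r in T4; [|lra]. apply Rlt_div_r in T5; [|lra].
  exists (Rmin (kA / (2 * (1 + C))) (/ (1 + C))). split.
  { apply Rmin_glb_lt; [apply Rdiv_lt_0_compat; lra | apply Rinv_0_lt_compat; lra]. }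
  intros r u a b au1 au2 av1 av2 bu1 bu2 bv1 bv2 e1 e2 Hr Hur Ha Hb HA HB
    Hau1 Hau2 Hav1 Hav2 Hbv1 Hbv2 Hbu1 Hbu2 Hd1 Hd2 Hnear Hfar Hcb.
  assert (Hu : 0 < u) by (clear - Hr Hur; nra).
  destruct (Rle_dec (K * e) r) as [Hre|Hre].
  - apply Rle_trans with (kA / (2 * (1 + C)) * (a + b)).
    { apply Rmult_le_compat_r; [lra|apply Rmin_l]. }
    apply glue_scalar_far with (d := d) (K := K) (e := e) (u := u) (e1 := e1) (e2 := e2); try assumption; try lra.
    + unfold M1 in T3. lra.
    + apply Rmult_le_reg_l with (e ^ 2 + r ^ 2); [clear - Hr; nra|]. rewrite Rmult_0_r.
      eapply Rle_trans; [|apply HB]. repeat apply Rmult_le_pos; lra.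
    + apply Hfar. apply Rle_trans with (K * e); [|lra]. apply Rmult_le_compat_r; lra.
  - apply Rnot_le_lt in Hre.
    apply Rle_trans with (/ (1 + C) * (a + b)).
    { apply Rmult_le_compat_r; [lra|apply Rmin_r]. }
    assert (P1 : e ^ 2 * (1 + K ^ 2) * (2 * C ^ 4) <= c) by (unfold M2 in T4; clear - T4 He T1; assert (e ^ 2 <= e) by nra; assert (0 <= (1 + K ^ 2) * (2 * C ^ 4)) by (pose proof (pow2_ge_0 K); pose proof (pow2_ge_0 (C ^ 2)); replace (C ^ 4) with ((C ^ 2) ^ 2) by ring; apply Rmult_le_pos; lra); nra).
    assert (P2 : e * (1 + K ^ 2) * (4 * C ^ 3 + 2) <= kB) by (unfold M3 in T5; lra).
    assert (P3 : a <= C) by (apply Hnear; lra).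
    apply glue_scalar_near with (kB := kB) (K := K) (c := c) (e := e); try assumption; lra.
Qed.

(** * Finite sums *)

Fixpoint bsum (g : nat -> R) (m : nat) : R :=
  match m with O => 0 | S m' => bsum g m' + g m' end.

Lemma bsum_ext g h m : (forall k, (k < m)%nat -> g k = h k) -> bsum g m = bsum h m.
Proof.
  induction m as [|m IH]; simpl; intros H; [reflexivity|].
  rewrite IH, H; auto.
Qed.

Lemma bsum_scal a g m : bsum (fun k => a * g k) m = a * bsum g m.
Proof. induction m as [|m IH]; simpl; [ring|rewrite IH; ring]. Qed.

Lemma bsum_plus g h m : bsum (fun k => g k + h k) m = bsum g m + bsum h m.
Proof. induction m as [|m IH]; simpl; [ring|rewrite IH; ring]. Qed.

Lemma bsum_minus g h m : bsum (fun k => g k - h k) m = bsum g m - bsum h m.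
Proof. induction m as [|m IH]; simpl; [ring|rewrite IH; ring]. Qed.

Lemma bsum_split g m p : bsum g (m + p) = bsum g m + bsum (fun k => g (m + k)%nat) p.
Proof.
  induction p as [|p IH]; simpl; [rewrite Nat.add_0_r; ring|].
  rewrite Nat.add_succ_r. simpl. rewrite IH. ring.
Qed.

Lemma bsum_recl g m : bsum g (S m) = g O + bsum (fun k => g (S k)) m.
Proof. induction m as [|m IH]; [simpl; ring|]. change (bsum g (S (S m))) with (bsum g (S m) + g (S m)). rewrite IH. simpl. ring. Qed.

Lemma bsum_le g h m : (forall k, (k < m)%nat -> g k <= h k) -> bsum g m <= bsum h m.
Proof.
  induction m as [|m IH]; simpl; intros H; [lra|].
  apply Rplus_le_compat; auto.
Qed.

Lemma bsum_0 m : bsum (fun _ => 0) m = 0.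
Proof. induction m as [|m IH]; simpl; [|rewrite IH]; ring. Qed.

Lemma bsum_ge0 g m : (forall k, (k < m)%nat -> 0 <= g k) -> 0 <= bsum g m.
Proof. intros H. rewrite <- (bsum_0 m). now apply bsum_le. Qed.

Lemma bsum_Rabs g h m : (forall k, (k < m)%nat -> Rabs (g k) <= h k) -> Rabs (bsum g m) <= bsum h m.
Proof.
  induction m as [|m IH]; simpl; intros H; [rewrite Rabs_R0; lra|].
  eapply Rle_trans; [apply Rabs_triang|]. apply Rplus_le_compat; auto.
Qed.

Lemma bsum_const a m : bsum (fun _ => a) m = INR m * a.
Proof. induction m as [|m IH]; [simpl; ring|]. rewrite S_INR. simpl. rewrite IH. ring. Qed.

Lemma bsum_term_le g m k : (forall j, (j < m)%nat -> 0 <= g j) -> (k < m)%nat -> g k <= bsum g m.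
Proof.
  induction m as [|m IH]; intros H Hk; [lia|]. simpl.
  destruct (Nat.eq_dec k m) as [->|Hne].
  - assert (0 <= bsum g m) by (apply bsum_ge0; auto). lra.
  - assert (g k <= bsum g m) by (apply IH; [auto|lia]). specialize (H m ltac:(lia)). lra.
Qed.

Lemma bsum_telescope (g : nat -> R) m : bsum (fun k => g (S k) - g k) m = g m - g O.
Proof. induction m as [|m IH]; simpl; [ring|rewrite IH; ring]. Qed.

(** * The Jacobian as a cross product of sums over the jumps *)

Definition cross (a b : Cpt) : R := fst a * snd b - snd a * fst b.

(* Squared distance from X + iY to the boundary point x of the upper half-plane. *)
Definition sqd (x X Y : R) : R := (X - x) * (X - x) + Y * Y.

Definition wsum (m : nat) (x : nat -> R) (X Y : R) : R := bsum (fun k => / sqd (x k) X Y) m.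
Definition usum (m : nat) (a : nat -> R) (x : nat -> R) (X Y : R) : R :=
  bsum (fun k => a k / sqd (x k) X Y) m.

(* Up to the factor Y / PI^2, the Jacobian of the harmonic map of the upper
   half-plane whose boundary values jump by [e k] at [x k]. *)
Definition jac (m : nat) (e : nat -> Cpt) (x : nat -> R) (X Y : R) : R :=
  usum m (fun k => fst (e k)) x X Y * usum m (fun k => snd (e k) * x k) x X Y
  - usum m (fun k => snd (e k)) x X Y * usum m (fun k => fst (e k) * x k) x X Y.

(* The weights make the positivity uniform up to the boundary and at infinity. *)
Definition jac_positive (m : nat) (e : nat -> Cpt) (x : nat -> R) : Prop :=
  exists k, 0 < k /\ forall X Y, 0 < Y ->
    k * wsum m x X Y <= (1 + (X * X + Y * Y)) * jac m e x X Y.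

Lemma mul_self_ge0 a : 0 <= a * a.
Proof. exact (Rle_0_sqr a). Qed.

Lemma sqd_pos x X Y : 0 < Y -> 0 < sqd x X Y.
Proof. intros HY. unfold sqd. pose proof (mul_self_ge0 (X - x)). assert (0 < Y * Y) by (now apply Rmult_lt_0_compat). lra. Qed.

Lemma jac_ext m e e' x x' X Y :
  (forall k, (k < m)%nat -> e k = e' k) -> (forall k, (k < m)%nat -> x k = x' k) ->
  jac m e x X Y = jac m e' x' X Y.
Proof.
  intros He Hx. unfold jac, usum.
  f_equal; f_equal; apply bsum_ext; intros k Hk; rewrite ?He, ?Hx; auto.
Qed.

Lemma jac_positive_ext m e e' x x' :
  (forall k, (k < m)%nat -> e k = e' k) -> (forall k, (k < m)%nat -> x k = x' k) ->
  jac_positive m e x -> jac_positive m e' x'.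
Proof.
  intros He Hx (k & Hk & H). exists k; split; [exact Hk|]. intros X Y HY.
  rewrite <- (jac_ext m e e' x x') by assumption.
  replace (wsum m x' X Y) with (wsum m x X Y); [now apply H|].
  apply bsum_ext. intros j Hj. now rewrite Hx.
Qed.

(** The cross product does not see the translation, because the second sum only loses [a] times the
    first. The weight changes by a bounded factor: 1 + (X + a)^2 + Y^2 <= 2 (1 + a^2) (1 + X^2 +
    Y^2). *)
Lemma jac_positive_translate m e x a :
  jac_positive m e x -> jac_positive m e (fun k => x k - a).
Proof.
  intros (k & Hk & H).
  set (D := 2 * (1 + a * a)).
  assert (HD : 0 < D) by (unfold D; nra).
  exists (k / D). split; [now apply Rdiv_lt_0_compat|].
  intros X Y HY.
  specialize (H (X + a) Y HY).
  assert (Hsq : forall j, sqd (x j - a) X Y = sqd (x j) (X + a) Y) by (intros j; unfold sqd; ring).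
  assert (HW : wsum m (fun j => x j - a) X Y = wsum m x (X + a) Y).
  { apply bsum_ext; intros j Hj. now rewrite Hsq. }
  assert (HU : forall g, usum m g (fun j => x j - a) X Y = usum m g x (X + a) Y).
  { intros g. apply bsum_ext; intros j Hj. now rewrite Hsq. }
  assert (HV : forall g, usum m (fun j => g j * (x j - a)) x (X + a) Y =
               usum m (fun j => g j * x j) x (X + a) Y - a * usum m g x (X + a) Y).
  { intros g. unfold usum. rewrite <- bsum_scal, <- bsum_minus.
    apply bsum_ext; intros j Hj. field. apply Rgt_not_eq. now apply sqd_pos. }
  assert (HJ : jac m e (fun j => x j - a) X Y = jac m e x (X + a) Y).
  { unfold jac. rewrite !HU, !HV. ring. }
  rewrite HJ, HW.
  assert (W0 : 0 <= wsum m x (X + a) Y).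
  { apply bsum_ge0; intros j _. left. apply Rinv_0_lt_compat. now apply sqd_pos. }
  set (J := jac m e x (X + a) Y) in *.
  assert (J0 : 0 <= J).
  { apply Rmult_le_reg_l with (1 + ((X + a) * (X + a) + Y * Y)); [pose proof (mul_self_ge0 (X + a)); pose proof (mul_self_ge0 Y); lra|]. rewrite Rmult_0_r.
    eapply Rle_trans; [|apply H]. apply Rmult_le_pos; lra. }
  apply Rmult_le_reg_l with D; [exact HD|].
  replace (D * (k / D * wsum m x (X + a) Y)) with (k * wsum m x (X + a) Y) by (field; lra).
  eapply Rle_trans; [apply H|]. rewrite <- Rmult_assoc. apply Rmult_le_compat_r; [exact J0|].
  unfold D. pose proof (mul_self_ge0 (X - a)). pose proof (mul_self_ge0 (a * Y)).
  pose proof (mul_self_ge0 (a * X)). pose proof (mul_self_ge0 Y). pose proof (mul_self_ge0 X). lra.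
Qed.

(** With two finite jumps the double sum contains a single cross product, so positivity amounts to
    the left turn, wherever the two points are. *)
Lemma jac_positive_triangle e x :
  x 0%nat < x 1%nat -> 0 < cross (e 0%nat) (e 1%nat) -> jac_positive 2 e x.
Proof.
  intros Hx He.
  set (d := x 1%nat - x 0%nat). assert (Hd : 0 < d) by (unfold d; lra).
  set (D := 4 + 2 * (x 0%nat * x 0%nat) + 2 * (x 1%nat * x 1%nat)).
  assert (HD : 0 < D).
  { unfold D. pose proof (mul_self_ge0 (x 0%nat)). pose proof (mul_self_ge0 (x 1%nat)). lra. }
  exists (cross (e 0%nat) (e 1%nat) * d / D).
  split; [apply Rdiv_lt_0_compat; nra|].
  intros X Y HY.
  pose proof (sqd_pos (x 0%nat) X Y HY) as H0. pose proof (sqd_pos (x 1%nat) X Y HY) as H1.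
  assert (HJ : jac 2 e x X Y = cross (e 0%nat) (e 1%nat) * d / (sqd (x 0%nat) X Y * sqd (x 1%nat) X Y)).
  { unfold jac, usum, cross, d. simpl. field. lra. }
  assert (HW : wsum 2 x X Y = (sqd (x 0%nat) X Y + sqd (x 1%nat) X Y) / (sqd (x 0%nat) X Y * sqd (x 1%nat) X Y)).
  { unfold wsum. simpl. field. lra. }
  rewrite HJ, HW.
  assert (HDs : sqd (x 0%nat) X Y + sqd (x 1%nat) X Y <= D * (1 + (X * X + Y * Y))).
  { unfold sqd, D.
    pose proof (mul_self_ge0 (X + x 0%nat)). pose proof (mul_self_ge0 (X + x 1%nat)).
    pose proof (mul_self_ge0 (X * x 0%nat)). pose proof (mul_self_ge0 (X * x 1%nat)).
    pose proof (mul_self_ge0 (Y * x 0%nat)). pose proof (mul_self_ge0 (Y * x 1%nat)).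
    pose proof (mul_self_ge0 X). pose proof (mul_self_ge0 Y). lra. }
  set (p := sqd (x 0%nat) X Y) in *. set (q := sqd (x 1%nat) X Y) in *.
  set (cr := cross (e 0%nat) (e 1%nat)) in *.
  replace (cr * d / D * ((p + q) / (p * q))) with ((p + q) * (cr * d / (D * (p * q)))) by (field; lra).
  replace ((1 + (X * X + Y * Y)) * (cr * d / (p * q))) with (D * (1 + (X * X + Y * Y)) * (cr * d / (D * (p * q)))) by (field; lra).
  apply Rmult_le_compat_r; [|exact HDs].
  left. apply Rdiv_lt_0_compat; repeat apply Rmult_lt_0_compat; lra.
Qed.

(** The inversion x -> -1/x sends the first jump, placed at 0, to infinity and brings the edge at
    infinity to 0. That edge closes the polygon, hence it is minus the sum of the others; it comes
    last because positive points go to negative ones. *)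
Definition rot_edges (p : nat) (g : nat -> R) (k : nat) : R :=
  if Nat.ltb k p then g (S k) else - bsum g (S p).
Definition rot_jumps (p : nat) (x : nat -> R) (k : nat) : R :=
  if Nat.ltb k p then - / x (S k) else 0.

Lemma rot_sum p (g h : nat -> R) (b : R) :
  bsum (fun k => if Nat.ltb k p then g k else b) (S p) = bsum g p + b.
Proof.
  simpl. rewrite Nat.ltb_irrefl. f_equal. apply bsum_ext. intros k Hk.
  now rewrite (proj2 (Nat.ltb_lt k p) Hk).
Qed.

(** The point (-X/N, Y/N) with N = X^2 + Y^2 is -1/z, and |-1/x - z| = |z| |x + 1/z| / |x|. *)
Lemma sqd_inversion x X Y : x <> 0 -> 0 < Y ->
  sqd (- / x) X Y = (X * X + Y * Y) / (x * x) * sqd x (- X / (X * X + Y * Y)) (Y / (X * X + Y * Y)).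
Proof.
  intros Hx HY. unfold sqd. assert (X * X + Y * Y <> 0) by (pose proof (mul_self_ge0 X); nra). field. now split.
Qed.

(** Put w = -1/z. In the numerators left by the inversion write x^2 = |w - x|^2 + 2 Re(w) x - |w|^2.
    The first term sums to a constant, which together with the new edge at 0 gives the contribution
    of the old jump at 0; the rest is a combination of the two old sums at w. *)
Lemma rot_usum p g x X Y : 0 < Y -> x 0%nat = 0 -> (forall k, (k < p)%nat -> x (S k) <> 0) ->
  let N := X * X + Y * Y in
  usum (S p) (rot_edges p g) (rot_jumps p x) X Y =
  / N * (2 * (- X / N) * usum (S p) (fun k => g k * x k) x (- X / N) (Y / N)
         - / N * usum (S p) g x (- X / N) (Y / N)).
Proof.
  intros HY H0 Hx N.
  assert (HN : 0 < N) by (unfold N; pose proof (mul_self_ge0 X); nra).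
  assert (HYN : 0 < Y / N) by now apply Rdiv_lt_0_compat.
  unfold usum.
  rewrite (bsum_ext _ (fun k => if Nat.ltb k p then g (S k) / sqd (- / x (S k)) X Y
       else (- bsum g (S p)) / sqd 0 X Y)).
  2:{ intros k _. unfold rot_edges, rot_jumps. now destruct (Nat.ltb k p). }
  rewrite (rot_sum p (fun k => g (S k) / sqd (- / x (S k)) X Y)) by assumption.
  rewrite !bsum_recl, H0.
  rewrite (bsum_ext (fun k => g (S k) / sqd (- / x (S k)) X Y)
    (fun k => / N * (g (S k) + (2 * (- X / N) * (g (S k) * x (S k) / sqd (x (S k)) (- X / N) (Y / N))
       - / N * (g (S k) / sqd (x (S k)) (- X / N) (Y / N)))))).
  2:{ intros k Hk. specialize (Hx k Hk).
      rewrite sqd_inversion by assumption. fold N.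
      pose proof (sqd_pos (x (S k)) (- X / N) (Y / N) HYN) as Hs.
      assert (E : sqd (x (S k)) (- X / N) (Y / N) = x (S k) * x (S k) + 2 * (X / N) * x (S k) + / N).
      { unfold sqd. unfold N. field. apply Rgt_not_eq. exact HN. }
      assert (E2 : x (S k) * x (S k) = sqd (x (S k)) (- X / N) (Y / N) - 2 * (X / N) * x (S k) - / N) by lra.
      transitivity (g (S k) * (x (S k) * x (S k)) / (N * sqd (x (S k)) (- X / N) (Y / N))).
      { field. repeat split; try lra; assumption. }
      rewrite E2. field. repeat split; try lra. }
  rewrite bsum_scal, bsum_plus, bsum_minus, !bsum_scal.
  assert (S0 : sqd 0 (- X / N) (Y / N) = / N).
  { unfold sqd. unfold N. field. apply Rgt_not_eq. exact HN. }
  assert (S1 : sqd 0 X Y = N) by (unfold sqd, N; ring).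
  rewrite S0, S1. field. lra.
Qed.

(** The new sums are linear in the old ones taken at w = -1/z, and the Jacobian gets divided by N^3
    with N = |z|^2. As [wsum] gains at most a constant times 1/N^2 and 1 + N = N (1 + 1/N), the
    weight 1 + |z|^2 supplies exactly the missing factor. *)
Lemma jac_positive_rot p e x :
  x 0%nat = 0 -> (forall k, (k < p)%nat -> x (S k) <> 0) -> jac_positive (S p) e x ->
  jac_positive (S p) (fun k => (rot_edges p (fun j => fst (e j)) k, rot_edges p (fun j => snd (e j)) k))
    (rot_jumps p x).
Proof.
  intros H0 Hx (k & Hk & H).
  assert (HP : 0 < 2 * INR p + 2) by (pose proof (pos_INR p); lra).
  exists (k / (2 * INR p + 2)). split; [now apply Rdiv_lt_0_compat|].
  intros X Y HY.
  set (N := X * X + Y * Y).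
  assert (HN : 0 < N) by (unfold N; pose proof (mul_self_ge0 X); nra).
  assert (HYN : 0 < Y / N) by now apply Rdiv_lt_0_compat.
  specialize (H (- X / N) (Y / N) HYN).
  assert (HNN : - X / N * (- X / N) + Y / N * (Y / N) = / N).
  { unfold N. field. apply Rgt_not_eq. exact HN. }
  rewrite HNN in H.
  assert (HV : forall g, usum (S p) (fun k => rot_edges p g k * rot_jumps p x k) (rot_jumps p x) X Y =
      - / N * usum (S p) (fun k => g k * x k) x (- X / N) (Y / N)).
  { intros g. unfold usum.
    rewrite (bsum_ext _ (fun k => if Nat.ltb k p then g (S k) * (- / x (S k)) / sqd (- / x (S k)) X Y
       else 0)).
    2:{ intros j _. unfold rot_edges, rot_jumps. destruct (Nat.ltb j p); [reflexivity|].
        unfold Rdiv. ring. }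
    rewrite (rot_sum p (fun k => g (S k) * (- / x (S k)) / sqd (- / x (S k)) X Y)) by assumption.
    rewrite bsum_recl, H0.
    rewrite (bsum_ext _ (fun k => - / N * (g (S k) * x (S k) / sqd (x (S k)) (- X / N) (Y / N)))).
    2:{ intros j Hj. specialize (Hx j Hj). rewrite sqd_inversion by assumption. fold N.
        pose proof (sqd_pos (x (S j)) (- X / N) (Y / N) HYN) as Hs.
        field. repeat split; try lra; assumption. }
    rewrite bsum_scal. unfold Rdiv. ring. }
  assert (HJ : jac (S p) (fun k => (rot_edges p (fun j => fst (e j)) k, rot_edges p (fun j => snd (e j)) k))
    (rot_jumps p x) X Y = / N * / N * / N * jac (S p) e x (- X / N) (Y / N)).
  { unfold jac. simpl fst; simpl snd.
    pose proof (rot_usum p (fun j => fst (e j)) x X Y HY H0 Hx) as U1.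
    pose proof (rot_usum p (fun j => snd (e j)) x X Y HY H0 Hx) as U2.
    pose proof (HV (fun j => fst (e j))) as V1. pose proof (HV (fun j => snd (e j))) as V2.
    cbv zeta in U1, U2. fold N in U1, U2. cbv beta in U1, U2, V1, V2.
    change (fun k0 => rot_edges p (fun j => fst (e j)) k0) with (rot_edges p (fun j => fst (e j))).
    change (fun k0 => rot_edges p (fun j => snd (e j)) k0) with (rot_edges p (fun j => snd (e j))).
    rewrite U1, U2, V1, V2. ring. }
  rewrite HJ.
  set (J := jac (S p) e x (- X / N) (Y / N)) in *.
  set (Q := bsum (fun k => / sqd (x (S k)) (- X / N) (Y / N)) p).
  assert (HQ : 0 <= Q).
  { apply bsum_ge0. intros j _. left. apply Rinv_0_lt_compat. now apply sqd_pos. }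
  assert (HN' : 0 < / N) by now apply Rinv_0_lt_compat.
  assert (HNi : N * / N = 1) by (apply Rinv_r; lra).
  assert (HW : wsum (S p) x (- X / N) (Y / N) = N + Q).
  { unfold wsum. rewrite bsum_recl, H0. fold Q. f_equal.
    replace (sqd 0 (- X / N) (Y / N)) with (/ N); [apply Rinv_inv|].
    unfold sqd. rewrite Rminus_0_r. symmetry. exact HNN. }
  (* Each inverted jump costs at most 2/N + 2/(N^2 |w - x|^2), by x^2 <= 2 |w - x|^2 + 2 |w|^2. The
     old jump at 0 gives the summand N of [wsum] at w, against which the terms of order 1/N are
     charged; this is where 2 p + 2 comes from. *)
  assert (HW' : wsum (S p) (rot_jumps p x) X Y <= (2 * INR p + 2) * (/ N * / N) * (N + Q)).
  { unfold wsum.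
    rewrite (bsum_ext _ (fun k => if Nat.ltb k p then / sqd (- / x (S k)) X Y else / N)).
    2:{ intros j _. unfold rot_jumps. destruct (Nat.ltb j p); [reflexivity|].
        f_equal. unfold sqd, N. ring. }
    rewrite (rot_sum p (fun k => / sqd (- / x (S k)) X Y)) by assumption.
    apply Rle_trans with (bsum (fun k => 2 * / N + 2 * (/ N * / N) * / sqd (x (S k)) (- X / N) (Y / N)) p + / N).
    - apply Rplus_le_compat_r. apply bsum_le. intros j Hj. specialize (Hx j Hj).
      rewrite sqd_inversion by assumption. fold N.
      pose proof (sqd_pos (x (S j)) (- X / N) (Y / N) HYN) as Hs.
      assert (E : sqd (x (S j)) (- X / N) (Y / N) = x (S j) * x (S j) + 2 * (X / N) * x (S j) + / N).
      { unfold sqd. unfold N. field. apply Rgt_not_eq. exact HN. }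
      set (s := sqd (x (S j)) (- X / N) (Y / N)) in *.
      replace (/ (N / (x (S j) * x (S j)) * s)) with (/ N * (x (S j) * x (S j) * / s)) by (field; repeat split; try lra; assumption).
      replace (2 * / N + 2 * (/ N * / N) * / s) with (/ N * ((2 * s + 2 * / N) * / s)) by (field; lra).
      apply Rmult_le_compat_l; [lra|]. apply Rmult_le_compat_r; [left; now apply Rinv_0_lt_compat|].
      assert (HXN : (X / N) * (X / N) <= / N).
      { rewrite <- HNN. pose proof (mul_self_ge0 (Y / N)). unfold Rdiv in *. lra. }
      pose proof (mul_self_ge0 (x (S j) + 2 * (X / N))). lra.
    - rewrite bsum_plus, bsum_const, bsum_scal. fold Q.
      assert (0 <= INR p) by apply pos_INR.
      assert (0 <= / N * / N * Q * INR p) by (repeat apply Rmult_le_pos; lra).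
      replace ((2 * INR p + 2) * (/ N * / N) * (N + Q)) with
       ((2 * INR p + 2) * (N * / N) * / N + 2 * (/ N * / N) * Q + 2 * (/ N * / N * Q * INR p)) by ring.
      rewrite HNi. lra. }
  rewrite HW in H.
  apply Rle_trans with (k / (2 * INR p + 2) * ((2 * INR p + 2) * (/ N * / N) * (N + Q))).
  - apply Rmult_le_compat_l; [left; now apply Rdiv_lt_0_compat|exact HW'].
  - replace (k / (2 * INR p + 2) * ((2 * INR p + 2) * (/ N * / N) * (N + Q))) with
      (/ N * / N * (k * (N + Q))) by (field; lra).
    replace ((1 + N) * (/ N * / N * / N * J)) with (/ N * / N * ((1 + / N) * J)) by (field; lra).
    apply Rmult_le_compat_l; [nra|exact H].
Qed.

(** * Inserting a small cluster of jumps *)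

(** The second sequence enters from its index 1: its entry 0, the jump of the diagonal, is what the
    first m entries replace. *)
Definition glued {T : Type} (m : nat) (f g : nat -> T) (k : nat) : T :=
  if Nat.ltb k m then f k else g (S (k - m)).

Lemma bsum_glued (F : nat -> R) m1 m2 (f g : nat -> R) :
  (forall k, (k < m1)%nat -> F k = f k) ->
  (forall k, (k < m2)%nat -> F (m1 + k)%nat = g k) ->
  bsum F (m1 + m2) = bsum f m1 + bsum g m2.
Proof.
  intros H1 H2. rewrite bsum_split. f_equal; apply bsum_ext; assumption.
Qed.

Lemma glued_l {T} m (f g : nat -> T) k : (k < m)%nat -> glued m f g k = f k.
Proof. intros H. unfold glued. now rewrite (proj2 (Nat.ltb_lt k m) H). Qed.

Lemma glued_r {T} m (f g : nat -> T) k : glued m f g (m + k)%nat = g (S k).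
Proof.
  unfold glued. rewrite (proj2 (Nat.ltb_ge (m + k) m)) by lia. do 2 f_equal. lia.
Qed.

Lemma usum_bound m g x X Y C : 0 < Y -> (forall k, (k < m)%nat -> Rabs (g k) <= C) ->
  Rabs (usum m g x X Y) <= C * wsum m x X Y.
Proof.
  intros HY H. unfold usum, wsum. rewrite <- bsum_scal. apply bsum_Rabs. intros k Hk.
  unfold Rdiv. rewrite Rabs_mult.
  pose proof (Rinv_0_lt_compat _ (sqd_pos (x k) X Y HY)) as Hs.
  rewrite (Rabs_right (/ _)) by lra. apply Rmult_le_compat_r; [lra|auto].
Qed.

Lemma finite_bound (g : nat -> R) m : exists C, 0 <= C /\ forall k, (k < m)%nat -> Rabs (g k) <= C.
Proof.
  exists (bsum (fun k => Rabs (g k)) m). split.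
  - apply bsum_ge0. intros; apply Rabs_pos.
  - intros k Hk. apply (bsum_term_le (fun k => Rabs (g k))); auto using Rabs_pos.
Qed.

Lemma positive_min (g : nat -> R) m : (forall k, (k < m)%nat -> 0 < g k) ->
  exists d, 0 < d /\ forall k, (k < m)%nat -> d <= g k.
Proof.
  induction m as [|m IH]; intros H.
  - exists 1. split; [lra|]. intros k Hk; lia.
  - destruct IH as (d & Hd & Hm); [auto|].
    exists (Rmin d (g m)). split; [apply Rmin_glb_lt; auto|].
    intros k Hk. destruct (Nat.eq_dec k m) as [->|Hne]; [apply Rmin_r|].
    eapply Rle_trans; [apply Rmin_l|]. apply Hm. lia.
Qed.

Lemma abs_le_of_sq a b : 0 <= b -> a * a <= b * b -> Rabs a <= b.
Proof.
  intros Hb H. rewrite <- (Rabs_right b) by lra. apply Rsqr_le_abs_0. exact H.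
Qed.

(* The inner configuration, shrunk by a small factor, replaces the first jump
   of the outer one.  Far from that jump the outer Jacobian dominates, near it
   the inner one does. *)
Lemma jac_positive_glue m1 e1 y m2 e2 x :
  (1 <= m1)%nat -> jac_positive m1 e1 y -> jac_positive (S m2) e2 x ->
  x 0%nat = 0 -> (forall k, (k < m2)%nat -> 0 < x (S k)) ->
  fst (e2 0%nat) = bsum (fun k => fst (e1 k)) m1 ->
  snd (e2 0%nat) = bsum (fun k => snd (e1 k)) m1 ->
  exists eps0, 0 < eps0 /\ forall eps, 0 < eps < eps0 ->
    jac_positive (m1 + m2) (glued m1 e1 e2) (glued m1 (fun k => eps * y k) x).
Proof.
  intros Hm1 (kB & HkB & HB) (kA & HkA & HA) Hx0 Hx He1 He2.
  destruct (finite_bound (fun k => fst (e1 k)) m1) as (C1 & HC1 & B1).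
  destruct (finite_bound (fun k => snd (e1 k)) m1) as (C2 & HC2 & B2).
  destruct (finite_bound (fun k => fst (e2 (S k))) m2) as (C3 & HC3 & B3).
  destruct (finite_bound (fun k => snd (e2 (S k))) m2) as (C4 & HC4 & B4).
  destruct (finite_bound y m1) as (C5 & HC5 & B5).
  destruct (finite_bound (fun k => fst (e2 (S k)) * x (S k)) m2) as (C6 & HC6 & B6).
  destruct (finite_bound (fun k => snd (e2 (S k)) * x (S k)) m2) as (C7 & HC7 & B7).
  destruct (positive_min (fun k => x (S k)) m2 Hx) as (d0 & Hd0 & Bd).
  set (d := Rmin 1 (d0 / 2)).
  assert (Hd : 0 < d <= 1) by (split; [apply Rmin_glb_lt; lra | apply Rmin_l]).
  assert (Hd2 : d <= d0 / 2) by apply Rmin_r.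
  assert (Hm1R : 1 <= INR m1) by (apply (le_INR 1); exact Hm1).
  pose proof (pos_INR m2) as Hm2R.
  assert (Hdd : 0 < / (d * d)) by (apply Rinv_0_lt_compat; nra).
  (* From |z|^2 - |z - eps y|^2 = 2 X eps y - (eps y)^2 with |y| <= [C5] and |X| <= r: the modulus
     is at most [Y2] eps (r + eps). *)
  set (Y2 := 2 * C5 + C5 * C5). assert (HY2 : 0 <= Y2) by (unfold Y2; nra).
  set (C := 1 + C1 + C2 + C3 + C4 + C6 + C7 + (C1 + C2) * C5 + (C1 + C2) * Y2 + INR m2 * / (d * d) + 4 * INR m1).
  assert (P1 : 0 <= C1 * C5) by now apply Rmult_le_pos. assert (P1' : 0 <= C2 * C5) by now apply Rmult_le_pos.
  assert (P2 : 0 <= C1 * Y2) by now apply Rmult_le_pos. assert (P2' : 0 <= C2 * Y2) by now apply Rmult_le_pos.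
  assert (P3 : 0 <= INR m2 * / (d * d)) by (apply Rmult_le_pos; lra).
  set (c := / (2 + 2 * (C5 * C5))).
  assert (Hc : 0 < c) by (apply Rinv_0_lt_compat; nra).
  (* For r >= 2 [C5] eps the cluster lies within r/2 of 0, so each of its terms is at most 4/r^2.
     The constant [c] bounds b (r^2 + eps^2) from below through the first cluster term alone, as |z
     - eps y|^2 <= 2 r^2 + 2 eps^2 [C5]^2. *)
  destruct (glue_scalar C kA kB d c (2 * C5)) as (eps0 & Heps0 & G); try assumption; [unfold C; lra|].
  exists eps0; split; [exact Heps0|]. intros eps Heps.
  destruct (G eps Heps) as (k & Hk & Hfin). clear G.
  exists k; split; [exact Hk|]. intros X Y HY.
  assert (HNp : 0 < X * X + Y * Y) by (pose proof (mul_self_ge0 X); nra).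
  set (r := sqrt (X * X + Y * Y)).
  assert (Hr : 0 < r) by (apply sqrt_lt_R0; exact HNp).
  assert (Hrr : r * r = X * X + Y * Y) by (apply sqrt_sqrt; lra).
  set (u := / r). assert (Hur : u * r = 1) by (apply Rinv_l; lra).
  assert (Hu2 : u ^ 2 = / (X * X + Y * Y)) by (rewrite <- Hrr; unfold u; field; lra).
  assert (HXr : Rabs X <= r).
  { apply abs_le_of_sq; [lra|]. rewrite Hrr. pose proof (mul_self_ge0 Y). lra. }
  set (ys := fun k => eps * y k). set (xs := fun k => x (S k)).
  set (a := wsum m2 xs X Y). set (b := wsum m1 ys X Y).
  assert (Ha : 0 <= a).
  { apply bsum_ge0; intros j _. left. apply Rinv_0_lt_compat. now apply sqd_pos. }
  assert (Hb : 0 <= b).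
  { apply bsum_ge0; intros j _. left. apply Rinv_0_lt_compat. now apply sqd_pos. }
  set (AU := fun g : Cpt -> R => usum m2 (fun k => g (e2 (S k))) xs X Y).
  set (AV := fun g : Cpt -> R => usum m2 (fun k => g (e2 (S k)) * xs k) xs X Y).
  set (BU := fun g : Cpt -> R => usum m1 (fun k => g (e1 k)) ys X Y).
  set (BV := fun g : Cpt -> R => usum m1 (fun k => g (e1 k) * ys k) ys X Y).
  assert (GU : forall g, usum (m1 + m2) (fun k => g (glued m1 e1 e2 k)) (glued m1 ys x) X Y = AU g + BU g).
  { intros g. unfold usum. rewrite Rplus_comm. apply bsum_glued; intros j Hj.
    - now rewrite !glued_l.
    - now rewrite !glued_r. }
  assert (GV : forall g, usum (m1 + m2) (fun k => g (glued m1 e1 e2 k) * glued m1 ys x k) (glued m1 ys x) X Y = AV g + BV g).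
  { intros g. unfold usum. rewrite Rplus_comm. apply bsum_glued; intros j Hj.
    - now rewrite !glued_l.
    - now rewrite !glued_r. }
  assert (GW : wsum (m1 + m2) (glued m1 ys x) X Y = a + b).
  { unfold wsum. rewrite Rplus_comm. apply bsum_glued; intros j Hj.
    - now rewrite !glued_l.
    - now rewrite !glued_r. }
  unfold jac. rewrite (GU fst), (GU snd), (GV fst), (GV snd), GW.
  replace (X * X + Y * Y) with (r ^ 2) by (simpl; lra).
  assert (Hs0 : sqd 0 X Y = X * X + Y * Y) by (unfold sqd; ring).
  specialize (Hfin r u a b (AU fst) (AU snd) (AV fst) (AV snd) (BU fst) (BU snd) (BV fst) (BV snd)
    (fst (e2 0%nat)) (snd (e2 0%nat)) Hr Hur Ha Hb).
  assert (Q1 : Rabs (AU fst) <= C3 * a) by (apply usum_bound; assumption).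
  assert (Q2 : Rabs (AU snd) <= C4 * a) by (apply usum_bound; assumption).
  assert (Q3 : Rabs (AV fst) <= C6 * a) by (apply usum_bound; assumption).
  assert (Q4 : Rabs (AV snd) <= C7 * a) by (apply usum_bound; assumption).
  assert (Q5 : Rabs (BU fst) <= C1 * b) by (apply usum_bound; assumption).
  assert (Q6 : Rabs (BU snd) <= C2 * b) by (apply usum_bound; assumption).
  assert (QV : forall g K, 0 <= K -> (forall k, (k < m1)%nat -> Rabs (g (e1 k)) <= K) -> Rabs (BV g) <= K * C5 * eps * b).
  { intros g K HK HgK. apply usum_bound; [assumption|]. intros j Hj. unfold ys.
    rewrite !Rabs_mult, (Rabs_right eps) by lra.
    replace (K * C5 * eps) with (K * (eps * C5)) by ring.
    apply Rmult_le_compat; auto using Rabs_pos.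
    - apply Rmult_le_pos; [lra|apply Rabs_pos].
    - apply Rmult_le_compat_l; [lra|auto]. }
  assert (Hys : forall j, sqd (ys j) X Y = r * r - 2 * X * (eps * y j) + (eps * y j) * (eps * y j)).
  { intros j. unfold sqd, ys. rewrite Hrr. ring. }
  assert (QD : forall g K, 0 <= K -> (forall k, (k < m1)%nat -> Rabs (g (e1 k)) <= K) ->
     Rabs (BU g - bsum (fun k => g (e1 k)) m1 * u ^ 2) <= K * Y2 * eps * (r + eps) * u ^ 2 * b).
  { intros g K HK HgK. unfold BU, usum, b, wsum.
    rewrite (Rmult_comm (bsum _ _) (u ^ 2)), <- !bsum_scal, <- bsum_minus.
    apply bsum_Rabs. intros j Hj.
    pose proof (sqd_pos (ys j) X Y HY) as Hs.
    replace (g (e1 j) / sqd (ys j) X Y - u ^ 2 * g (e1 j)) with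
       (g (e1 j) * (r * r - sqd (ys j) X Y) * (u ^ 2 * / sqd (ys j) X Y)).
    2:{ rewrite Hrr, Hu2. field. lra. }
    assert (Hup : 0 < u ^ 2 * / sqd (ys j) X Y).
    { apply Rmult_lt_0_compat; [rewrite Hu2|]; now apply Rinv_0_lt_compat. }
    rewrite Rabs_mult, (Rabs_right (u ^ 2 * _)) by lra. rewrite Rabs_mult.
    replace (K * Y2 * eps * (r + eps) * u ^ 2 * / sqd (ys j) X Y) with
     (K * (Y2 * eps * (r + eps)) * (u ^ 2 * / sqd (ys j) X Y)) by ring.
    apply Rmult_le_compat_r; [lra|]. apply Rmult_le_compat; auto using Rabs_pos.
    rewrite Hys.
    replace (r * r - (r * r - 2 * X * (eps * y j) + eps * y j * (eps * y j))) with
      (2 * (X * (eps * y j)) + - (eps * y j * (eps * y j))) by ring.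
    eapply Rle_trans; [apply Rabs_triang|]. rewrite Rabs_Ropp, !Rabs_mult, (Rabs_right eps), (Rabs_right 2) by lra.
    pose proof (B5 j Hj) as Hyj. pose proof (Rabs_pos (y j)) as Hyj0.
    assert (T1 : Rabs X * (eps * Rabs (y j)) <= r * (eps * C5)).
    { apply Rmult_le_compat; auto using Rabs_pos.
      - apply Rmult_le_pos; lra.
      - apply Rmult_le_compat_l; lra. }
    assert (T2 : eps * Rabs (y j) * (eps * Rabs (y j)) <= eps * C5 * (eps * C5)).
    { assert (0 <= eps * Rabs (y j) <= eps * C5) by (split; [apply Rmult_le_pos|apply Rmult_le_compat_l]; lra).
      apply Rmult_le_compat; lra. }
    unfold Y2.
    assert (0 <= r * eps * (C5 * C5)) by (repeat apply Rmult_le_pos; lra).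
    assert (0 <= eps * eps * C5) by (repeat apply Rmult_le_pos; lra).
    lra. }
  apply Hfin; clear Hfin.
  - specialize (HA X Y HY).
    assert (GA : forall g, usum (S m2) g x X Y = usum m2 (fun k => g (S k)) xs X Y + g 0%nat * u ^ 2).
    { intros g. unfold usum. rewrite bsum_recl, Hx0, Hs0, Hu2. unfold Rdiv, xs. ring. }
    unfold jac in HA. rewrite !GA in HA.
    assert (GWA : wsum (S m2) x X Y = u ^ 2 + a).
    { unfold wsum. rewrite bsum_recl, Hx0, Hs0, Hu2. reflexivity. }
    rewrite GWA, <- Hrr in HA. eapply Rle_trans; [apply HA|]. right.
    change (usum m2 (fun k => fst (e2 (S k))) xs X Y) with (AU fst).
    change (usum m2 (fun k => snd (e2 (S k))) xs X Y) with (AU snd).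
    change (usum m2 (fun k => fst (e2 (S k)) * x (S k)) xs X Y) with (AV fst).
    change (usum m2 (fun k => snd (e2 (S k)) * x (S k)) xs X Y) with (AV snd).
    rewrite Hx0. ring.
  (* The inner bound is used at z / eps, which turns the jumps y into eps y. *)
  - assert (Hye : 0 < Y / eps) by (apply Rdiv_lt_0_compat; lra).
    specialize (HB (X / eps) (Y / eps) Hye).
    assert (Hsc : forall j, sqd (y j) (X / eps) (Y / eps) = sqd (ys j) X Y / (eps * eps)).
    { intros j. unfold sqd, ys. field. lra. }
    assert (GB : forall g, usum m1 g y (X / eps) (Y / eps) = eps * eps * usum m1 g ys X Y).
    { intros g. unfold usum. rewrite <- bsum_scal. apply bsum_ext. intros j _. rewrite Hsc.
      pose proof (sqd_pos (ys j) X Y HY). field. lra. }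
    assert (GBV : forall g : Cpt -> R, usum m1 (fun j => g (e1 j) * y j) y (X / eps) (Y / eps) = eps * BV g).
    { intros g. rewrite GB. unfold BV, usum. rewrite <- !bsum_scal. apply bsum_ext. intros j _.
      unfold ys. pose proof (sqd_pos (ys j) X Y HY). field. unfold ys in *. lra. }
    unfold jac in HB. rewrite (GBV fst), (GBV snd), !GB in HB.
    fold (BU fst) (BU snd) in HB.
    assert (GWB : wsum m1 y (X / eps) (Y / eps) = eps * eps * b).
    { unfold b, wsum. rewrite <- bsum_scal. apply bsum_ext. intros j _. rewrite Hsc.
      pose proof (sqd_pos (ys j) X Y HY). field. lra. }
    rewrite GWB in HB.
    apply Rmult_le_reg_l with eps; [lra|].
    replace (eps * (kB * eps * b)) with (kB * (eps * eps * b)) by ring.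
    eapply Rle_trans; [apply HB|]. right.
    replace (r ^ 2) with (X * X + Y * Y) by (simpl; lra).
    field. lra.
  - eapply Rle_trans; [apply Q1|]. apply Rmult_le_compat_r; [lra|unfold C; lra].
  - eapply Rle_trans; [apply Q2|]. apply Rmult_le_compat_r; [lra|unfold C; lra].
  - eapply Rle_trans; [apply Q3|]. apply Rmult_le_compat_r; [lra|unfold C; lra].
  - eapply Rle_trans; [apply Q4|]. apply Rmult_le_compat_r; [lra|unfold C; lra].
  - eapply Rle_trans; [apply (QV fst C1 HC1 B1)|].
    repeat (apply Rmult_le_compat_r; [lra|]). unfold C. lra.
  - eapply Rle_trans; [apply (QV snd C2 HC2 B2)|].
    repeat (apply Rmult_le_compat_r; [lra|]). unfold C. lra.
  - eapply Rle_trans; [apply Q5|]. apply Rmult_le_compat_r; [lra|unfold C; lra].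
  - eapply Rle_trans; [apply Q6|]. apply Rmult_le_compat_r; [lra|unfold C; lra].
  - rewrite He1. eapply Rle_trans; [apply (QD fst C1 HC1 B1)|].
    assert (0 < u ^ 2) by (rewrite Hu2; now apply Rinv_0_lt_compat).
    repeat (apply Rmult_le_compat_r; [lra|]). unfold C. lra.
  - rewrite He2. eapply Rle_trans; [apply (QD snd C2 HC2 B2)|].
    assert (0 < u ^ 2) by (rewrite Hu2; now apply Rinv_0_lt_compat).
    repeat (apply Rmult_le_compat_r; [lra|]). unfold C. lra.
  - intros Hrd. apply Rle_trans with (INR m2 * / (d * d)); [|unfold C; lra].
    unfold a, wsum. rewrite <- bsum_const. apply bsum_le. intros j Hj.
    apply Rinv_le_contravar; [apply Rmult_lt_0_compat; lra|]. unfold sqd, xs. specialize (Bd j Hj).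
    assert (X <= r) by (apply Rle_trans with (Rabs X); [apply Rle_abs|lra]).
    assert (Hdx : d <= x (S j) - X) by lra. pose proof (mul_self_ge0 Y) as HYY. clear - Hdx HYY Hd. nra.
  - intros Hre. apply Rle_trans with (4 * INR m1 * u ^ 2).
    2:{ apply Rmult_le_compat_r; [rewrite Hu2; left; now apply Rinv_0_lt_compat|unfold C; lra]. }
    replace (4 * INR m1 * u ^ 2) with (INR m1 * (4 * u ^ 2)) by ring.
    unfold b, wsum. rewrite <- bsum_const. apply bsum_le. intros j Hj.
    rewrite Hu2, <- Hrr. replace (4 * / (r * r)) with (/ (r * r / 4)) by (field; lra).
    apply Rinv_le_contravar; [apply Rdiv_lt_0_compat; [apply Rmult_lt_0_compat|]; lra|]. rewrite Hys. specialize (B5 j Hj).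
    assert (T : Rabs (eps * y j) <= r / 2).
    { rewrite Rabs_mult, (Rabs_right eps) by lra. clear - B5 Hre Heps. nra. }
    set (t := eps * y j) in *.
    assert (T2 : X * t <= r * Rabs t).
    { eapply Rle_trans; [apply Rle_abs|]. rewrite Rabs_mult. apply Rmult_le_compat_r; [apply Rabs_pos|lra]. }
    assert (T3 : t * t = Rabs t * Rabs t).
    { rewrite <- Rabs_mult. rewrite Rabs_right; [reflexivity|]. pose proof (mul_self_ge0 t). lra. }
    rewrite T3. pose proof (Rabs_pos t) as Ht0. clear - T T2 Ht0 Hr. nra.
  - apply Rle_trans with (/ sqd (ys 0%nat) X Y * (r ^ 2 + eps ^ 2)).
    2:{ apply Rmult_le_compat_r; [pose proof (pow2_ge_0 r); pose proof (pow2_ge_0 eps); lra|].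
        apply (bsum_term_le (fun k => / sqd (ys k) X Y)); [|lia].
        intros j _. left. apply Rinv_0_lt_compat. now apply sqd_pos. }
    pose proof (sqd_pos (ys 0%nat) X Y HY) as Hs.
    apply Rmult_le_reg_l with (sqd (ys 0%nat) X Y); [lra|].
    rewrite <- Rmult_assoc, Rinv_r, Rmult_1_l by lra.
    unfold c. apply Rmult_le_reg_r with (2 + 2 * (C5 * C5)); [pose proof (mul_self_ge0 C5); lra|].
    rewrite Rmult_assoc, Rinv_l, Rmult_1_r by (pose proof (mul_self_ge0 C5); lra).
    specialize (B5 0%nat Hm1).
    assert (T : y 0%nat * y 0%nat <= C5 * C5).
    { pose proof (Rabs_pos (y 0%nat)) as Hy0. rewrite <- (Rabs_right (y 0%nat * y 0%nat)) by (pose proof (mul_self_ge0 (y 0%nat)); lra).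
      rewrite Rabs_mult. clear - Hy0 B5. nra. }
    assert (T2 : sqd (ys 0%nat) X Y <= 2 * (r * r) + 2 * (eps * eps * (y 0%nat * y 0%nat))).
    { rewrite Hrr. unfold sqd, ys. pose proof (mul_self_ge0 (X + eps * y 0%nat)). pose proof (mul_self_ge0 Y). lra. }
    assert (T3 : eps * eps * (y 0%nat * y 0%nat) <= eps * eps * (C5 * C5)) by (apply Rmult_le_compat_l; [apply mul_self_ge0|assumption]).
    assert (0 <= r * r * (C5 * C5)) by (apply Rmult_le_pos; apply mul_self_ge0).
    pose proof (mul_self_ge0 eps).
    simpl. lra.
Qed.

(** * Strict differentiability and local inversion *)

(** Strict differentiability at one point, with gradient (a, b): both points of the increment vary.
    It is stable under linear combinations and by itself gives local inversion, also at r = 0 in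
    polar coordinates. *)
Definition strict_diff (g : R -> R -> R) (p q a b : R) : Prop :=
  forall eta, 0 < eta -> exists d, 0 < d /\ forall x y x' y',
    Rabs (x - p) < d -> Rabs (y - q) < d -> Rabs (x' - p) < d -> Rabs (y' - q) < d ->
    Rabs (g x y - g x' y' - (a * (x - x') + b * (y - y'))) <= eta * (Rabs (x - x') + Rabs (y - y')).

(** Mean value theorem on the two legs of the path from (x', y') over (x', y) to (x, y). *)
Lemma strict_diff_C1 g gx gy p q d0 : 0 < d0 ->
  (forall x y, Rabs (x - p) < d0 -> Rabs (y - q) < d0 -> is_derive (fun t => g t y) x (gx x y)) ->
  (forall x y, Rabs (x - p) < d0 -> Rabs (y - q) < d0 -> is_derive (fun t => g x t) y (gy x y)) ->
  continuity_2d_pt gx p q -> continuity_2d_pt gy p q ->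
  strict_diff g p q (gx p q) (gy p q).
Proof.
  intros Hd0 Hx Hy Cx Cy eta Heta.
  destruct (Cx (mkposreal _ Heta)) as (d1 & H1). destruct (Cy (mkposreal _ Heta)) as (d2 & H2).
  simpl in H1, H2. pose proof (cond_pos d1). pose proof (cond_pos d2).
  exists (Rmin d0 (Rmin d1 d2)). split; [repeat apply Rmin_glb_lt; lra|].
  assert (M : forall z, z < Rmin d0 (Rmin d1 d2) -> z < d0 /\ z < d1 /\ z < d2).
  { intros z Hz. pose proof (Rmin_l d0 (Rmin d1 d2)). pose proof (Rmin_r d0 (Rmin d1 d2)).
    pose proof (Rmin_l d1 d2). pose proof (Rmin_r d1 d2). lra. }
  assert (B : forall c s t e, Rabs (s - c) < e -> Rabs (t - c) < e -> forall z,
     Rmin s t <= z <= Rmax s t -> Rabs (z - c) < e).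
  { intros c s t e Hs Ht z Hz. apply Rabs_def2 in Hs. apply Rabs_def2 in Ht. apply Rabs_def1;
    unfold Rmin, Rmax in Hz; destruct (Rle_dec s t); lra. }
  intros x y x' y' A1 A2 A3 A4.
  destruct (MVT_gen (fun t => g t y) x' x (fun t => gx t y)) as (s & Hs & Es).
  { intros t Ht. apply Hx; [|apply (M _ A2)]. apply (B p x' x); try apply M; auto; lra. }
  { intros t Ht. apply continuity_pt_filterlim.
    apply (ex_derive_continuous (fun t => g t y)). eexists. apply Hx; [|apply (M _ A2)].
    apply (B p x' x); try apply M; auto; lra. }
  destruct (MVT_gen (fun t => g x' t) y' y (fun t => gy x' t)) as (t & Ht & Et).
  { intros t Ht. apply Hy; [apply (M _ A3)|]. apply (B q y' y); try apply M; auto; lra. }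
  { intros t Ht. apply continuity_pt_filterlim.
    apply (ex_derive_continuous (fun t => g x' t)). eexists. apply Hy; [apply (M _ A3)|].
    apply (B q y' y); try apply M; auto; lra. }
  assert (G1 : Rabs (gx s y - gx p q) < eta).
  { apply H1; [|apply (M _ A2)]. apply (B p x' x); try apply M; auto. }
  assert (G2 : Rabs (gy x' t - gy p q) < eta).
  { apply H2; [apply (M _ A3)|]. apply (B q y' y); try apply M; auto. }
  replace (g x y - g x' y' - (gx p q * (x - x') + gy p q * (y - y'))) with
    ((gx s y - gx p q) * (x - x') + (gy x' t - gy p q) * (y - y')).
  2:{ replace (g x y - g x' y') with ((g x y - g x' y) + (g x' y - g x' y')) by ring.
      rewrite Es, Et. ring. }
  eapply Rle_trans; [apply Rabs_triang|]. rewrite !Rabs_mult, Rmult_plus_distr_l.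
  apply Rplus_le_compat; apply Rmult_le_compat_r; try apply Rabs_pos; lra.
Qed.

Lemma strict_diff_ext g h p q a b d0 : 0 < d0 ->
  (forall x y, Rabs (x - p) < d0 -> Rabs (y - q) < d0 -> g x y = h x y) ->
  strict_diff g p q a b -> strict_diff h p q a b.
Proof.
  intros Hd0 E H eta Heta. destruct (H eta Heta) as (d & Hd & G).
  exists (Rmin d0 d). split; [now apply Rmin_glb_lt|].
  pose proof (Rmin_l d0 d). pose proof (Rmin_r d0 d).
  intros x y x' y' A1 A2 A3 A4. rewrite <- !E by lra. apply G; lra.
Qed.

Lemma strict_diff_const c p q : strict_diff (fun _ _ => c) p q 0 0.
Proof.
  intros eta Heta. exists 1. split; [lra|]. intros x y x' y' _ _ _ _.
  replace (c - c - (0 * (x - x') + 0 * (y - y'))) with 0 by ring. rewrite Rabs_R0.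
  apply Rmult_le_pos; [lra|]. apply Rplus_le_le_0_compat; apply Rabs_pos.
Qed.

Lemma strict_diff_lin s t g h p q a b c d :
  strict_diff g p q a b -> strict_diff h p q c d ->
  strict_diff (fun x y => s * g x y + t * h x y) p q (s * a + t * c) (s * b + t * d).
Proof.
  intros Hg Hh eta Heta.
  set (K := Rabs s + Rabs t + 1).
  assert (HK : 0 < K) by (unfold K; pose proof (Rabs_pos s); pose proof (Rabs_pos t); lra).
  assert (He : 0 < eta / K) by now apply Rdiv_lt_0_compat.
  destruct (Hg _ He) as (d1 & Hd1 & G1). destruct (Hh _ He) as (d2 & Hd2 & G2).
  exists (Rmin d1 d2). split; [now apply Rmin_glb_lt|].
  pose proof (Rmin_l d1 d2). pose proof (Rmin_r d1 d2).
  intros x y x' y' A1 A2 A3 A4.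
  specialize (G1 x y x' y' ltac:(lra) ltac:(lra) ltac:(lra) ltac:(lra)).
  specialize (G2 x y x' y' ltac:(lra) ltac:(lra) ltac:(lra) ltac:(lra)).
  set (D := Rabs (x - x') + Rabs (y - y')) in *.
  replace (s * g x y + t * h x y - (s * g x' y' + t * h x' y') - ((s * a + t * c) * (x - x') + (s * b + t * d) * (y - y')))
   with (s * (g x y - g x' y' - (a * (x - x') + b * (y - y'))) + t * (h x y - h x' y' - (c * (x - x') + d * (y - y')))) by ring.
  eapply Rle_trans; [apply Rabs_triang|]. rewrite !Rabs_mult.
  assert (HD : 0 <= eta / K * D).
  { apply Rmult_le_pos; [lra|]. apply Rplus_le_le_0_compat; apply Rabs_pos. }
  apply Rle_trans with (Rabs s * (eta / K * D) + Rabs t * (eta / K * D)).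
  - apply Rplus_le_compat; apply Rmult_le_compat_l; auto using Rabs_pos.
  - rewrite <- Rmult_plus_distr_r. apply Rle_trans with (K * (eta / K * D)).
    + apply Rmult_le_compat_r; [exact HD|unfold K; lra].
    + right. field. lra.
Qed.

Lemma strict_diff_bsum (c : nat -> R) (g : nat -> R -> R -> R) p q a b m :
  (forall k, (k < m)%nat -> strict_diff (g k) p q (a k) (b k)) ->
  strict_diff (fun x y => bsum (fun k => c k * g k x y) m) p q
    (bsum (fun k => c k * a k) m) (bsum (fun k => c k * b k) m).
Proof.
  induction m as [|m IH]; intros H; [exact (strict_diff_const 0 p q)|].
  simpl.
  pose proof (strict_diff_lin 1 (c m) _ _ _ _ _ _ _ _ (IH (fun k Hk => H k (Nat.lt_lt_succ_r _ _ Hk))) (H m (Nat.lt_succ_diag_r m))) as G.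
  rewrite !Rmult_1_l in G.
  eapply strict_diff_ext with (d0 := 1); [lra| |exact G].
  intros x y _ _. cbv beta. ring.
Qed.

Lemma geometric_cauchy u C : (forall k, Rabs (u (S k) - u k) <= C * (1 / 2) ^ k) ->
  exists l, Un_cv u l.
Proof.
  intros H.
  assert (HC : 0 <= C).
  { specialize (H O). simpl in H. pose proof (Rabs_pos (u 1%nat - u 0%nat)). lra. }
  assert (P : forall k, 0 < (1 / 2) ^ k) by (intros k; apply pow_lt; lra).
  assert (G : forall n k, Rabs (u (n + k)%nat - u n) <= 2 * C * (1 / 2) ^ n - 2 * C * (1 / 2) ^ (n + k)).
  { intros n k. induction k as [|k IH].
    - rewrite Nat.add_0_r, !Rminus_diag, Rabs_R0. lra.
    - rewrite Nat.add_succ_r. specialize (H (n + k)%nat).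
      replace (u (S (n + k)) - u n) with ((u (S (n + k)) - u (n + k)%nat) + (u (n + k)%nat - u n)) by ring.
      eapply Rle_trans; [apply Rabs_triang|]. simpl. lra. }
  destruct (R_complete u) as (l & Hl); [|now exists l].
  intros eps Heps.
  assert (He : 0 < eps / (4 * C + 1)) by (apply Rdiv_lt_0_compat; lra).
  destruct (pow_lt_1_zero (1 / 2) ltac:(rewrite Rabs_right; lra) _ He) as (N & HN).
  exists N. intros n m Hn Hm. unfold Rdist.
  specialize (HN N (Nat.le_refl N)). rewrite Rabs_right in HN by (apply Rle_ge; left; apply P).
  apply Rlt_div_r in HN; [|lra].
  pose proof (G N (n - N)%nat) as G1. pose proof (G N (m - N)%nat) as G2.
  replace (N + (n - N))%nat with n in G1 by lia. replace (N + (m - N))%nat with m in G2 by lia.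
  replace (u n - u m) with ((u n - u N) + - (u m - u N)) by ring.
  eapply Rle_lt_trans; [apply Rabs_triang|]. rewrite Rabs_Ropp.
  pose proof (P n). pose proof (P m). pose proof (P N).
  assert (0 <= C * (1 / 2) ^ n) by (apply Rmult_le_pos; lra).
  assert (0 <= C * (1 / 2) ^ m) by (apply Rmult_le_pos; lra). lra.
Qed.

(** The iteration P -> P - (h(P) - v) at least halves its steps, since each coordinate contributes
    an error of a quarter; starting with a step e < d/4 it stays within 2 e of (p, q). *)
Lemma near_identity_solve h1 h2 p q d v1 v2 : 0 < d ->
  (forall x y x' y', Rabs (x - p) < d -> Rabs (y - q) < d -> Rabs (x' - p) < d -> Rabs (y' - q) < d ->
    Rabs (h1 x y - h1 x' y' - (x - x')) <= / 4 * (Rabs (x - x') + Rabs (y - y'))) ->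
  (forall x y x' y', Rabs (x - p) < d -> Rabs (y - q) < d -> Rabs (x' - p) < d -> Rabs (y' - q) < d ->
    Rabs (h2 x y - h2 x' y' - (y - y')) <= / 4 * (Rabs (x - x') + Rabs (y - y'))) ->
  Rabs (h1 p q - v1) + Rabs (h2 p q - v2) < d / 4 ->
  exists x y, Rabs (x - p) < d /\ Rabs (y - q) < d /\ h1 x y = v1 /\ h2 x y = v2.
Proof.
  intros Hd H1 H2 Hv.
  set (e := Rabs (h1 p q - v1) + Rabs (h2 p q - v2)) in *.
  assert (He : 0 <= e) by (apply Rplus_le_le_0_compat; apply Rabs_pos).
  set (u := fun k => Nat.iter k (fun P : R * R => (fst P - (h1 (fst P) (snd P) - v1), snd P - (h2 (fst P) (snd P) - v2))) (p, q)).
  assert (u0 : u 0%nat = (p, q)) by reflexivity.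
  assert (uS1 : forall k, fst (u (S k)) = fst (u k) - (h1 (fst (u k)) (snd (u k)) - v1)) by reflexivity.
  assert (uS2 : forall k, snd (u (S k)) = snd (u k) - (h2 (fst (u k)) (snd (u k)) - v2)) by reflexivity.
  clearbody u.
  set (step := fun k => Rabs (fst (u (S k)) - fst (u k)) + Rabs (snd (u (S k)) - snd (u k))).
  set (off := fun k => Rabs (fst (u k) - p) + Rabs (snd (u k) - q)).
  assert (INV : forall k, step k <= e * (1 / 2) ^ k /\ off k <= 2 * e - 2 * e * (1 / 2) ^ k).
  { assert (Hoff : forall k, step k <= e * (1 / 2) ^ k -> off k <= 2 * e - 2 * e * (1 / 2) ^ k ->
               off (S k) <= 2 * e - 2 * e * (1 / 2) ^ (S k)).
    { intros k Hs Ho. unfold off.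
      replace (fst (u (S k)) - p) with ((fst (u (S k)) - fst (u k)) + (fst (u k) - p)) by ring.
      replace (snd (u (S k)) - q) with ((snd (u (S k)) - snd (u k)) + (snd (u k) - q)) by ring.
      pose proof (Rabs_triang (fst (u (S k)) - fst (u k)) (fst (u k) - p)).
      pose proof (Rabs_triang (snd (u (S k)) - snd (u k)) (snd (u k) - q)).
      unfold step, off in *. simpl pow. lra. }
    intros k. induction k as [|k (IHs & IHo)].
    - split; unfold step, off; rewrite ?uS1, ?uS2, u0; simpl.
      + replace (p - (h1 p q - v1) - p) with (- (h1 p q - v1)) by ring.
        replace (q - (h2 p q - v2) - q) with (- (h2 p q - v2)) by ring.
        rewrite !Rabs_Ropp. unfold e. lra.
      + rewrite !Rminus_diag, Rabs_R0. lra.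
    - pose proof (Hoff k IHs IHo) as Ho.
      assert (P : forall j, 0 < (1 / 2) ^ j) by (intros j; apply pow_lt; lra).
      split; [|exact Ho].
      assert (off k < d /\ off (S k) < d) as (D1 & D2).
      { pose proof (P k). pose proof (P (S k)).
        assert (0 <= e * (1 / 2) ^ k) by (apply Rmult_le_pos; lra).
        assert (0 <= e * (1 / 2) ^ (S k)) by (apply Rmult_le_pos; lra). lra. }
      unfold off in D1, D2.
      pose proof (Rabs_pos (fst (u k) - p)). pose proof (Rabs_pos (snd (u k) - q)).
      pose proof (Rabs_pos (fst (u (S k)) - p)). pose proof (Rabs_pos (snd (u (S k)) - q)).
      pose proof (H1 (fst (u (S k))) (snd (u (S k))) (fst (u k)) (snd (u k)) ltac:(lra) ltac:(lra) ltac:(lra) ltac:(lra)) as E1.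
      pose proof (H2 (fst (u (S k))) (snd (u (S k))) (fst (u k)) (snd (u k)) ltac:(lra) ltac:(lra) ltac:(lra) ltac:(lra)) as E2.
      fold (step k) in E1, E2.
      assert (S1 : step (S k) <= / 2 * step k).
      { unfold step at 1. rewrite (uS1 (S k)), (uS2 (S k)).
        rewrite <- (Rabs_Ropp (fst (u (S k)) - _ - _)), <- (Rabs_Ropp (snd (u (S k)) - _ - _)).
        replace (- (fst (u (S k)) - (h1 (fst (u (S k))) (snd (u (S k))) - v1) - fst (u (S k)))) with
          (h1 (fst (u (S k))) (snd (u (S k))) - h1 (fst (u k)) (snd (u k)) - (fst (u (S k)) - fst (u k))).
        2:{ pose proof (uS1 k). lra. }
        replace (- (snd (u (S k)) - (h2 (fst (u (S k))) (snd (u (S k))) - v2) - snd (u (S k)))) with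
          (h2 (fst (u (S k))) (snd (u (S k))) - h2 (fst (u k)) (snd (u k)) - (snd (u (S k)) - snd (u k))).
        2:{ pose proof (uS2 k). lra. }
        lra. }
      simpl pow. lra. }
  assert (P : forall j, 0 < (1 / 2) ^ j) by (intros j; apply pow_lt; lra).
  destruct (geometric_cauchy (fun k => fst (u k)) e) as (x & Hx).
  { intros k. destruct (INV k) as (I & _). unfold step in I. pose proof (Rabs_pos (snd (u (S k)) - snd (u k))). lra. }
  destruct (geometric_cauchy (fun k => snd (u k)) e) as (y & Hy).
  { intros k. destruct (INV k) as (I & _). unfold step in I. pose proof (Rabs_pos (fst (u (S k)) - fst (u k))). lra. }
  assert (OFF : forall k, off k <= 2 * e).
  { intros k. destruct (INV k) as (_ & I). pose proof (P k). assert (0 <= e * (1 / 2) ^ k) by (apply Rmult_le_pos; lra). lra. }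
  assert (LIM : forall t, 0 < t -> exists k, Rabs (fst (u k) - x) < t /\ Rabs (snd (u k) - y) < t /\ step k < t).
  { intros t Ht. destruct (Hx t Ht) as (N1 & HN1). destruct (Hy t Ht) as (N2 & HN2).
    assert (Ht' : 0 < t / (e + 1)) by (apply Rdiv_lt_0_compat; lra).
    destruct (pow_lt_1_zero (1 / 2) ltac:(rewrite Rabs_right; lra) _ Ht') as (N3 & HN3).
    exists (N1 + N2 + N3)%nat. repeat split.
    - apply HN1. lia.
    - apply HN2. lia.
    - destruct (INV (N1 + N2 + N3)%nat) as (I & _). specialize (HN3 (N1 + N2 + N3)%nat ltac:(lia)).
      rewrite Rabs_right in HN3 by (apply Rle_ge; left; apply P).
      apply Rlt_div_r in HN3; [|lra]. pose proof (P (N1 + N2 + N3)%nat). lra. }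
  assert (Dx : Rabs (x - p) < d /\ Rabs (y - q) < d).
  { destruct (LIM (d / 4) ltac:(lra)) as (k & K1 & K2 & _). specialize (OFF k). unfold off in OFF.
    rewrite Rabs_minus_sym in K1. rewrite Rabs_minus_sym in K2.
    pose proof (Rabs_pos (fst (u k) - p)). pose proof (Rabs_pos (snd (u k) - q)).
    split.
    - replace (x - p) with ((x - fst (u k)) + (fst (u k) - p)) by ring.
      eapply Rle_lt_trans; [apply Rabs_triang|]. lra.
    - replace (y - q) with ((y - snd (u k)) + (snd (u k) - q)) by ring.
      eapply Rle_lt_trans; [apply Rabs_triang|]. lra. }
  destruct Dx as (Dx & Dy).
  exists x, y. split; [exact Dx|]. split; [exact Dy|].
  assert (Z : forall r, (forall t, 0 < t -> Rabs r <= 4 * t) -> r = 0).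
  { intros r Hr. destruct (Req_dec r 0) as [E|E]; [exact E|].
    apply Rabs_pos_lt in E. specialize (Hr (Rabs r / 8) ltac:(lra)). lra. }
  split; apply Rminus_diag_uniq; apply Z; intros t Ht;
    destruct (LIM t Ht) as (k & K1 & K2 & K3);
    specialize (OFF k); unfold off in OFF;
    pose proof (Rabs_pos (fst (u k) - p)); pose proof (Rabs_pos (snd (u k) - q));
    unfold step in K3; rewrite uS1, uS2 in K3;
    pose proof (Rabs_pos (fst (u k) - (h1 (fst (u k)) (snd (u k)) - v1) - fst (u k)));
    pose proof (Rabs_pos (snd (u k) - (h2 (fst (u k)) (snd (u k)) - v2) - snd (u k))).
  - pose proof (H1 (fst (u k)) (snd (u k)) x y ltac:(lra) ltac:(lra) Dx Dy) as E.
    replace (fst (u k) - (h1 (fst (u k)) (snd (u k)) - v1) - fst (u k)) with (- (h1 (fst (u k)) (snd (u k)) - v1)) in * by ring.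
    rewrite Rabs_Ropp in *.
    replace (h1 x y - v1) with ((h1 (fst (u k)) (snd (u k)) - v1)
       + - (h1 (fst (u k)) (snd (u k)) - h1 x y - (fst (u k) - x)) + - (fst (u k) - x)) by ring.
    eapply Rle_trans; [apply Rabs_triang|]. eapply Rle_trans; [apply Rplus_le_compat_r; apply Rabs_triang|].
    rewrite !Rabs_Ropp. lra.
  - pose proof (H2 (fst (u k)) (snd (u k)) x y ltac:(lra) ltac:(lra) Dx Dy) as E.
    replace (snd (u k) - (h2 (fst (u k)) (snd (u k)) - v2) - snd (u k)) with (- (h2 (fst (u k)) (snd (u k)) - v2)) in * by ring.
    rewrite Rabs_Ropp in *.
    replace (h2 x y - v2) with ((h2 (fst (u k)) (snd (u k)) - v2)
       + - (h2 (fst (u k)) (snd (u k)) - h2 x y - (snd (u k) - y)) + - (snd (u k) - y)) by ring.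
    eapply Rle_trans; [apply Rabs_triang|]. eapply Rle_trans; [apply Rplus_le_compat_r; apply Rabs_triang|].
    rewrite !Rabs_Ropp. lra.
Qed.

(** Composed with the inverse of the matrix of partial derivatives the pair becomes a perturbation
    of the identity. Openness is stated for every smaller radius s because preimages are later
    wanted in prescribed small neighbourhoods. *)
Lemma inverse_function g1 g2 p q a b c d :
  strict_diff g1 p q a b -> strict_diff g2 p q c d -> a * d - b * c <> 0 ->
  exists r, 0 < r /\
    (forall x y x' y', Rabs (x - p) < r -> Rabs (y - q) < r -> Rabs (x' - p) < r -> Rabs (y' - q) < r ->
       g1 x y = g1 x' y' -> g2 x y = g2 x' y' -> x = x' /\ y = y') /\
    forall s, 0 < s <= r -> exists eta, 0 < eta /\ forall w1 w2,
      Rabs (w1 - g1 p q) < eta -> Rabs (w2 - g2 p q) < eta ->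
      exists x y, Rabs (x - p) < s /\ Rabs (y - q) < s /\ g1 x y = w1 /\ g2 x y = w2.
Proof.
  intros H1 H2 HD. set (D := a * d - b * c) in *.
  pose proof (strict_diff_lin (d / D) (- b / D) _ _ _ _ _ _ _ _ H1 H2) as I1.
  pose proof (strict_diff_lin (- c / D) (a / D) _ _ _ _ _ _ _ _ H1 H2) as I2.
  replace (d / D * a + - b / D * c) with 1 in I1 by (unfold D in *; field; assumption).
  replace (d / D * b + - b / D * d) with 0 in I1 by (unfold D in *; field; assumption).
  replace (- c / D * a + a / D * c) with 0 in I2 by (unfold D in *; field; assumption).
  replace (- c / D * b + a / D * d) with 1 in I2 by (unfold D in *; field; assumption).
  set (h1 := fun x y => d / D * g1 x y + - b / D * g2 x y) in *.
  set (h2 := fun x y => - c / D * g1 x y + a / D * g2 x y) in *.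
  destruct (I1 (/ 4) ltac:(lra)) as (r1 & Hr1 & J1). destruct (I2 (/ 4) ltac:(lra)) as (r2 & Hr2 & J2).
  pose proof (Rmin_l r1 r2). pose proof (Rmin_r r1 r2).
  exists (Rmin r1 r2). split; [now apply Rmin_glb_lt|].
  assert (L1 : forall x y x' y', Rabs (x - p) < Rmin r1 r2 -> Rabs (y - q) < Rmin r1 r2 -> Rabs (x' - p) < Rmin r1 r2 -> Rabs (y' - q) < Rmin r1 r2 ->
    Rabs (h1 x y - h1 x' y' - (x - x')) <= / 4 * (Rabs (x - x') + Rabs (y - y'))).
  { intros x y x' y' A1 A2 A3 A4.
    replace (x - x') with (1 * (x - x') + 0 * (y - y')) at 1 by ring. apply J1; lra. }
  assert (L2 : forall x y x' y', Rabs (x - p) < Rmin r1 r2 -> Rabs (y - q) < Rmin r1 r2 -> Rabs (x' - p) < Rmin r1 r2 -> Rabs (y' - q) < Rmin r1 r2 ->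
    Rabs (h2 x y - h2 x' y' - (y - y')) <= / 4 * (Rabs (x - x') + Rabs (y - y'))).
  { intros x y x' y' A1 A2 A3 A4.
    replace (y - y') with (0 * (x - x') + 1 * (y - y')) at 1 by ring. apply J2; lra. }
  split.
  - intros x y x' y' A1 A2 A3 A4 E1 E2.
    pose proof (L1 x y x' y' A1 A2 A3 A4) as M1. pose proof (L2 x y x' y' A1 A2 A3 A4) as M2.
    unfold h1, h2 in M1, M2. rewrite E1, E2 in M1, M2.
    rewrite Rminus_diag, Rminus_0_l, Rabs_Ropp in M1, M2.
    pose proof (Rabs_pos (x - x')). pose proof (Rabs_pos (y - y')).
    split; apply Rminus_diag_uniq; apply Rabs_eq_0; lra.
  - intros s Hs.
    (* [K] bounds the sum of the entries of the inverse matrix, so that data within s / 4 / K move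
       the right-hand sides by less than s / 4. *)
    set (K := Rabs (d / D) + Rabs (b / D) + Rabs (c / D) + Rabs (a / D) + 1).
    assert (HK : 0 < K).
    { unfold K. pose proof (Rabs_pos (d / D)). pose proof (Rabs_pos (b / D)). pose proof (Rabs_pos (c / D)). pose proof (Rabs_pos (a / D)). lra. }
    exists (s / 4 / K). split; [apply Rdiv_lt_0_compat; lra|].
    intros w1 w2 W1 W2.
    destruct (near_identity_solve h1 h2 p q s (d / D * w1 + - b / D * w2) (- c / D * w1 + a / D * w2)) as (x & y & X1 & X2 & X3 & X4).
    + lra.
    + intros; apply L1; lra.
    + intros; apply L2; lra.
    + set (d1 := Rabs (w1 - g1 p q)) in *. set (d2 := Rabs (w2 - g2 p q)) in *.
      assert (N1 : Rabs (h1 p q - (d / D * w1 + - b / D * w2)) <= Rabs (d / D) * d1 + Rabs (b / D) * d2).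
      { unfold d1, d2, h1. rewrite <- !Rabs_mult.
        replace (d / D * g1 p q + - b / D * g2 p q - (d / D * w1 + - b / D * w2)) with
          (- (d / D * (w1 - g1 p q)) + (b / D * (w2 - g2 p q))) by (field; assumption).
        eapply Rle_trans; [apply Rabs_triang|]. rewrite Rabs_Ropp. lra. }
      assert (N2 : Rabs (h2 p q - (- c / D * w1 + a / D * w2)) <= Rabs (c / D) * d1 + Rabs (a / D) * d2).
      { unfold d1, d2, h2. rewrite <- !Rabs_mult.
        replace (- c / D * g1 p q + a / D * g2 p q - (- c / D * w1 + a / D * w2)) with
          ((c / D * (w1 - g1 p q)) + - (a / D * (w2 - g2 p q))) by (field; assumption).
        eapply Rle_trans; [apply Rabs_triang|]. rewrite Rabs_Ropp. lra. }
      assert (N3 : K * (s / 4 / K) = s / 4) by (field; lra).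
      set (e := s / 4 / K) in *.
      assert (He : 0 < e) by (unfold e; repeat apply Rdiv_lt_0_compat; lra).
      pose proof (Rmult_le_compat_l _ _ _ (Rabs_pos (d / D)) (Rlt_le _ _ W1)).
      pose proof (Rmult_le_compat_l _ _ _ (Rabs_pos (b / D)) (Rlt_le _ _ W2)).
      pose proof (Rmult_le_compat_l _ _ _ (Rabs_pos (c / D)) (Rlt_le _ _ W1)).
      pose proof (Rmult_le_compat_l _ _ _ (Rabs_pos (a / D)) (Rlt_le _ _ W2)).
      unfold K in N3. lra.
    + exists x, y. repeat split; try assumption; unfold h1, h2 in X3, X4.
      * assert (E : a * (d / D * g1 x y + - b / D * g2 x y) + b * (- c / D * g1 x y + a / D * g2 x y) = g1 x y) by (unfold D in *; field; assumption).
        rewrite X3, X4 in E. rewrite <- E. unfold D in *. field. assumption.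
      * assert (E : c * (d / D * g1 x y + - b / D * g2 x y) + d * (- c / D * g1 x y + a / D * g2 x y) = g2 x y) by (unfold D in *; field; assumption).
        rewrite X3, X4 in E. rewrite <- E. unfold D in *. field. assumption.
Qed.

(** * The harmonic map of the upper half-plane *)

(* The argument of u + iY, for Y > 0. *)
Definition th (u Y : R) : R := PI / 2 - atan (u / Y).

(** One coordinate of the map; [c0] is the boundary value to the right of all jumps, where every
    argument vanishes. *)
Definition hmap (c0 : R) (m : nat) (g x : nat -> R) (X Y : R) : R :=
  c0 - bsum (fun k => g k * th (X - x k) Y) m / PI.

Lemma sqd_continuous x p q : continuity_2d_pt (fun X Y => sqd x X Y) p q.
Proof.
  unfold sqd. apply continuity_2d_pt_plus; apply continuity_2d_pt_mult;
    repeat first [apply continuity_2d_pt_minus | apply continuity_2d_pt_id1 | apply continuity_2d_pt_id2 | apply continuity_2d_pt_const].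
Qed.

Lemma th_strict_diff x p q : 0 < q ->
  strict_diff (fun X Y => th (X - x) Y) p q (- q / sqd x p q) ((p - x) / sqd x p q).
Proof.
  intros Hq.
  assert (P : forall y, Rabs (y - q) < q -> 0 < y).
  { intros y Hy. apply Rabs_def2 in Hy. lra. }
  apply (strict_diff_C1 (fun X Y => th (X - x) Y) (fun X Y => - Y / sqd x X Y) (fun X Y => (X - x) / sqd x X Y) p q q Hq).
  - intros X Y _ HY. apply P in HY. unfold th. auto_derive; [lra|].
    pose proof (sqd_pos x X Y HY) as Hs. unfold sqd in *. field. lra.
  - intros X Y _ HY. apply P in HY. unfold th. auto_derive; [lra|].
    pose proof (sqd_pos x X Y HY) as Hs. unfold sqd in *. field. lra.
  - apply continuity_2d_pt_mult.
    + apply continuity_2d_pt_opp, continuity_2d_pt_id2.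
    + apply continuity_2d_pt_inv; [apply sqd_continuous|]. apply Rgt_not_eq. now apply sqd_pos.
  - apply continuity_2d_pt_mult.
    + apply continuity_2d_pt_minus; [apply continuity_2d_pt_id1|apply continuity_2d_pt_const].
    + apply continuity_2d_pt_inv; [apply sqd_continuous|]. apply Rgt_not_eq. now apply sqd_pos.
Qed.

(** The term with p in the second partial derivative is proportional to the first one, so the
    determinant of two such coordinates is q / PI^2 times [jac]. *)
Lemma hmap_strict_diff c0 m g x p q : 0 < q ->
  strict_diff (hmap c0 m g x) p q
    (q / PI * usum m g x p q)
    (- / PI * (p * usum m g x p q - usum m (fun k => g k * x k) x p q)).
Proof.
  intros Hq. pose proof PI_RGT_0.
  pose proof (strict_diff_bsum g (fun k X Y => th (X - x k) Y) p q _ _ m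
    (fun k _ => th_strict_diff (x k) p q Hq)) as H1.
  pose proof (strict_diff_lin 1 (- / PI) _ _ _ _ _ _ _ _ (strict_diff_const c0 p q) H1) as H2.
  replace (q / PI * usum m g x p q) with
    (1 * 0 + - / PI * bsum (fun k => g k * (- q / sqd (x k) p q)) m).
  2:{ unfold usum. rewrite <- bsum_scal, <- bsum_scal, Rmult_0_r, Rplus_0_l. apply bsum_ext. intros k _.
      pose proof (sqd_pos (x k) p q Hq). field. lra. }
  replace (- / PI * (p * usum m g x p q - usum m (fun k => g k * x k) x p q)) with
    (1 * 0 + - / PI * bsum (fun k => g k * ((p - x k) / sqd (x k) p q)) m).
  2:{ unfold usum. rewrite Rmult_0_r, Rplus_0_l. f_equal. rewrite <- bsum_scal, <- bsum_minus. apply bsum_ext. intros k _.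
      pose proof (sqd_pos (x k) p q Hq). field. lra. }
  apply strict_diff_ext with (d0 := 1) (3 := H2); [lra|].
  intros X Y _ _. unfold hmap. cbv beta. field. lra.
Qed.

Lemma th_bounds u Y : 0 < th u Y < PI.
Proof. unfold th. pose proof (atan_bound (u / Y)). lra. Qed.

Lemma th_neg u Y : u < 0 -> 0 < Y -> th u Y = PI - atan (Y / - u).
Proof.
  intros Hu HY. unfold th.
  assert (H : 0 < Y / - u) by (apply Rdiv_lt_0_compat; lra).
  pose proof (atan_inv _ H) as E.
  replace (/ (Y / - u)) with (- (u / Y)) in E by (field; lra).
  rewrite atan_opp in E. lra.
Qed.

Lemma th_pos u Y : 0 < u -> 0 < Y -> th u Y = atan (Y / u).
Proof.
  intros Hu HY. unfold th.
  assert (H : 0 < Y / u) by (apply Rdiv_lt_0_compat; lra).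
  pose proof (atan_inv _ H) as E.
  replace (/ (Y / u)) with (u / Y) in E by (field; lra). lra.
Qed.

Lemma th_polar r t : 0 < r -> 0 < t < PI -> th (r * cos t) (r * sin t) = t.
Proof.
  intros Hr Ht. unfold th.
  assert (Hs : 0 < sin t) by (apply sin_gt_0; lra).
  replace (r * cos t / (r * sin t)) with (tan (PI / 2 - t)).
  - rewrite atan_tan; lra.
  - unfold tan. rewrite sin_shift, cos_shift. field. lra.
Qed.

(* [hmap] in polar coordinates around the first jump; the formula makes sense
   across r = 0. *)
Definition polar_map (c0 : R) (p : nat) (g x : nat -> R) (r t : R) : R :=
  c0 - bsum (fun k => g (S k)) p - g 0%nat * t / PI
  + bsum (fun k => g (S k) * atan (r * sin t / (x (S k) - x 0%nat - r * cos t))) p / PI.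

(** Below the distance to the other jumps, each of these lies to the right of the point, where the
    argument is PI minus the angle kept in [polar_map]; the terms PI shift the constant. *)
Lemma hmap_polar c0 p g x r t : 0 < r -> 0 < t < PI ->
  (forall k, (k < p)%nat -> r < x (S k) - x 0%nat) ->
  hmap c0 (S p) g x (x 0%nat + r * cos t) (r * sin t) = polar_map c0 p g x r t.
Proof.
  intros Hr Ht Hx. pose proof PI_RGT_0.
  assert (Hs : 0 < sin t) by (apply sin_gt_0; lra).
  assert (HY : 0 < r * sin t) by now apply Rmult_lt_0_compat.
  unfold hmap, polar_map. rewrite bsum_recl.
  replace (x 0%nat + r * cos t - x 0%nat) with (r * cos t) by ring. rewrite th_polar by assumption.
  rewrite (bsum_ext (fun k => g (S k) * th (x 0%nat + r * cos t - x (S k)) (r * sin t))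
    (fun k => PI * g (S k) - g (S k) * atan (r * sin t / (x (S k) - x 0%nat - r * cos t)))).
  2:{ intros k Hk. specialize (Hx k Hk). pose proof (COS_bound t).
      rewrite th_neg; [|nra|exact HY].
      replace (- (x 0%nat + r * cos t - x (S k))) with (x (S k) - x 0%nat - r * cos t) by ring. ring. }
  rewrite bsum_minus, bsum_scal. field. lra.
Qed.

(** The fraction is regular for small r of either sign because d - r cos t stays positive; at r = 0
    only the radial derivative survives. *)
Lemma atan_polar_strict_diff d : 0 < d ->
  strict_diff (fun r t => atan (r * sin t / (d - r * cos t))) 0 (PI / 2) (/ d) 0.
Proof.
  intros Hd.
  set (den := fun r t => (d - r * cos t) * (d - r * cos t) + r * sin t * (r * sin t)).
  assert (Hden0 : den 0 (PI / 2) = d * d) by (unfold den; ring).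
  assert (W : forall r t, Rabs (r - 0) < d / 2 -> 0 < d - r * cos t).
  { intros r t Hr. rewrite Rminus_0_r in Hr. apply Rabs_def2 in Hr. pose proof (COS_bound t).
    destruct (Rle_dec 0 r); nra. }
  assert (D : forall r t, Rabs (r - 0) < d / 2 -> 0 < den r t).
  { intros r t Hr. pose proof (W r t Hr). unfold den. pose proof (mul_self_ge0 (r * sin t)). nra. }
  assert (C1 : continuity_2d_pt (fun _ t => sin t) 0 (PI / 2)).
  { apply (continuity_1d_2d_pt_comp sin (fun _ t => t)); [apply continuity_sin|apply continuity_2d_pt_id2]. }
  assert (C2 : continuity_2d_pt (fun _ t => cos t) 0 (PI / 2)).
  { apply (continuity_1d_2d_pt_comp cos (fun _ t => t)); [apply continuity_cos|apply continuity_2d_pt_id2]. }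
  assert (C3 : continuity_2d_pt den 0 (PI / 2)).
  { unfold den.
    apply continuity_2d_pt_plus; apply continuity_2d_pt_mult;
    repeat first [assumption | apply continuity_2d_pt_minus | apply continuity_2d_pt_mult | apply continuity_2d_pt_id1 | apply continuity_2d_pt_const]. }
  replace 0 with ((0 * d * cos (PI / 2) - 0 * 0) / den 0 (PI / 2)) at 2 by (unfold Rdiv; ring).
  replace (/ d) with (d * sin (PI / 2) / den 0 (PI / 2)).
  2:{ rewrite Hden0, sin_PI2. field. lra. }
  apply (strict_diff_C1 _ (fun r t => d * sin t / den r t) (fun r t => (r * d * cos t - r * r) / den r t) 0 (PI / 2) (d / 2)).
  - lra.
  - intros r t Hr _. pose proof (W r t Hr) as HW. pose proof (D r t Hr) as HD. auto_derive; [lra|].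
    unfold den in *. field. split; lra.
  - intros r t Hr _. pose proof (W r t Hr) as HW. pose proof (D r t Hr) as HD. auto_derive; [lra|].
    unfold den in *. pose proof (sin2_cos2 t) as SC. unfold Rsqr in SC.
    replace (r * d * cos t - r * r) with (r * d * cos t - r * r * (sin t * sin t + cos t * cos t)) by (rewrite SC; ring).
    field. split; lra.
  - apply continuity_2d_pt_mult.
    + apply continuity_2d_pt_mult; [apply continuity_2d_pt_const|assumption].
    + apply continuity_2d_pt_inv; [assumption|]. rewrite Hden0. nra.
  - apply continuity_2d_pt_mult.
    + repeat first [assumption | apply continuity_2d_pt_minus | apply continuity_2d_pt_mult | apply continuity_2d_pt_id1 | apply continuity_2d_pt_const].
    + apply continuity_2d_pt_inv; [assumption|]. rewrite Hden0. nra.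
Qed.

Lemma strict_diff_eq g p q a b a' b' :
  strict_diff g p q a b -> a = a' -> b = b' -> strict_diff g p q a' b'.
Proof. intros H -> ->. exact H. Qed.

Lemma polar_map_strict_diff c0 p g x : (forall k, (k < p)%nat -> 0 < x (S k) - x 0%nat) ->
  strict_diff (polar_map c0 p g x) 0 (PI / 2)
    (bsum (fun k => g (S k) / (x (S k) - x 0%nat)) p / PI) (- (g 0%nat / PI)).
Proof.
  intros Hx. pose proof PI_RGT_0.
  pose proof (strict_diff_bsum (fun k => g (S k)) (fun k r t => atan (r * sin t / (x (S k) - x 0%nat - r * cos t)))
    0 (PI / 2) _ _ p (fun k Hk => atan_polar_strict_diff _ (Hx k Hk))) as H1.
  assert (H2 : strict_diff (fun _ t => t) 0 (PI / 2) 0 1).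
  { intros eta Heta. exists 1. split; [lra|]. intros r t r' t' _ _ _ _.
    replace (t - t' - (0 * (r - r') + 1 * (t - t'))) with 0 by ring. rewrite Rabs_R0.
    apply Rmult_le_pos; [lra|]. apply Rplus_le_le_0_compat; apply Rabs_pos. }
  pose proof (strict_diff_lin (/ PI) (- (g 0%nat / PI)) _ _ _ _ _ _ _ _ H1 H2) as H3.
  pose proof (strict_diff_lin 1 1 _ _ _ _ _ _ _ _ (strict_diff_const (c0 - bsum (fun k => g (S k)) p) 0 (PI / 2)) H3) as H4.
  apply strict_diff_ext with (d0 := 1) (h := polar_map c0 p g x) in H4.
  - eapply strict_diff_eq; [exact H4| |].
    + unfold Rdiv. ring.
    + rewrite (bsum_ext _ (fun _ => 0)) by (intros; ring). rewrite bsum_0. ring.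
  - lra.
  - intros r t _ _. unfold polar_map. field. lra.
Qed.

Lemma bsum_continuity_pt (g : nat -> R -> R) m y :
  (forall k, (k < m)%nat -> continuity_pt (g k) y) -> continuity_pt (fun t => bsum (fun k => g k t) m) y.
Proof.
  induction m as [|m IH]; intros H; simpl.
  - apply continuity_pt_const. intros a b; reflexivity.
  - apply (continuity_pt_plus (fun t => bsum (fun k => g k t) m) (g m)); auto.
Qed.

(* Up to the factor 1 / PI^2, the Jacobian of [polar_map] at r = 0, t = PI / 2. *)
Lemma jac_positive_at_jump p e x : jac_positive (S p) e x ->
  (forall k, (k < p)%nat -> 0 < x (S k) - x 0%nat) ->
  0 < fst (e 0%nat) * bsum (fun k => snd (e (S k)) / (x (S k) - x 0%nat)) p
      - snd (e 0%nat) * bsum (fun k => fst (e (S k)) / (x (S k) - x 0%nat)) p.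
Proof.
  intros H Hx. apply (jac_positive_translate _ _ _ (x 0%nat)) in H.
  set (z := fun k => x k - x 0%nat) in *.
  assert (Hz : forall k, (k < p)%nat -> 0 < z (S k)) by exact Hx.
  assert (z0 : z 0%nat = 0) by (unfold z; ring).
  destruct H as (k & Hk & H).
  set (U := fun g : Cpt -> R => fun Y => bsum (fun k => g (e (S k)) / (z (S k) * z (S k) + Y * Y)) p).
  set (V := fun g : Cpt -> R => fun Y => bsum (fun k => g (e (S k)) * z (S k) / (z (S k) * z (S k) + Y * Y)) p).
  (* On the vertical line over the jump, [phi] is Y^2 (1 + Y^2) times the Jacobian. It extends
     continuously to Y = 0, where it is the wanted quantity, and the term 1/Y^2 of [wsum] keeps it
     above k, so that the limit is strictly positive. *)
  set (phi := fun Y => (1 + Y * Y) * ((fst (e 0%nat) + Y * Y * U fst Y) * V snd Y - (snd (e 0%nat) + Y * Y * U snd Y) * V fst Y)).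
  assert (E : forall Y, 0 < Y -> k <= phi Y).
  { intros Y HY. specialize (H 0 Y HY).
    assert (HYY : 0 < Y * Y) by nra.
    assert (A : forall g : Cpt -> R, usum (S p) (fun k => g (e k)) z 0 Y = g (e 0%nat) / (Y * Y) + U g Y).
    { intros g. unfold usum, U. rewrite bsum_recl, z0. unfold sqd. f_equal.
      - f_equal. ring.
      - apply bsum_ext. intros j _. f_equal. ring. }
    assert (B : forall g : Cpt -> R, usum (S p) (fun k => g (e k) * z k) z 0 Y = V g Y).
    { intros g. unfold usum, V. rewrite bsum_recl, z0. unfold sqd, Rdiv. rewrite Rmult_0_r, Rmult_0_l, Rplus_0_l.
      apply bsum_ext. intros j _. do 2 f_equal. ring. }
    unfold jac in H. rewrite (A fst), (A snd), (B fst), (B snd) in H.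
    assert (Wb : / (Y * Y) <= wsum (S p) z 0 Y).
    { unfold wsum. rewrite bsum_recl, z0.
      assert (0 <= bsum (fun k => / sqd (z (S k)) 0 Y) p).
      { apply bsum_ge0. intros j _. left. apply Rinv_0_lt_compat. now apply sqd_pos. }
      replace (sqd 0 0 Y) with (Y * Y) by (unfold sqd; ring). lra. }
    unfold phi. apply Rmult_le_reg_l with (/ (Y * Y)); [now apply Rinv_0_lt_compat|].
    apply Rle_trans with (k * wsum (S p) z 0 Y); [rewrite Rmult_comm; apply Rmult_le_compat_l; lra|].
    eapply Rle_trans; [apply H|]. right. field. lra. }
  assert (C : continuity_pt phi 0).
  { assert (CY : continuity_pt (fun Y => Y * Y) 0) by reg.
    assert (CS : forall c d, 0 < d -> continuity_pt (fun Y => c / (d * d + Y * Y)) 0).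
    { intros c d Hd. reg. nra. }
    assert (CU : forall g, continuity_pt (U g) 0).
    { intros g. apply bsum_continuity_pt. intros j Hj. apply CS. auto. }
    assert (CV : forall g, continuity_pt (V g) 0).
    { intros g. apply bsum_continuity_pt. intros j Hj. apply CS. auto. }
    unfold phi.
    apply (continuity_pt_mult (fun Y => 1 + Y * Y)); [reg|].
    apply (continuity_pt_minus (fun Y => (fst (e 0%nat) + Y * Y * U fst Y) * V snd Y)).
    - apply (continuity_pt_mult (fun Y => fst (e 0%nat) + Y * Y * U fst Y)); [|apply CV].
      apply (continuity_pt_plus (fun _ => fst (e 0%nat))); [reg|].
      apply (continuity_pt_mult (fun Y => Y * Y)); [exact CY|apply CU].
    - apply (continuity_pt_mult (fun Y => snd (e 0%nat) + Y * Y * U snd Y)); [|apply CV].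
      apply (continuity_pt_plus (fun _ => snd (e 0%nat))); [reg|].
      apply (continuity_pt_mult (fun Y => Y * Y)); [exact CY|apply CU]. }
  assert (V0 : forall g : Cpt -> R, V g 0 = bsum (fun k => g (e (S k)) / z (S k)) p).
  { intros g. apply bsum_ext. intros j Hj. specialize (Hz j Hj). field. lra. }
  assert (P0 : phi 0 = fst (e 0%nat) * bsum (fun k => snd (e (S k)) / z (S k)) p
      - snd (e 0%nat) * bsum (fun k => fst (e (S k)) / z (S k)) p).
  { unfold phi. rewrite !V0. ring. }
  change (0 < fst (e 0%nat) * bsum (fun k => snd (e (S k)) / z (S k)) p
      - snd (e 0%nat) * bsum (fun k => fst (e (S k)) / z (S k)) p).
  rewrite <- P0. apply Rnot_le_lt. intros Hneg.
  destruct (C k Hk) as (a & Ha & Hlim).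
  specialize (Hlim (a / 2)). simpl in Hlim. unfold Rdist, D_x, no_cond in Hlim.
  rewrite Rminus_0_r, Rabs_right in Hlim by lra.
  specialize (Hlim ltac:(repeat split; lra)). apply Rabs_def2 in Hlim.
  specialize (E (a / 2) ltac:(lra)). lra.
Qed.

(** * Limits of the arguments at the boundary and at infinity *)

Lemma atan_le y : 0 <= y -> 0 <= atan y <= y.
Proof.
  intros Hy.
  destruct (MVT_gen atan 0 y (fun t => / (1 + t ^ 2))) as (c & Hc & E).
  - intros t _. apply is_derive_Reals. apply derivable_pt_lim_atan.
  - intros t _. apply derivable_continuous_pt. exists (/ (1 + t ^ 2)). apply derivable_pt_lim_atan.
  - rewrite atan_0, !Rminus_0_r in E. rewrite E.
    assert (0 < / (1 + c ^ 2) <= 1).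
    { assert (1 <= 1 + c ^ 2) by nra. split; [apply Rinv_0_lt_compat; lra|].
      rewrite <- Rinv_1 at 2. apply Rinv_le_contravar; lra. }
    nra.
Qed.

Lemma th_small u Y d e : 0 < d -> 0 < Y -> Y <= d * e -> d <= u -> Rabs (th u Y - 0) <= e.
Proof.
  intros Hd HY HYe Hu. rewrite th_pos by lra.
  assert (H : 0 < Y / u) by (apply Rdiv_lt_0_compat; lra).
  pose proof (atan_le (Y / u) ltac:(lra)).
  rewrite Rminus_0_r, Rabs_right by lra.
  apply Rle_trans with (Y / u); [lra|]. apply Rle_div_l; [lra|].
  assert (0 <= e) by nra. nra.
Qed.

Lemma th_large u Y d e : 0 < d -> 0 < Y -> Y <= d * e -> u <= - d -> Rabs (th u Y - PI) <= e.
Proof.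
  intros Hd HY HYe Hu. rewrite th_neg by lra.
  assert (H : 0 < Y / - u) by (apply Rdiv_lt_0_compat; lra).
  pose proof (atan_le (Y / - u) ltac:(lra)).
  rewrite Rabs_left1 by lra.
  apply Rle_trans with (Y / - u); [lra|]. apply Rle_div_l; [lra|].
  assert (0 <= e) by nra. nra.
Qed.

(** The derivative of the argument in u is -Y / (u^2 + Y^2), of modulus at most 1/R once Y or |u|
    reaches R; the three cases ensure this on the whole interval between u and v. *)
Lemma th_far u v Y B R : 0 < Y -> 0 < R -> Rabs (u - v) <= B ->
  (R <= Y \/ (R <= u /\ R <= v) \/ (u <= - R /\ v <= - R)) ->
  Rabs (th u Y - th v Y) <= B / R.
Proof.
  intros HY HR HB H.
  assert (Hsq : forall s, 0 < s * s + Y * Y) by (intros s; pose proof (mul_self_ge0 s); nra).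
  destruct (MVT_gen (fun s => th s Y) v u (fun s => - Y / (s * s + Y * Y))) as (s & Hs & E).
  - intros s _. unfold th. auto_derive; [lra|]. specialize (Hsq s). field. split; [nra|lra].
  - intros s _. apply continuity_pt_filterlim. apply (ex_derive_continuous (fun s => th s Y)).
    unfold th. auto_derive. lra.
  - rewrite E, Rabs_mult.
    replace (B / R) with (/ R * B) by (unfold Rdiv; ring).
    apply Rmult_le_compat; try apply Rabs_pos; [|assumption].
    specialize (Hsq s).
    replace (- Y / (s * s + Y * Y)) with (- (Y / (s * s + Y * Y))) by (field; lra).
    rewrite Rabs_Ropp, Rabs_right.
    2:{ apply Rle_ge. left. now apply Rdiv_lt_0_compat. }
    apply Rle_div_l; [lra|].
    assert (HRs : R <= Y \/ R <= s \/ s <= - R).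
    { destruct H as [H|[H|H]]; [now left| |].
      - right; left. unfold Rmin in Hs. destruct (Rle_dec v u); lra.
      - right; right. unfold Rmax in Hs. destruct (Rle_dec v u); lra. }
    apply Rmult_le_reg_l with R; [lra|]. rewrite <- Rmult_assoc, Rinv_r, Rmult_1_l by lra.
    pose proof (mul_self_ge0 (s - Y)). pose proof (mul_self_ge0 (s + Y)). pose proof (mul_self_ge0 s).
    destruct HRs as [G|[G|G]]; nra.
Qed.

Lemma polar_coordinates u Y : 0 < Y -> exists r t, 0 < r /\ r <= Rabs u + Y /\
  0 < t < PI /\ u = r * cos t /\ Y = r * sin t /\ t = th u Y.
Proof.
  intros HY. set (z := u / Y). set (w := sqrt (1 + z * z)).
  assert (Hz : 0 < 1 + z * z) by (pose proof (mul_self_ge0 z); lra).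
  assert (Hw : 0 < w) by now apply sqrt_lt_R0.
  assert (Hww : w * w = 1 + z * z) by (apply sqrt_sqrt; lra).
  exists (Y * w), (th u Y).
  assert (Hst : sin (th u Y) = / w).
  { unfold th. rewrite sin_shift, cos_atan. unfold Rsqr. fold z. fold w. field. lra. }
  assert (Hct : cos (th u Y) = z / w).
  { unfold th. rewrite cos_shift, sin_atan. unfold Rsqr. fold z. fold w. reflexivity. }
  rewrite Hst, Hct.
  repeat split; try apply th_bounds.
  - now apply Rmult_lt_0_compat.
  - assert (E : Rabs u = Y * Rabs z).
    { unfold z. unfold Rdiv. rewrite Rabs_mult, (Rabs_right (/ Y)). field. lra.
      apply Rle_ge. left. now apply Rinv_0_lt_compat. }
    rewrite E. assert (w <= Rabs z + 1); [|nra].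
    assert (Rabs z * Rabs z = z * z).
    { rewrite <- Rabs_mult. apply Rabs_right. pose proof (mul_self_ge0 z). lra. }
    pose proof (Rabs_pos z). apply Rnot_lt_le. intros Hlt. nra.
  - unfold z. field. lra.
  - field. lra.
Qed.

Lemma hmap_target c0 m g x X Y tau err G : 0 <= err ->
  (forall k, (k < m)%nat -> Rabs (th (X - x k) Y - tau k) <= err) ->
  bsum (fun k => Rabs (g k)) m <= G ->
  Rabs (hmap c0 m g x X Y - (c0 - bsum (fun k => g k * tau k) m / PI)) <= G * err.
Proof.
  intros He H HG. pose proof PI2_3_2. unfold hmap.
  replace (c0 - bsum (fun k => g k * th (X - x k) Y) m / PI - (c0 - bsum (fun k => g k * tau k) m / PI))
   with (- (/ PI * (bsum (fun k => g k * th (X - x k) Y) m - bsum (fun k => g k * tau k) m))) by (field; lra).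
  rewrite Rabs_Ropp, Rabs_mult, <- bsum_minus.
  assert (B : Rabs (bsum (fun k => g k * th (X - x k) Y - g k * tau k) m) <= G * err).
  { apply Rle_trans with (bsum (fun k => err * Rabs (g k)) m).
    - apply bsum_Rabs. intros k Hk. rewrite <- Rmult_minus_distr_l, Rabs_mult, Rmult_comm.
      apply Rmult_le_compat_r; [apply Rabs_pos|auto].
    - rewrite bsum_scal, Rmult_comm. now apply Rmult_le_compat_r. }
  assert (P : 0 < / PI <= 1).
  { split; [apply Rinv_0_lt_compat; lra|]. rewrite <- Rinv_1. apply Rinv_le_contravar; lra. }
  rewrite (Rabs_right (/ PI)) by lra.
  pose proof (Rabs_pos (bsum (fun k => g k * th (X - x k) Y - g k * tau k) m)).
  nra.
Qed.

(** * The map attached to a polygon and its boundary values *)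

Definition edge_vec (c : nat -> Cpt) (k : nat) : Cpt := Csub (c (S k)) (c k).

(** For a polygon with p + 2 vertices: the edges 0 to p belong to the jumps x_0, ..., x_p, and the
    closing edge from [c (S p)] to [c 0] sits at infinity. *)
Definition poly_map (p : nat) (c : nat -> Cpt) (x : nat -> R) (X Y : R) : Cpt :=
  (hmap (fst (c (S p))) (S p) (fun k => fst (edge_vec c k)) x X Y,
   hmap (snd (c (S p))) (S p) (fun k => snd (edge_vec c k)) x X Y).

Definition box (w : Cpt) (d : R) (z : Cpt) : Prop :=
  Rabs (fst z - fst w) < d /\ Rabs (snd z - snd w) < d.

Definition increasing (m : nat) (x : nat -> R) : Prop :=
  forall k, (S k < m)%nat -> x k < x (S k).

Lemma increasing_lt m x : increasing m x -> forall j k, (j < k < m)%nat -> x j < x k.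
Proof.
  intros H j k. induction k as [|k IH]; intros Hjk; [lia|].
  destruct (Nat.eq_dec j k) as [->|Hne]; [apply H; lia|].
  apply Rlt_trans with (x k); [apply IH; lia|apply H; lia].
Qed.

(** Gaps of 2 d leave at most one jump within d of X; the index k is that of this jump, or of an
    adjacent one when there is none. *)
Lemma locate_jump m x d X : 0 < d -> (forall j k, (j < k < S m)%nat -> 2 * d <= x k - x j) ->
  exists k, (k <= m)%nat /\ (forall j, (j < k)%nat -> d <= X - x j) /\
    (forall j, (k < j <= m)%nat -> X - x j <= - d).
Proof.
  intros Hd. induction m as [|m IH]; intros Hx.
  - exists 0%nat. repeat split; intros; lia.
  - destruct IH as (k & Hk & H1 & H2); [intros; apply Hx; lia|].
    destruct (Rle_dec (X - x (S m)) (- d)) as [Hl|Hl].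
    + exists k. repeat split; [lia|assumption|]. intros j Hj.
      destruct (Nat.eq_dec j (S m)) as [->|]; [assumption|apply H2; lia].
    + exists (S m). repeat split; [lia| |intros; lia]. intros j Hj.
      specialize (Hx j (S m) ltac:(lia)). lra.
Qed.

(* Boundary values of the arguments near the k-th jump. *)
Definition step_arg (k : nat) (t : R) (j : nat) : R :=
  if Nat.ltb j k then 0 else if Nat.eqb j k then t else PI.

(** Jumps to the left contribute nothing and those to the right contribute fully, so everything
    beyond the k-th jump telescopes and a point on the line of the k-th edge remains. *)
Lemma step_arg_sum (v : nat -> R) m k t : (k <= m)%nat ->
  v (S m) - bsum (fun j => (v (S j) - v j) * step_arg k t j) (S m) / PI =
  v (S k) - (v (S k) - v k) * t / PI.
Proof.
  intros Hk. pose proof PI_RGT_0.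
  assert (H0 : forall q, (q <= k)%nat -> bsum (fun j => (v (S j) - v j) * step_arg k t j) q = 0).
  { intros q Hq. rewrite <- (bsum_0 q). apply bsum_ext. intros j Hj. unfold step_arg.
    rewrite (proj2 (Nat.ltb_lt j k)) by lia. ring. }
  assert (H1 : forall q, bsum (fun j => (v (S j) - v j) * step_arg k t j) (S k + q) =
     (v (S k) - v k) * t + PI * (v (S k + q)%nat - v (S k))).
  { induction q as [|q IH].
    - rewrite Nat.add_0_r. simpl. rewrite H0 by lia. unfold step_arg.
      rewrite Nat.ltb_irrefl, Nat.eqb_refl. ring.
    - rewrite Nat.add_succ_r. change (bsum (fun j => (v (S j) - v j) * step_arg k t j) (S (S k + q)))
       with (bsum (fun j => (v (S j) - v j) * step_arg k t j) (S k + q) +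
         (v (S (S k + q)) - v (S k + q)%nat) * step_arg k t (S k + q)).
      rewrite IH. unfold step_arg.
      rewrite (proj2 (Nat.ltb_ge (S k + q) k)) by lia.
      rewrite (proj2 (Nat.eqb_neq (S k + q) k)) by lia. ring. }
  specialize (H1 (m - k)%nat). replace (S k + (m - k))%nat with (S m) in H1 by lia.
  rewrite H1. field. lra.
Qed.

Lemma next_lt n k : (S k < n)%nat -> next n k = S k.
Proof. intros H. unfold next. now apply Nat.mod_small. Qed.

Lemma next_last n : next (S n) n = 0%nat.
Proof. unfold next. apply Nat.Div0.mod_same. Qed.

(** Near the real line all arguments but one are close to 0 or PI, and near infinity they are close
    to one another, so the map is close to an edge. The edge 0 is reported separately, with polar
    coordinates at its jump, because preimages of points near this edge are to be located in the
    polar chart. *)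
Lemma boundary_behaviour p c x eta : (1 <= p)%nat -> increasing (S p) x -> 0 < eta ->
  let n := S (S p) in exists R0 d0, 0 < d0 /\ forall X Y, 0 < Y ->
  (R0 < Rabs X \/ R0 < Y \/ Y < d0) ->
  (exists k w, (k < n)%nat /\ k <> 0%nat /\ on_seg (c k) (c (next n k)) w /\ box w eta (poly_map p c x X Y)) \/
  (exists r t, 0 < r < eta /\ 0 < t < PI /\ X = x 0%nat + r * cos t /\ Y = r * sin t /\
     box (Csub (c 1%nat) (Cscale (t / PI) (edge_vec c 0%nat))) eta (poly_map p c x X Y)).
Proof.
  intros Hp Hx Heta n. pose proof PI_RGT_0.
  set (g1 := fun k => fst (edge_vec c k)). set (g2 := fun k => snd (edge_vec c k)).
  set (G := bsum (fun k => Rabs (g1 k)) (S p) + bsum (fun k => Rabs (g2 k)) (S p) + 1).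
  assert (G1 : 0 <= bsum (fun k => Rabs (g1 k)) (S p)) by (apply bsum_ge0; intros; apply Rabs_pos).
  assert (G2 : 0 <= bsum (fun k => Rabs (g2 k)) (S p)) by (apply bsum_ge0; intros; apply Rabs_pos).
  assert (HG : 1 <= G) by (unfold G; lra).
  set (err := eta / (2 * G)). assert (Herr : 0 < err) by (apply Rdiv_lt_0_compat; lra).
  assert (HGe : G * err = eta / 2) by (unfold err; field; lra).
  assert (TGT : forall X Y tau, (forall k, (k < S p)%nat -> Rabs (th (X - x k) Y - tau k) <= err) ->
    box (fst (c (S p)) - bsum (fun k => g1 k * tau k) (S p) / PI,
         snd (c (S p)) - bsum (fun k => g2 k * tau k) (S p) / PI) eta (poly_map p c x X Y)).
  { intros X Y tau Ht. split.
    - apply Rle_lt_trans with (G * err); [|lra].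
      apply (hmap_target _ _ g1); [lra|exact Ht|unfold G; lra].
    - apply Rle_lt_trans with (G * err); [|lra].
      apply (hmap_target _ _ g2); [lra|exact Ht|unfold G; lra]. }
  (* All arguments close to one t: the value is close to the closing edge, at the parameter t /
     PI. *)
  assert (ROOT : forall X Y t, 0 <= t <= PI -> (forall k, (k < S p)%nat -> Rabs (th (X - x k) Y - t) <= err) ->
    exists k w, (k < n)%nat /\ k <> 0%nat /\ on_seg (c k) (c (next n k)) w /\ box w eta (poly_map p c x X Y)).
  { intros X Y t Ht Hth. exists (S p). eexists. split; [unfold n; lia|]. split; [lia|].
    split; [|apply (TGT X Y (fun _ => t) Hth)].
    unfold n. rewrite next_last. exists (t / PI). split.
    - split; [apply Rdiv_le_0_compat; lra|]. apply Rle_div_l; lra.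
    - assert (T : forall v : nat -> R, bsum (fun k => (v (S k) - v k) * t) (S p) = (v (S p) - v 0%nat) * t).
      { intros v. rewrite <- bsum_telescope, Rmult_comm, <- bsum_scal. apply bsum_ext. intros; ring. }
      unfold g1, g2, edge_vec, Cadd, Cscale, Csub. cbn [fst snd].
      rewrite (T (fun k => fst (c k))), (T (fun k => snd (c k))). f_equal; field; lra. }
  assert (STEP : forall X Y k, (k < S p)%nat -> (forall j, (j < S p)%nat -> Rabs (th (X - x j) Y - step_arg k (th (X - x k) Y) j) <= err) ->
     box (Csub (c (S k)) (Cscale (th (X - x k) Y / PI) (edge_vec c k))) eta (poly_map p c x X Y)).
  { intros X Y k Hk Hth. pose proof (TGT X Y _ Hth) as T.
    unfold g1, g2, edge_vec in T. cbn [Csub fst snd] in T.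
    rewrite (step_arg_sum (fun k => fst (c k))), (step_arg_sum (fun k => snd (c k))) in T by lia.
    unfold box, poly_map in T |- *. cbn [Csub Cscale edge_vec fst snd] in T |- *.
    unfold Rdiv in *.
    split; [destruct T as (T & _)|destruct T as (_ & T)];
      (eapply Rle_lt_trans; [|apply T]); right; f_equal; ring. }
  assert (POS : forall k, (k < p)%nat -> 0 < x (S k) - x k) by (intros k Hk; specialize (Hx k ltac:(lia)); lra).
  destruct (positive_min (fun k => x (S k) - x k) p POS) as (d1 & Hd1 & Bd1).
  destruct (finite_bound x (S p)) as (B & HB & BB).
  (* Half of the smallest gap serves [locate_jump]; eta / 4, together with Y < eta / 2, makes the
     polar radius smaller than eta. *)
  set (d := Rmin (d1 / 2) (eta / 4)).
  assert (Hd : 0 < d) by (apply Rmin_glb_lt; lra).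
  assert (Hdd1 : d <= d1 / 2) by apply Rmin_l. assert (Hde : d <= eta / 4) by apply Rmin_r.
  assert (GAP : forall j k, (j < k < S p)%nat -> 2 * d <= x k - x j).
  { intros j k. induction k as [|k IH]; intros Hjk; [lia|].
    specialize (Bd1 k ltac:(lia)). simpl in Bd1.
    destruct (Nat.eq_dec j k) as [->|Hne]; [lra|]. specialize (IH ltac:(lia)). lra. }
  (* Distance beyond which a shift by the difference of two jumps, at most 2 B, changes an argument
     by at most [err]. *)
  set (Q := (2 * B + 1) / err).
  assert (HQ : 0 < Q) by (apply Rdiv_lt_0_compat; lra).
  exists (Q + B), (Rmin (d * err) (eta / 2)).
  split; [apply Rmin_glb_lt; [now apply Rmult_lt_0_compat|lra]|].
  intros X Y HY [HX|[HX|HX]].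
  1,2: left; apply (ROOT X Y (th (X - x 0%nat) Y)); [pose proof (th_bounds (X - x 0%nat) Y); lra|];
    intros k Hk; pose proof (BB k Hk) as Bk; pose proof (BB 0%nat ltac:(lia)) as B0;
    apply Rabs_le_between in Bk; apply Rabs_le_between in B0;
    apply Rle_trans with ((2 * B + 1) / Q); [|right; unfold Q; field; lra];
    apply th_far; [assumption|assumption|apply Rabs_le; lra|].
  - right. unfold Rabs in HX. destruct (Rcase_abs X); [right|left]; lra.
  - left. lra.
  - pose proof (Rmin_l (d * err) (eta / 2)). pose proof (Rmin_r (d * err) (eta / 2)).
    destruct (locate_jump p x d X Hd GAP) as (k & Hk & L1 & L2).
    assert (STEPK : forall k, (k <= p)%nat -> (forall j, (j < k)%nat -> d <= X - x j) ->
       (forall j, (k < j <= p)%nat -> X - x j <= - d) ->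
       box (Csub (c (S k)) (Cscale (th (X - x k) Y / PI) (edge_vec c k))) eta (poly_map p c x X Y)).
    { clear k Hk L1 L2. intros k Hk L1 L2. apply STEP; [lia|]. intros j Hj. unfold step_arg.
      destruct (Nat.ltb_spec j k) as [Hjk|Hjk].
      - apply (th_small _ _ d); try lra. now apply L1.
      - destruct (Nat.eqb_spec j k) as [->|Hne].
        + rewrite Rminus_diag, Rabs_R0. lra.
        + apply (th_large _ _ d); try lra. apply L2. lia. }
    assert (EDGEK : forall k, (k <= p)%nat -> k <> 0%nat -> (forall j, (j < k)%nat -> d <= X - x j) ->
       (forall j, (k < j <= p)%nat -> X - x j <= - d) ->
       exists k w, (k < n)%nat /\ k <> 0%nat /\ on_seg (c k) (c (next n k)) w /\ box w eta (poly_map p c x X Y)).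
    { clear k Hk L1 L2. intros k Hk K0 L1 L2. exists k. eexists. split; [unfold n; lia|]. split; [assumption|].
      split; [|apply (STEPK k Hk L1 L2)].
      unfold n. rewrite next_lt by lia. pose proof (th_bounds (X - x k) Y) as Tb.
      exists (1 - th (X - x k) Y / PI). split.
      - assert (0 <= th (X - x k) Y / PI <= 1); [|lra].
        split; [apply Rdiv_le_0_compat; lra|]. apply Rle_div_l; lra.
      - unfold Cadd, Csub, Cscale, edge_vec, Csub. cbn [fst snd]. f_equal; ring. }
    (* With k = 0 the point may still be at distance d from the jump: to its right the value is near
       [c 1] and is charged to edge 1, to its left it is near [c 0] and is charged to the closing
       edge. *)
    destruct (Nat.eq_dec k 0) as [->|Hk0]; [|left; now apply (EDGEK k)].
    destruct (Rle_dec d (X - x 0%nat)) as [E1|E1].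
    { left. apply (EDGEK 1%nat); try lia.
      - intros j Hj. now replace j with 0%nat by lia.
      - intros j Hj. apply L2. lia. }
    destruct (Rle_dec (X - x 0%nat) (- d)) as [E2|E2].
    { left. apply (ROOT X Y PI); [lra|]. intros j Hj. apply (th_large _ _ d); try lra.
      destruct (Nat.eq_dec j 0) as [->|]; [assumption|apply L2; lia]. }
    right. destruct (polar_coordinates (X - x 0%nat) Y HY) as (r & t & Hr & Hrb & Ht & Eu & EY & Et).
    exists r, t. split; [|split; [assumption|]].
    + split; [assumption|]. assert (Rabs (X - x 0%nat) <= d) by (apply Rabs_le; lra). lra.
    + split; [lra|]. split; [assumption|]. rewrite Et. apply STEPK; [lia|intros; lia|exact L2].
Qed.

(** * Preimages and the polygon *)

Lemma Cpt_eq (a b : Cpt) : fst a = fst b -> snd a = snd b -> a = b.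
Proof. destruct a, b; simpl; intros -> ->; reflexivity. Qed.

Lemma box_center w d : 0 < d -> box w d w.
Proof. intros Hd. split; rewrite Rminus_diag, Rabs_R0; exact Hd. Qed.

Lemma box_sym w z d : box w d z -> box z d w.
Proof. intros (H1 & H2). split; rewrite Rabs_minus_sym; assumption. Qed.

Lemma box_mono w d d' z : d <= d' -> box w d z -> box w d' z.
Proof. intros H (H1 & H2). split; lra. Qed.

Lemma box_trans w d z d' y : box w d z -> box z d' y -> box w (d + d') y.
Proof.
  intros (H1 & H2) (H3 & H4). split.
  - replace (fst y - fst w) with ((fst y - fst z) + (fst z - fst w)) by ring.
    eapply Rle_lt_trans; [apply Rabs_triang|]. lra.
  - replace (snd y - snd w) with ((snd y - snd z) + (snd z - snd w)) by ring.
    eapply Rle_lt_trans; [apply Rabs_triang|]. lra.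
Qed.

Lemma box_separate w z : w <> z -> exists d, 0 < d /\ forall y, box w d y -> ~ box z d y.
Proof.
  intros Hne.
  assert (Hp : 0 < Rabs (fst z - fst w) + Rabs (snd z - snd w)).
  { pose proof (Rabs_pos (fst z - fst w)) as P1. pose proof (Rabs_pos (snd z - snd w)) as P2.
    destruct (Req_dec (Rabs (fst z - fst w) + Rabs (snd z - snd w)) 0) as [E|E]; [|lra].
    exfalso. apply Hne. apply Cpt_eq; symmetry; apply Rminus_diag_uniq; apply Rabs_eq_0; lra. }
  exists ((Rabs (fst z - fst w) + Rabs (snd z - snd w)) / 4). split; [lra|].
  intros y H1 H2. apply box_sym in H2. destruct (box_trans _ _ _ _ _ H1 H2). lra.
Qed.

Lemma seg_separate a b w : ~ on_seg a b w -> exists d, 0 < d /\ forall z, box w d z -> ~ on_seg a b z.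
Proof.
  intros Hw.
  set (q := fun s => Cadd a (Cscale s (Csub b a))).
  set (h := fun s => Rabs (fst (q s) - fst w) + Rabs (snd (q s) - snd w)).
  assert (Hc : forall s, 0 <= s <= 1 -> continuity_pt h s).
  { intros s _. unfold h, q, Cadd, Cscale, Csub. simpl. reg. }
  destruct (continuity_ab_min h 0 1 ltac:(lra) Hc) as (s0 & Hmin & Hs0).
  assert (Hp : 0 < h s0).
  { unfold h. pose proof (Rabs_pos (fst (q s0) - fst w)) as P1. pose proof (Rabs_pos (snd (q s0) - snd w)) as P2.
    destruct (Req_dec (Rabs (fst (q s0) - fst w) + Rabs (snd (q s0) - snd w)) 0) as [E|E]; [|lra].
    exfalso. apply Hw. exists s0. split; [assumption|]. fold (q s0).
    apply Cpt_eq; symmetry; apply Rminus_diag_uniq; apply Rabs_eq_0; lra. }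
  exists (h s0 / 2). split; [lra|]. intros z (B1 & B2) (s & Hs & ->).
  specialize (Hmin s Hs). unfold h at 2 in Hmin. fold (q s) in B1, B2. lra.
Qed.

Lemma finite_separate (P : nat -> Cpt -> Prop) w m :
  (forall k, (k < m)%nat -> exists d, 0 < d /\ forall z, box w d z -> P k z) ->
  exists d, 0 < d /\ forall k z, (k < m)%nat -> box w d z -> P k z.
Proof.
  induction m as [|m IH]; intros H.
  - exists 1. split; [lra|]. intros; lia.
  - destruct IH as (d1 & Hd1 & H1); [intros; apply H; lia|].
    destruct (H m ltac:(lia)) as (d2 & Hd2 & H2).
    exists (Rmin d1 d2). split; [now apply Rmin_glb_lt|].
    intros k z Hk Hz. destruct (Nat.eq_dec k m) as [->|Hne].
    + apply H2. eapply box_mono; [apply Rmin_r|exact Hz].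
    + apply H1; [lia|]. eapply box_mono; [apply Rmin_l|exact Hz].
Qed.

Lemma polygon_separate n c w : ~ on_polygon n c w ->
  exists d, 0 < d /\ forall z, box w d z -> ~ on_polygon n c z.
Proof.
  intros Hw.
  destruct (finite_separate (fun k z => ~ on_seg (c k) (c (next n k)) z) w n) as (d & Hd & H).
  - intros k Hk. apply seg_separate. intros Hs. apply Hw. now exists k.
  - exists d. split; [assumption|]. intros z Hz (k & Hk & Hs). exact (H k z Hk Hz Hs).
Qed.

(** Compactness of a rectangle in the form of a uniform radius; since [Q] passes to smaller radii,
    the radii attached to the points of a cover can be replaced by a common one. *)
Lemma rectangle_uniform a b a' b' (Q : R -> R -> R -> Prop) :
  (forall x y d d', 0 < d' <= d -> Q x y d -> Q x y d') ->
  (forall u v, a <= u <= b -> a' <= v <= b' ->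
     exists d, 0 < d /\ forall x y, Rabs (x - u) < d -> Rabs (y - v) < d -> Q x y d) ->
  exists d, 0 < d /\ forall x y, a <= x <= b -> a' <= y <= b' -> Q x y d.
Proof.
  intros Hmono Hloc.
  assert (E : forall u v, exists d : posreal, a <= u <= b -> a' <= v <= b' ->
     forall x y, Rabs (x - u) < d -> Rabs (y - v) < d -> Q x y d).
  { intros u v. destruct (classic (a <= u <= b /\ a' <= v <= b')) as [(Hu & Hv)|Hn].
    - destruct (Hloc u v Hu Hv) as (d & Hd & H). exists (mkposreal d Hd). intros _ _. exact H.
    - exists (mkposreal 1 Rlt_0_1). intros Hu Hv. exfalso. now apply Hn. }
  set (delta := fun u v => proj1_sig (constructive_indefinite_description _ (E u v))).
  destruct (compactness_value_2d a b a' b' delta) as (d & Hd).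
  exists d. split; [apply cond_pos|]. intros x y Hx Hy.
  apply NNPP. intros Hn. apply (Hd x y Hx Hy). intros (u & v & Hu & Hv & X1 & X2 & X3).
  apply Hn. apply Hmono with (delta u v); [split; [apply cond_pos|exact X3]|].
  exact (proj2_sig (constructive_indefinite_description _ (E u v)) Hu Hv x y X1 X2).
Qed.

(** The indicator with values 1 and -1 of a locally constant predicate is continuous, and the
    intermediate value theorem forbids a change of sign. Clamping extends it from [a, b] to the
    whole line. *)
Lemma interval_connected (Q : R -> Prop) a b : a <= b ->
  (forall s, a <= s <= b -> exists d, 0 < d /\ forall s', a <= s' <= b -> Rabs (s' - s) < d -> (Q s' <-> Q s)) ->
  Q a -> Q b.
Proof.
  intros Hab H Ha.
  set (cl := fun s => Rmax a (Rmin b s)).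
  assert (Hcl : forall s, a <= cl s <= b).
  { intros s. unfold cl, Rmax, Rmin. destruct (Rle_dec b s); destruct (Rle_dec a _); lra. }
  assert (HL : forall s s', Rabs (cl s' - cl s) <= Rabs (s' - s)).
  { intros s s'. unfold cl, Rmax, Rmin.
    destruct (Rle_dec b s); destruct (Rle_dec b s'); repeat destruct (Rle_dec a _);
     unfold Rabs; repeat destruct (Rcase_abs _); lra. }
  set (h := fun s => if excluded_middle_informative (Q (cl s)) then 1 else -1).
  assert (Hc : continuity h).
  { intros s eps Heps. destruct (H (cl s) (Hcl s)) as (d & Hd & HQ).
    exists d. split; [assumption|]. intros s' (_ & Hs'). simpl in *. unfold Rdist in *.
    assert (E : Q (cl s') <-> Q (cl s)) by (apply HQ; [apply Hcl|specialize (HL s s'); lra]).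
    unfold h. destruct (excluded_middle_informative (Q (cl s'))); destruct (excluded_middle_informative (Q (cl s)));
      try tauto; rewrite Rminus_diag, Rabs_R0; assumption. }
  assert (Ca : cl a = a) by (unfold cl, Rmax, Rmin; destruct (Rle_dec b a); destruct (Rle_dec a _); lra).
  assert (Cb : cl b = b) by (unfold cl, Rmax, Rmin; destruct (Rle_dec b b); destruct (Rle_dec a _); lra).
  apply NNPP. intros Hb.
  assert (h a = 1). { unfold h. rewrite Ca. destruct (excluded_middle_informative _); tauto. }
  assert (h b = -1). { unfold h. rewrite Cb. destruct (excluded_middle_informative _); tauto. }
  destruct (IVT_cor h a b Hc Hab) as (s & _ & Hs); [nra|].
  unfold h in Hs. destruct (excluded_middle_informative _); lra.
Qed.

(** Such a predicate is constant on every component of the complement, whatever it says on the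
    polygon; it stands for a union of components. *)
Definition off_clopen (n : nat) (c : nat -> Cpt) (P : Cpt -> Prop) : Prop :=
  forall w, ~ on_polygon n c w -> exists d, 0 < d /\ forall z, box w d z -> (P z <-> P w).

Lemma joined_off_clopen n c P z w : off_clopen n c P -> joined_off_polygon n c z w -> P z -> P w.
Proof.
  intros HP (g & C1 & C2 & <- & <- & Hoff) Hz.
  apply (interval_connected (fun s => P (g s)) 0 1); [lra| |exact Hz].
  intros s Hs. destruct (HP (g s) (Hoff s Hs)) as (d & Hd & H).
  destruct (C1 s d Hd) as (d1 & Hd1 & H1). destruct (C2 s d Hd) as (d2 & Hd2 & H2).
  simpl in H1, H2. unfold Rdist, D_x, no_cond in H1, H2.
  exists (Rmin d1 d2). split; [now apply Rmin_glb_lt|]. intros s' _ Hs'.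
  pose proof (Rmin_l d1 d2). pose proof (Rmin_r d1 d2).
  apply H. destruct (Req_dec s s') as [->|Hne]; [now apply box_center|].
  split; [apply H1|apply H2]; repeat split; auto; lra.
Qed.

(** * Images and unique preimages off the polygon *)

Definition image (p : nat) (c : nat -> Cpt) (x : nat -> R) (w : Cpt) : Prop :=
  exists X Y, 0 < Y /\ poly_map p c x X Y = w.

Definition single_preimage (p : nat) (c : nat -> Cpt) (x : nat -> R) (w : Cpt) : Prop :=
  image p c x w /\ forall X Y X' Y', 0 < Y -> 0 < Y' ->
    poly_map p c x X Y = w -> poly_map p c x X' Y' = w -> X = X' /\ Y = Y'.

(** The determinant of the differential is Y0 / PI^2 times [jac], hence positive; r <= Y0 keeps the
    neighbourhood inside the half-plane. *)
Lemma poly_map_local p c x X0 Y0 : jac_positive (S p) (edge_vec c) x -> 0 < Y0 ->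
  exists r, 0 < r <= Y0 /\
    (forall X Y X' Y', Rabs (X - X0) < r -> Rabs (Y - Y0) < r -> Rabs (X' - X0) < r -> Rabs (Y' - Y0) < r ->
       poly_map p c x X Y = poly_map p c x X' Y' -> X = X' /\ Y = Y') /\
    forall s, 0 < s <= r -> exists eta, 0 < eta /\ forall w, box (poly_map p c x X0 Y0) eta w ->
      exists X Y, Rabs (X - X0) < s /\ Rabs (Y - Y0) < s /\ poly_map p c x X Y = w.
Proof.
  intros (k & Hk & HJ) HY0.
  pose proof (hmap_strict_diff (fst (c (S p))) (S p) (fun k => fst (edge_vec c k)) x X0 Y0 HY0) as D1.
  pose proof (hmap_strict_diff (snd (c (S p))) (S p) (fun k => snd (edge_vec c k)) x X0 Y0 HY0) as D2.
  pose proof PI_RGT_0.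
  destruct (inverse_function _ _ _ _ _ _ _ _ D1 D2) as (r & Hr & Hinj & Hopen).
  { match goal with |- ?a <> 0 => replace a with (Y0 / (PI * PI) * jac (S p) (edge_vec c) x X0 Y0) end.
    2:{ unfold jac. field. lra. }
    apply Rgt_not_eq. apply Rmult_lt_0_compat.
    - apply Rdiv_lt_0_compat; nra.
    - specialize (HJ X0 Y0 HY0).
      assert (HW : 0 < wsum (S p) x X0 Y0).
      { unfold wsum. simpl.
        assert (0 <= bsum (fun k => / sqd (x k) X0 Y0) p).
        { apply bsum_ge0. intros j _. left. apply Rinv_0_lt_compat. now apply sqd_pos. }
        pose proof (Rinv_0_lt_compat _ (sqd_pos (x p) X0 Y0 HY0)). lra. }
      assert (HN : 0 < 1 + (X0 * X0 + Y0 * Y0)) by (pose proof (mul_self_ge0 X0); nra).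
      apply Rnot_le_lt. intros Hneg.
      assert (0 < k * wsum (S p) x X0 Y0) by now apply Rmult_lt_0_compat. nra. }
  exists (Rmin r Y0). split; [split; [now apply Rmin_glb_lt|apply Rmin_r]|].
  pose proof (Rmin_l r Y0). split.
  - intros X Y X' Y' A1 A2 A3 A4 E. apply Hinj; try lra.
    + exact (f_equal fst E).
    + exact (f_equal snd E).
  - intros s Hs. destruct (Hopen s ltac:(lra)) as (eta & Heta & H1).
    exists eta. split; [assumption|]. intros w (W1 & W2).
    destruct (H1 (fst w) (snd w) W1 W2) as (X & Y & A1 & A2 & A3 & A4).
    exists X, Y. repeat split; try assumption. now apply Cpt_eq.
Qed.

Lemma strict_diff_continuous g p q a b eps : strict_diff g p q a b -> 0 < eps ->
  exists d, 0 < d /\ forall x y, Rabs (x - p) < d -> Rabs (y - q) < d -> Rabs (g x y - g p q) < eps.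
Proof.
  intros H He. destruct (H 1 Rlt_0_1) as (d & Hd & G).
  set (K := Rabs a + Rabs b + 2).
  assert (HK : 0 < K) by (unfold K; pose proof (Rabs_pos a); pose proof (Rabs_pos b); lra).
  assert (He' : 0 < eps / K) by now apply Rdiv_lt_0_compat.
  assert (EK : K * (eps / K) = eps) by (field; lra).
  set (e := eps / K) in *.
  exists (Rmin d e). split; [now apply Rmin_glb_lt|].
  pose proof (Rmin_l d e). pose proof (Rmin_r d e).
  intros x y Hx Hy.
  assert (Z : forall r, Rabs (r - r) < d) by (intros r; rewrite Rminus_diag, Rabs_R0; lra).
  specialize (G x y p q ltac:(lra) ltac:(lra) (Z p) (Z q)).
  replace (g x y - g p q) with ((g x y - g p q - (a * (x - p) + b * (y - q))) + (a * (x - p) + b * (y - q))) by ring.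
  eapply Rle_lt_trans; [apply Rabs_triang|].
  eapply Rle_lt_trans; [apply Rplus_le_compat; [exact G|apply Rabs_triang]|].
  rewrite !Rabs_mult.
  assert (Rabs a * Rabs (x - p) <= Rabs a * e) by (apply Rmult_le_compat_l; [apply Rabs_pos|lra]).
  assert (Rabs b * Rabs (y - q) <= Rabs b * e) by (apply Rmult_le_compat_l; [apply Rabs_pos|lra]).
  unfold K in EK. lra.
Qed.

Lemma poly_map_continuous p c x X0 Y0 eps : 0 < Y0 -> 0 < eps ->
  exists d, 0 < d /\ forall X Y, Rabs (X - X0) < d -> Rabs (Y - Y0) < d ->
    box (poly_map p c x X0 Y0) eps (poly_map p c x X Y).
Proof.
  intros HY0 He.
  destruct (strict_diff_continuous _ _ _ _ _ eps (hmap_strict_diff (fst (c (S p))) (S p) (fun k => fst (edge_vec c k)) x X0 Y0 HY0) He) as (d1 & Hd1 & H1).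
  destruct (strict_diff_continuous _ _ _ _ _ eps (hmap_strict_diff (snd (c (S p))) (S p) (fun k => snd (edge_vec c k)) x X0 Y0 HY0) He) as (d2 & Hd2 & H2).
  exists (Rmin d1 d2). split; [now apply Rmin_glb_lt|].
  pose proof (Rmin_l d1 d2). pose proof (Rmin_r d1 d2).
  intros X Y A1 A2. split; [apply H1|apply H2]; lra.
Qed.

(** A form of properness: a region Z that is a neighbourhood of each preimage of w0, and contains
    the points near the boundary with values near w0, captures all preimages of nearby points.
    Compactness is applied on the rectangle |X| <= R0, d0 <= Y <= R0. *)
Lemma preimage_localization p c x w0 (Z : R -> R -> Prop) R0 d0 eta0 : 0 < d0 -> 0 < eta0 ->
  (forall X Y, 0 < Y -> (R0 < Rabs X \/ R0 < Y \/ Y < d0) -> box w0 eta0 (poly_map p c x X Y) -> Z X Y) ->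
  (forall X Y, 0 < Y -> poly_map p c x X Y = w0 ->
     exists d, 0 < d /\ forall X' Y', Rabs (X' - X) < d -> Rabs (Y' - Y) < d -> Z X' Y') ->
  exists eta, 0 < eta /\ forall X Y, 0 < Y -> box w0 eta (poly_map p c x X Y) -> Z X Y.
Proof.
  intros Hd0 Heta0 Hout Hin.
  destruct (rectangle_uniform (- R0) R0 d0 R0 (fun X Y d => box w0 d (poly_map p c x X Y) -> Z X Y)) as (d & Hd & H).
  - intros X Y d d' Hdd HQ Hb. apply HQ. eapply box_mono; [apply Hdd|exact Hb].
  - intros u v Hu Hv. assert (Hv0 : 0 < v) by lra.
    destruct (classic (poly_map p c x u v = w0)) as [E|E].
    + destruct (Hin u v Hv0 E) as (d & Hd & HZ). exists d. split; [assumption|]. intros; now apply HZ.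
    + destruct (box_separate (poly_map p c x u v) w0 E) as (d1 & Hd1 & H1).
      destruct (poly_map_continuous p c x u v d1 Hv0 Hd1) as (d2 & Hd2 & H2).
      exists (Rmin d1 d2). split; [now apply Rmin_glb_lt|].
      pose proof (Rmin_l d1 d2). pose proof (Rmin_r d1 d2).
      intros X Y A1 A2 Hb. exfalso. apply (H1 (poly_map p c x X Y)); [apply H2; lra|].
      eapply box_mono; [|exact Hb]. lra.
  - exists (Rmin eta0 d). split; [now apply Rmin_glb_lt|]. intros X Y HY Hb.
    pose proof (Rmin_l eta0 d). pose proof (Rmin_r eta0 d).
    destruct (classic (R0 < Rabs X \/ R0 < Y \/ Y < d0)) as [Ho|Ho].
    + apply Hout; [assumption|assumption|]. eapply box_mono; [|exact Hb]. lra.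
    + apply H; [apply Rabs_le_between; lra|lra|]. eapply box_mono; [|exact Hb]. lra.
Qed.

Lemma image_open p c x w : jac_positive (S p) (edge_vec c) x -> image p c x w ->
  exists d, 0 < d /\ forall z, box w d z -> image p c x z.
Proof.
  intros HJ (X & Y & HY & <-).
  destruct (poly_map_local p c x X Y HJ HY) as (r & Hr & _ & Hopen).
  destruct (Hopen r ltac:(lra)) as (eta & Heta & H). exists eta. split; [assumption|].
  intros z Hz. destruct (H z Hz) as (X' & Y' & A1 & A2 & A3). exists X', Y'. split; [|assumption].
  apply Rabs_def2 in A2. lra.
Qed.

Lemma near_edge0 (c : nat -> Cpt) n t : (2 <= n)%nat -> 0 < t < PI ->
  on_polygon n c (Csub (c 1%nat) (Cscale (t / PI) (edge_vec c 0%nat))).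
Proof.
  intros Hn Ht. exists 0%nat. split; [lia|]. rewrite next_lt by lia.
  exists (1 - t / PI). split.
  - assert (0 < t / PI < 1); [|lra]. split; [apply Rdiv_lt_0_compat; lra|]. apply Rlt_div_l; lra.
  - unfold Cadd, Csub, Cscale, edge_vec, Csub. cbn [fst snd]. f_equal; ring.
Qed.

(** Values near the boundary are close to the polygon and hence stay away from w0, which settles the
    part of the properness condition near the boundary. *)
Lemma preimage_localization_off p c x w0 (Z : R -> R -> Prop) : (1 <= p)%nat -> increasing (S p) x ->
  ~ on_polygon (S (S p)) c w0 ->
  (forall X Y, 0 < Y -> poly_map p c x X Y = w0 ->
     exists d, 0 < d /\ forall X' Y', Rabs (X' - X) < d -> Rabs (Y' - Y) < d -> Z X' Y') ->
  exists eta, 0 < eta /\ forall X Y, 0 < Y -> box w0 eta (poly_map p c x X Y) -> Z X Y.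
Proof.
  intros Hp Hx Hw Hin.
  destruct (polygon_separate _ _ _ Hw) as (d & Hd & Hsep).
  destruct (boundary_behaviour p c x (d / 2) Hp Hx ltac:(lra)) as (R0 & d0 & Hd0 & HB).
  apply (preimage_localization p c x w0 Z R0 d0 (d / 2)); try assumption; [lra|].
  intros X Y HY Hout Hb. exfalso.
  destruct (HB X Y HY Hout) as [(k & w & Hk & _ & Hs & Hbw)|(r & t & Hr & Ht & _ & _ & Hbw)].
  - apply (Hsep w); [|now exists k]. replace d with (d / 2 + d / 2) by field.
    eapply box_trans; [exact Hb|]. now apply box_sym.
  - eapply Hsep; [|apply near_edge0 with (t := t); [lia|exact Ht]].
    replace d with (d / 2 + d / 2) by field. eapply box_trans; [exact Hb|]. now apply box_sym.
Qed.

(** Open since the map is a local homeomorphism; closed off the polygon by properness, applied with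
    an empty region. *)
Lemma image_clopen p c x : (1 <= p)%nat -> increasing (S p) x ->
  jac_positive (S p) (edge_vec c) x -> off_clopen (S (S p)) c (image p c x).
Proof.
  intros Hp Hx HJ w Hw. destruct (classic (image p c x w)) as [Hi|Hi].
  - destruct (image_open p c x w HJ Hi) as (d & Hd & H). exists d. split; [assumption|].
    intros z Hz. split; auto.
  - destruct (preimage_localization_off p c x w (fun _ _ => False) Hp Hx Hw) as (d & Hd & H).
    + intros X Y HY E. exfalso. apply Hi. now exists X, Y.
    + exists d. split; [assumption|]. intros z Hz. split; [|tauto].
      intros (X & Y & HY & <-). exfalso. now apply (H X Y).
Qed.

(** A unique preimage stays unique, since all preimages of nearby points fall into one neighbourhood
    of injectivity. Two distinct preimages persist in disjoint neighbourhoods by openness. *)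
Lemma single_preimage_clopen p c x : (1 <= p)%nat -> increasing (S p) x ->
  jac_positive (S p) (edge_vec c) x -> off_clopen (S (S p)) c (single_preimage p c x).
Proof.
  intros Hp Hx HJ w Hw.
  destruct (image_clopen p c x Hp Hx HJ w Hw) as (d1 & Hd1 & H1).
  destruct (classic (single_preimage p c x w)) as [Hs|Hs].
  - destruct Hs as (Hi & Hu). destruct Hi as (X0 & Y0 & HY0 & E0).
    destruct (poly_map_local p c x X0 Y0 HJ HY0) as (r & Hr & Hinj & _).
    destruct (preimage_localization_off p c x w (fun X Y => Rabs (X - X0) < r /\ Rabs (Y - Y0) < r) Hp Hx Hw) as (d2 & Hd2 & H2).
    { intros X Y HY E. destruct (Hu X Y X0 Y0 HY HY0 E E0) as (-> & ->).
      exists r. split; [lra|]. auto. }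
    exists (Rmin d1 d2). split; [now apply Rmin_glb_lt|].
    pose proof (Rmin_l d1 d2). pose proof (Rmin_r d1 d2).
    intros z Hz. split; intros _.
    + split; [now exists X0, Y0|exact Hu].
    + split.
      * apply H1; [eapply box_mono; [|exact Hz]; lra|]. now exists X0, Y0.
      * intros X Y X' Y' HY HY' E E'.
        destruct (H2 X Y HY) as (A1 & A2). { rewrite E. eapply box_mono; [|exact Hz]; lra. }
        destruct (H2 X' Y' HY') as (A3 & A4). { rewrite E'. eapply box_mono; [|exact Hz]; lra. }
        apply Hinj; try assumption. now rewrite E, E'.
  - destruct (classic (image p c x w)) as [Hi|Hi].
    2:{ exists d1. split; [assumption|]. intros z Hz. split; [|tauto]. intros (Hiz & _).
        exfalso. apply Hi. now apply (H1 z Hz). }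
    assert (Htwo : exists X Y X' Y', 0 < Y /\ 0 < Y' /\ poly_map p c x X Y = w /\ poly_map p c x X' Y' = w /\ (X, Y) <> (X', Y')).
    { apply NNPP. intros Hn. apply Hs. split; [assumption|]. intros X Y X' Y' HY HY' E E'.
      assert (Heq : (X, Y) = (X', Y')) by (apply NNPP; intros Hne; apply Hn; now exists X, Y, X', Y').
      inversion Heq; now split. }
    destruct Htwo as (X & Y & X' & Y' & HY & HY' & E & E' & Hne).
    destruct (box_separate _ _ Hne) as (s & Hss & Hsep).
    destruct (poly_map_local p c x X Y HJ HY) as (r & Hr & _ & Ho).
    destruct (poly_map_local p c x X' Y' HJ HY') as (r' & Hr' & _ & Ho').
    destruct (Ho (Rmin r s)) as (e & He & G). { split; [apply Rmin_glb_lt; lra|apply Rmin_l]. }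
    destruct (Ho' (Rmin r' s)) as (e' & He' & G'). { split; [apply Rmin_glb_lt; lra|apply Rmin_l]. }
    pose proof (Rmin_l r s). pose proof (Rmin_r r s). pose proof (Rmin_l r' s). pose proof (Rmin_r r' s).
    exists (Rmin e e'). split; [now apply Rmin_glb_lt|].
    pose proof (Rmin_l e e'). pose proof (Rmin_r e e').
    intros z Hz. split; [|tauto]. intros (_ & Hu). exfalso.
    destruct (G z) as (U & V & A1 & A2 & A3). { rewrite E. eapply box_mono; [|exact Hz]; lra. }
    destruct (G' z) as (U' & V' & B1 & B2 & B3). { rewrite E'. eapply box_mono; [|exact Hz]; lra. }
    destruct (Hu U V U' V') as (-> & ->); try assumption.
    { apply Rabs_def2 in A2; lra. } { apply Rabs_def2 in B2; lra. }
    apply (Hsep (U', V')); split; simpl; lra.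
Qed.

(* Positive when [w] lies to the left of the line from [a] to [b]. *)
Definition side (a b w : Cpt) : R := cross (Csub b a) (Csub w a).

(** * The polar chart across the first edge *)

Definition midpoint (a b : Cpt) : Cpt := Cscale (1 / 2) (Cadd a b).

Definition polar_poly_map (p : nat) (c : nat -> Cpt) (x : nat -> R) (r t : R) : Cpt :=
  (polar_map (fst (c (S p))) p (fun k => fst (edge_vec c k)) x r t,
   polar_map (snd (c (S p))) p (fun k => snd (edge_vec c k)) x r t).

(** On r = 0 the chart runs along the line of edge 0, and its radial derivative points strictly to
    the left of it. Hence the sign of r tells the side, while the part with r > 0 is the original
    map. *)
Lemma polar_poly_map_local p c x : increasing (S p) x -> jac_positive (S p) (edge_vec c) x ->
  exists s, 0 < s <= 1 /\
    (forall r t r' t', Rabs r < s -> Rabs (t - PI / 2) < s -> Rabs r' < s -> Rabs (t' - PI / 2) < s ->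
       polar_poly_map p c x r t = polar_poly_map p c x r' t' -> r = r' /\ t = t') /\
    (forall r t, Rabs r < s -> Rabs (t - PI / 2) < s ->
       (0 < r -> 0 < side (c 0%nat) (c 1%nat) (polar_poly_map p c x r t)) /\
       (0 < side (c 0%nat) (c 1%nat) (polar_poly_map p c x r t) -> 0 < r)) /\
    (forall r t, 0 < r < s -> 0 < t < PI ->
       poly_map p c x (x 0%nat + r * cos t) (r * sin t) = polar_poly_map p c x r t) /\
    exists eta, 0 < eta /\ forall w, box (midpoint (c 0%nat) (c 1%nat)) eta w ->
       exists r t, Rabs r < s /\ Rabs (t - PI / 2) < s /\ polar_poly_map p c x r t = w.
Proof.
  intros Hx HJ.
  assert (Hpos : forall k, (k < p)%nat -> 0 < x (S k) - x 0%nat).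
  { intros k Hk. pose proof (increasing_lt _ _ Hx 0%nat (S k) ltac:(lia)). lra. }
  pose proof (jac_positive_at_jump p _ x HJ Hpos) as HK.
  pose proof PI_RGT_0. pose proof PI2_3_2.
  set (e1 := fst (edge_vec c 0%nat)) in *. set (e2 := snd (edge_vec c 0%nat)) in *.
  set (a1 := bsum (fun k => fst (edge_vec c (S k)) / (x (S k) - x 0%nat)) p) in *.
  set (a2 := bsum (fun k => snd (edge_vec c (S k)) / (x (S k) - x 0%nat)) p) in *.
  pose proof (polar_map_strict_diff (fst (c (S p))) p (fun k => fst (edge_vec c k)) x Hpos) as D1.
  pose proof (polar_map_strict_diff (snd (c (S p))) p (fun k => snd (edge_vec c k)) x Hpos) as D2.
  cbv beta in D1, D2. fold a1 e1 in D1. fold a2 e2 in D2.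
  destruct (inverse_function _ _ _ _ _ _ _ _ D1 D2) as (s1 & Hs1 & Hinj & Hopen).
  { replace (a1 / PI * - (e2 / PI) - - (e1 / PI) * (a2 / PI)) with ((e1 * a2 - e2 * a1) / (PI * PI)) by (field; lra).
    apply Rgt_not_eq. apply Rdiv_lt_0_compat; [exact HK|nra]. }
  (* Rate at which the chart leaves the line: [side] is [kap] r up to an error of at most [kap] / 2
     |r|, which the tolerance [kap] / 2 / [E] in the strict differentiability guarantees. *)
  set (kap := (e1 * a2 - e2 * a1) / PI).
  assert (Hkap : 0 < kap) by (apply Rdiv_lt_0_compat; lra).
  set (E := Rabs e1 + Rabs e2 + 1).
  assert (HE : 0 < E) by (unfold E; pose proof (Rabs_pos e1); pose proof (Rabs_pos e2); lra).
  assert (Heta : 0 < kap / 2 / E) by (repeat apply Rdiv_lt_0_compat; lra).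
  destruct (D1 _ Heta) as (s2 & Hs2 & L1). destruct (D2 _ Heta) as (s3 & Hs3 & L2).
  destruct (positive_min _ p Hpos) as (s4 & Hs4 & L4).
  set (s := Rmin (Rmin 1 s1) (Rmin (Rmin s2 s3) s4)).
  assert (Hs : 0 < s) by (repeat apply Rmin_glb_lt; lra).
  assert (S1 : s <= 1 /\ s <= s1 /\ s <= s2 /\ s <= s3 /\ s <= s4).
  { unfold s. pose proof (Rmin_l (Rmin 1 s1) (Rmin (Rmin s2 s3) s4)). pose proof (Rmin_r (Rmin 1 s1) (Rmin (Rmin s2 s3) s4)).
    pose proof (Rmin_l 1 s1). pose proof (Rmin_r 1 s1). pose proof (Rmin_l (Rmin s2 s3) s4). pose proof (Rmin_r (Rmin s2 s3) s4).
    pose proof (Rmin_l s2 s3). pose proof (Rmin_r s2 s3). lra. }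
  destruct S1 as (S0 & S1 & S2 & S3 & S4).
  assert (G0 : forall c0 g t, polar_map c0 p g x 0 t = c0 - bsum (fun k => g (S k)) p - g 0%nat * t / PI).
  { intros c0 g t. unfold polar_map.
    rewrite (bsum_ext (fun k => g (S k) * atan (0 * sin t / (x (S k) - x 0%nat - 0 * cos t))) (fun _ => 0)).
    - rewrite bsum_0. field. lra.
    - intros k _. unfold Rdiv. rewrite !Rmult_0_l, atan_0. ring. }
  assert (T1 : forall v : nat -> R, v (S p) - bsum (fun k => v (S (S k)) - v (S k)) p = v 1%nat).
  { intros v. rewrite (bsum_telescope (fun k => v (S k))). ring. }
  assert (P0 : forall t, polar_poly_map p c x 0 t = Csub (c 1%nat) (Cscale (t / PI) (edge_vec c 0%nat))).
  { intros t. unfold polar_poly_map. rewrite !G0. unfold edge_vec at 1 3, Csub at 1 2. cbn [fst snd].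
    rewrite (T1 (fun k => fst (c k))), (T1 (fun k => snd (c k))).
    unfold Csub, Cscale. cbn [fst snd]. unfold Rdiv. f_equal; ring. }
  exists s. split; [lra|]. split; [|split; [|split]].
  - intros r t r' t' A1 A2 A3 A4 Eq. apply Hinj; rewrite ?Rminus_0_r; try lra.
    + exact (f_equal fst Eq).
    + exact (f_equal snd Eq).
  - intros r t A1 A2.
    assert (Z : Rabs (0 - 0) < s) by (rewrite Rminus_0_r, Rabs_R0; lra).
    pose proof (L1 r t 0 t ltac:(rewrite Rminus_0_r; lra) ltac:(lra) ltac:(lra) ltac:(lra)) as M1.
    pose proof (L2 r t 0 t ltac:(rewrite Rminus_0_r; lra) ltac:(lra) ltac:(lra) ltac:(lra)) as M2.
    rewrite Rminus_0_r, Rminus_diag, Rabs_R0, Rmult_0_r, !Rplus_0_r in M1, M2.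
    set (m1 := polar_map (fst (c (S p))) p (fun k => fst (edge_vec c k)) x r t
       - polar_map (fst (c (S p))) p (fun k => fst (edge_vec c k)) x 0 t - a1 / PI * r) in *.
    set (m2 := polar_map (snd (c (S p))) p (fun k => snd (edge_vec c k)) x r t
       - polar_map (snd (c (S p))) p (fun k => snd (edge_vec c k)) x 0 t - a2 / PI * r) in *.
    assert (ES : side (c 0%nat) (c 1%nat) (polar_poly_map p c x r t) = kap * r + (e1 * m2 - e2 * m1)).
    { assert (E0 : side (c 0%nat) (c 1%nat) (polar_poly_map p c x 0 t) = 0).
      { rewrite P0. unfold side, cross, Csub, Cscale, edge_vec, Csub. cbn [fst snd]. ring. }
      transitivity (side (c 0%nat) (c 1%nat) (polar_poly_map p c x r t) - side (c 0%nat) (c 1%nat) (polar_poly_map p c x 0 t)); [rewrite E0; ring|].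
      unfold side, cross. cbn [polar_poly_map Csub fst snd].
      change (fst (c 1%nat) - fst (c 0%nat)) with e1. change (snd (c 1%nat) - snd (c 0%nat)) with e2.
      unfold m1, m2, kap. field. lra. }
    assert (EB : Rabs (e1 * m2 - e2 * m1) <= kap / 2 * Rabs r).
    { unfold Rminus at 1. eapply Rle_trans; [apply Rabs_triang|]. rewrite Rabs_Ropp, !Rabs_mult.
      set (q := kap / 2 / E * Rabs r) in *.
      assert (EQ : kap / 2 * Rabs r = E * q) by (unfold q; field; lra). rewrite EQ.
      assert (Hq : 0 <= q) by (apply Rmult_le_pos; [lra|apply Rabs_pos]).
      assert (Rabs e1 * Rabs m2 <= Rabs e1 * q) by (apply Rmult_le_compat_l; [apply Rabs_pos|exact M2]).
      assert (Rabs e2 * Rabs m1 <= Rabs e2 * q) by (apply Rmult_le_compat_l; [apply Rabs_pos|exact M1]).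
      unfold E. lra. }
    apply Rabs_le_between in EB. rewrite ES. split.
    + intros Hr. rewrite Rabs_right in EB by lra. nra.
    + intros Hpos'. apply Rnot_le_lt. intros Hr. rewrite Rabs_left1 in EB by lra. nra.
  - intros r t Hr Ht. unfold poly_map, polar_poly_map.
    rewrite !hmap_polar; try lra; [reflexivity| |]; intros k Hk; specialize (L4 k Hk); simpl in L4; lra.
  - destruct (Hopen s ltac:(lra)) as (eta & Heta' & Ho). exists eta. split; [assumption|].
    assert (Hmid : polar_poly_map p c x 0 (PI / 2) = midpoint (c 0%nat) (c 1%nat)).
    { rewrite P0. unfold midpoint, Csub, Cscale, Cadd, edge_vec, Csub. cbn [fst snd]. f_equal; field; lra. }
    rewrite <- Hmid. intros w (W1 & W2).
    destruct (Ho (fst w) (snd w) W1 W2) as (r & t & A1 & A2 & A3 & A4).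
    rewrite Rminus_0_r in A1. exists r, t. repeat split; try assumption. now apply Cpt_eq.
Qed.

Lemma left_in_image p c x : increasing (S p) x -> jac_positive (S p) (edge_vec c) x ->
  exists d, 0 < d /\ forall w, box (midpoint (c 0%nat) (c 1%nat)) d w ->
    0 < side (c 0%nat) (c 1%nat) w -> image p c x w.
Proof.
  intros Hx HJ. destruct (polar_poly_map_local p c x Hx HJ) as (s & Hs & _ & Hsign & Hpol & eta & Heta & Ho).
  exists eta. split; [assumption|]. intros w Hw Hside.
  destruct (Ho w Hw) as (r & t & A1 & A2 & A3).
  pose proof PI2_3_2. apply Rabs_def2 in A2 as B2.
  assert (Hr : 0 < r) by (apply (Hsign r t A1 A2); rewrite A3; exact Hside).
  apply Rabs_def2 in A1.
  exists (x 0%nat + r * cos t), (r * sin t). split.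
  - apply Rmult_lt_0_compat; [assumption|]. apply sin_gt_0; lra.
  - rewrite Hpol; [assumption|lra|lra].
Qed.

(** The midpoint has no preimage, being a limit of points outside the open image. So preimages of
    nearby points lie near the boundary, with boundary values near the middle of edge 0 and away
    from the other edges; they fall into the polar chart, which is injective. *)
Lemma single_preimage_left p c x : (1 <= p)%nat -> increasing (S p) x ->
  jac_positive (S p) (edge_vec c) x -> c 0%nat <> c 1%nat ->
  (forall k, (k < S (S p))%nat -> k <> 0%nat -> ~ on_seg (c k) (c (next (S (S p)) k)) (midpoint (c 0%nat) (c 1%nat))) ->
  (forall d, 0 < d -> exists w, box (midpoint (c 0%nat) (c 1%nat)) d w /\ ~ image p c x w) ->
  exists d, 0 < d /\ forall w, box (midpoint (c 0%nat) (c 1%nat)) d w ->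
    0 < side (c 0%nat) (c 1%nat) w -> single_preimage p c x w.
Proof.
  intros Hp Hx HJ Hne Hother Hout. set (w0 := midpoint (c 0%nat) (c 1%nat)) in *.
  pose proof PI_RGT_0. pose proof PI2_3_2.
  destruct (left_in_image p c x Hx HJ) as (d1 & Hd1 & Himg).
  destruct (polar_poly_map_local p c x Hx HJ) as (s & Hs & Hinj & _ & Hpol & _).
  destruct (finite_separate (fun k z => k <> 0%nat -> ~ on_seg (c k) (c (next (S (S p)) k)) z) w0 (S (S p))) as (d2 & Hd2 & Hsep).
  { intros k Hk. destruct (Nat.eq_dec k 0) as [->|Hk0].
    - exists 1. split; [lra|]. intros z _ Hc. congruence.
    - destruct (seg_separate _ _ _ (Hother k Hk Hk0)) as (d & Hd & H1). exists d. split; [assumption|]. intros; now apply H1. }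
  set (e := edge_vec c 0%nat) in *.
  set (M := Rmax (Rabs (fst e)) (Rabs (snd e))).
  assert (HM : 0 < M).
  { assert (Rabs (fst e) <= M) by apply Rmax_l. assert (Rabs (snd e) <= M) by apply Rmax_r.
    pose proof (Rabs_pos (fst e)). pose proof (Rabs_pos (snd e)).
    apply Rnot_le_lt. intros HM. apply Hne.
    assert (fst e = 0) by (apply Rabs_eq_0; lra). assert (snd e = 0) by (apply Rabs_eq_0; lra).
    unfold e, edge_vec, Csub in *. cbn [fst snd] in *. apply Cpt_eq; lra. }
  set (eta := Rmin (Rmin s (d2 / 2)) (M * s / (8 * PI))).
  assert (Heta : 0 < eta).
  { repeat apply Rmin_glb_lt; try lra. apply Rdiv_lt_0_compat; [apply Rmult_lt_0_compat|]; lra. }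
  assert (E1 : eta <= s) by (eapply Rle_trans; [apply Rmin_l|apply Rmin_l]).
  assert (E2 : eta <= d2 / 2) by (eapply Rle_trans; [apply Rmin_l|apply Rmin_r]).
  assert (E3 : eta <= M * s / (8 * PI)) by apply Rmin_r.
  destruct (boundary_behaviour p c x eta Hp Hx Heta) as (R0 & d0 & Hd0 & HB).
  set (Z := fun X Y => exists r t, 0 < r < s /\ Rabs (t - PI / 2) < s /\ 0 < t < PI /\
     X = x 0%nat + r * cos t /\ Y = r * sin t).
  destruct (preimage_localization p c x w0 Z R0 d0 eta Hd0 Heta) as (d3 & Hd3 & HZ).
  { intros X Y HY Hb Hbox.
    destruct (HB X Y HY Hb) as [(k & w & Hk & Hk0 & Hs' & Hbw)|(r & t & Hr & Ht & EX & EY & Hbw)].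
    - exfalso. apply (Hsep k w Hk); try assumption. replace d2 with (d2 / 2 + d2 / 2) by field.
      eapply box_trans; [eapply box_mono; [exact E2|exact Hbox]|]. apply box_sym. eapply box_mono; [exact E2|exact Hbw].
    - exists r, t. split; [lra|]. split; [|repeat split; tauto].
      pose proof (box_trans _ _ _ _ _ Hbox (box_sym _ _ _ Hbw)) as (B1 & B2).
      unfold w0, midpoint in B1, B2. unfold Csub, Cscale, Cadd in B1, B2. fold e in B1, B2. cbn [fst snd] in B1, B2.
      assert (F1 : fst (c 1%nat) = fst (c 0%nat) + fst e) by (unfold e, edge_vec, Csub; simpl; ring).
      assert (F2 : snd (c 1%nat) = snd (c 0%nat) + snd e) by (unfold e, edge_vec, Csub; simpl; ring).
      replace (fst (c 1%nat) - t / PI * fst e - 1 / 2 * (fst (c 0%nat) + fst (c 1%nat))) with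
         (- (fst e * ((t - PI / 2) / PI))) in B1 by (rewrite F1; field; lra).
      replace (snd (c 1%nat) - t / PI * snd e - 1 / 2 * (snd (c 0%nat) + snd (c 1%nat))) with
         (- (snd e * ((t - PI / 2) / PI))) in B2 by (rewrite F2; field; lra).
      rewrite Rabs_Ropp, Rabs_mult in B1, B2.
      assert (B3 : M * Rabs ((t - PI / 2) / PI) < 2 * (M * s / (8 * PI))).
      { apply Rlt_le_trans with (eta + eta); [|lra]. clearbody eta. unfold M, Rmax. destruct (Rle_dec (Rabs (fst e)) (Rabs (snd e))); lra. }
      unfold Rdiv at 1 in B3. rewrite Rabs_mult, (Rabs_right (/ PI)) in B3.
      2:{ apply Rle_ge. left. apply Rinv_0_lt_compat. lra. }
      apply Rmult_lt_reg_l with (M / PI); [apply Rdiv_lt_0_compat; lra|].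
      replace (M / PI * Rabs (t - PI / 2)) with (M * (Rabs (t - PI / 2) * / PI)) by (unfold Rdiv; ring).
      eapply Rlt_le_trans; [exact B3|].
      replace (2 * (M * s / (8 * PI))) with (M / PI * s * / 4) by (field; lra).
      assert (0 < M / PI * s) by (apply Rmult_lt_0_compat; [apply Rdiv_lt_0_compat|]; lra). lra. }
  { intros X Y HY E. exfalso.
    destruct (image_open p c x w0 HJ) as (d & Hd & Hi); [now exists X, Y|].
    destruct (Hout d Hd) as (w & Hw & Hni). auto. }
  exists (Rmin d1 d3). split; [now apply Rmin_glb_lt|]. intros w Hw Hside. split.
  - apply Himg; [|assumption]. eapply box_mono; [apply Rmin_l|exact Hw].
  - intros X Y X' Y' HY HY' E E'.
    assert (Hw3 : box w0 d3 w) by (eapply box_mono; [apply Rmin_r|exact Hw]).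
    destruct (HZ X Y HY) as (r & t & Hr & Ht & Ht' & -> & ->); [now rewrite E|].
    destruct (HZ X' Y' HY') as (r' & t' & Hr' & Ht2 & Ht2' & -> & ->); [now rewrite E'|].
    rewrite Hpol in E by lra. rewrite Hpol in E' by lra.
    destruct (Hinj r t r' t') as (-> & ->).
    + rewrite Rabs_right; lra.
    + assumption.
    + rewrite Rabs_right; lra.
    + assumption.
    + now rewrite E, E'.
    + split; reflexivity.
Qed.

(** * The two sides of a Jordan polygon *)

Definition edge_pt (n : nat) (c : nat -> Cpt) (k : nat) (s : R) : Cpt :=
  Cadd (c k) (Cscale s (Csub (c (next n k)) (c k))).

Definition edge_side (n : nat) (c : nat -> Cpt) (k : nat) (w : Cpt) : R := side (c k) (c (next n k)) w.

(** One-sided neighbourhoods of an edge point, here on the left; these are what gets carried along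
    the edges and around the vertices. *)
Definition germ (n : nat) (c : nat -> Cpt) (k : nat) (s : R) (P : Cpt -> Prop) : Prop :=
  exists d, 0 < d /\ forall w, box (edge_pt n c k s) d w -> 0 < edge_side n c k w -> P w.

Definition germ_right (n : nat) (c : nat -> Cpt) (k : nat) (s : R) (P : Cpt -> Prop) : Prop :=
  exists d, 0 < d /\ forall w, box (edge_pt n c k s) d w -> edge_side n c k w < 0 -> P w.

Lemma next_cases n k : (k < n)%nat -> (S k < n /\ next n k = S k)%nat \/ (S k = n /\ next n k = 0)%nat.
Proof.
  intros Hk. destruct (Nat.eq_dec (S k) n) as [<-|Hne].
  - right. split; [reflexivity|]. apply next_last.
  - left. split; [lia|]. apply next_lt. lia.
Qed.

Lemma segment_joined n c a b :
  (forall s, 0 <= s <= 1 -> ~ on_polygon n c (Cadd a (Cscale s (Csub b a)))) -> joined_off_polygon n c a b.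
Proof.
  intros H. exists (fun s => Cadd a (Cscale s (Csub b a))).
  unfold Cadd, Cscale, Csub in *. cbn [fst snd] in *.
  split; [reg|]. split; [reg|]. split; [|split].
  - apply Cpt_eq; simpl; ring.
  - apply Cpt_eq; simpl; ring.
  - exact H.
Qed.

Lemma box_convex q d z w s : box q d z -> box q d w -> 0 <= s <= 1 -> box q d (Cadd z (Cscale s (Csub w z))).
Proof.
  assert (A : forall a b t, Rabs (a - t) < d -> Rabs (b - t) < d -> 0 <= s <= 1 -> Rabs (a + s * (b - a) - t) < d).
  { intros a b t H1 H2 Hs. apply Rabs_def2 in H1. apply Rabs_def2 in H2.
    assert (B : forall u v, 0 < u -> 0 < v -> 0 < (1 - s) * u + s * v).
    { intros u v Hu Hv. destruct (Rle_dec s (1 / 2)); nra. }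
    pose proof (B (d - (a - t)) (d - (b - t)) ltac:(lra) ltac:(lra)).
    pose proof (B (a - t + d) (b - t + d) ltac:(lra) ltac:(lra)).
    apply Rabs_def1; lra. }
  intros (H1 & H2) (H3 & H4) Hs. unfold Cadd, Cscale, Csub. split; cbn [fst snd]; auto.
Qed.

Lemma side_convex a b z w s :
  side a b (Cadd z (Cscale s (Csub w z))) = (1 - s) * side a b z + s * side a b w.
Proof. unfold side, cross, Cadd, Cscale, Csub. cbn [fst snd]. ring. Qed.

Lemma edge_length_pos n c k : (2 <= n)%nat -> distinct_vertices n c -> (k < n)%nat ->
  let e := Csub (c (next n k)) (c k) in 0 < fst e * fst e + snd e * snd e.
Proof.
  intros Hn HD Hk e.
  assert (Hne : c (next n k) <> c k).
  { intros E. apply (HD (next n k) k); auto; destruct (next_cases n k Hk); lia. }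
  pose proof (mul_self_ge0 (fst e)) as P1. pose proof (mul_self_ge0 (snd e)) as P2.
  destruct (Req_dec (fst e * fst e + snd e * snd e) 0) as [Z|Z]; [|lra].
  exfalso. apply Hne. assert (fst e = 0 /\ snd e = 0) as (Z1 & Z2) by (split; nra).
  unfold e, Csub in Z1, Z2. cbn [fst snd] in *. apply Cpt_eq; lra.
Qed.

Lemma edge_pt_only n c k s : jordan_polygon n c -> distinct_vertices n c -> (k < n)%nat -> 0 < s < 1 ->
  forall j, (j < n)%nat -> j <> k -> ~ on_seg (c j) (c (next n j)) (edge_pt n c k s).
Proof.
  intros HJ HD Hk Hs j Hj Hjk Hon.
  assert (Hself : on_seg (c k) (c (next n k)) (edge_pt n c k s)) by (exists s; split; [lra|reflexivity]).
  assert (Hnk : (next n k < n)%nat) by (destruct (next_cases n k Hk); lia).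
  assert (Hne : c (next n k) <> c k).
  { intros E. destruct (next_cases n k Hk) as [(L & E2)|(L & E2)].
    - apply (HD (next n k) k); auto; lia.
    - destruct (Nat.eq_dec k 0) as [->|K0]; [lia|]. apply (HD (next n k) k); auto; lia. }
  assert (Hend : edge_pt n c k s <> c (next n k) /\ edge_pt n c k s <> c k).
  { unfold edge_pt, Cadd, Cscale, Csub. split; intros E; apply Hne;
      pose proof (f_equal fst E) as E1; pose proof (f_equal snd E) as E2; cbn [fst snd] in E1, E2; apply Cpt_eq; nra. }
  destruct (HJ k j _ Hk Hj (not_eq_sym Hjk) Hself Hon) as [(-> & E)|(E1 & E)]; tauto.
Qed.

(** The other edges keep a distance, and a point of the line close to an interior point of the edge
    has its parameter in [0, 1]; [d2] is chosen for the latter. *)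
Lemma edge_neighbourhood n c k s : (2 <= n)%nat -> jordan_polygon n c -> distinct_vertices n c -> (k < n)%nat -> 0 < s < 1 ->
  exists d, 0 < d /\ forall w, box (edge_pt n c k s) d w -> (on_polygon n c w <-> edge_side n c k w = 0).
Proof.
  intros Hn HJ HD Hk Hs.
  destruct (finite_separate (fun j z => j <> k -> ~ on_seg (c j) (c (next n j)) z) (edge_pt n c k s) n) as (d & Hd & H).
  { intros j Hj. destruct (Nat.eq_dec j k) as [->|Hjk].
    - exists 1. split; [lra|]. intros z _ Hc. congruence.
    - destruct (seg_separate _ _ _ (edge_pt_only n c k s HJ HD Hk Hs j Hj Hjk)) as (d & Hd & H).
      exists d. split; [assumption|]. intros; now apply H. }
  set (e := Csub (c (next n k)) (c k)) in *.
  set (E := fst e * fst e + snd e * snd e).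
  assert (HE : 0 < E) by (apply edge_length_pos; assumption).
  set (M := Rabs (fst e) + Rabs (snd e) + 1).
  assert (HM : 0 < M) by (unfold M; pose proof (Rabs_pos (fst e)); pose proof (Rabs_pos (snd e)); lra).
  set (d2 := Rmin s (1 - s) * E / M).
  assert (Hmin : 0 < Rmin s (1 - s)) by (apply Rmin_glb_lt; lra).
  assert (Hd2 : 0 < d2) by (apply Rdiv_lt_0_compat; [now apply Rmult_lt_0_compat|lra]).
  exists (Rmin d d2). split; [now apply Rmin_glb_lt|].
  pose proof (Rmin_l d d2). pose proof (Rmin_r d d2).
  intros w Hw. split.
  - intros (j & Hj & Hon). destruct (Nat.eq_dec j k) as [->|Hjk].
    + destruct Hon as (t & _ & ->). unfold edge_side, side, cross, Cadd, Cscale, Csub. cbn [fst snd]. ring.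
    + exfalso. apply (H j w Hj); try assumption. eapply box_mono; [|exact Hw]. lra.
  - intros Hside. exists k. split; [assumption|].
    set (u := fst w - fst (edge_pt n c k s)). set (v := snd w - snd (edge_pt n c k s)).
    set (t := (u * fst e + v * snd e) / E).
    assert (HMd : M * d2 = Rmin s (1 - s) * E) by (unfold d2; field; lra).
    destruct Hw as (W1 & W2). fold u in W1. fold v in W2.
    assert (Ht : Rabs (t * E) < Rmin s (1 - s) * E).
    { unfold t. replace ((u * fst e + v * snd e) / E * E) with (u * fst e + v * snd e) by (field; lra).
      rewrite <- HMd. eapply Rle_lt_trans; [apply Rabs_triang|]. rewrite !Rabs_mult.
      assert (Rabs u * Rabs (fst e) <= d2 * Rabs (fst e)) by (apply Rmult_le_compat_r; [apply Rabs_pos|lra]).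
      assert (Rabs v * Rabs (snd e) <= d2 * Rabs (snd e)) by (apply Rmult_le_compat_r; [apply Rabs_pos|lra]).
      unfold M. lra. }
    rewrite Rabs_mult, (Rabs_right E) in Ht by lra. apply Rmult_lt_reg_r in Ht; [|lra].
    pose proof (Rmin_l s (1 - s)). pose proof (Rmin_r s (1 - s)). apply Rabs_def2 in Ht.
    assert (Hpar : fst e * v - snd e * u = 0).
    { rewrite <- Hside. unfold edge_side, side, cross, u, v, edge_pt, Cadd, Cscale. fold e.
      unfold Csub. cbn [fst snd]. unfold e, Csub; cbn [fst snd]. ring. }
    exists (s + t). split; [lra|].
    assert (X1 : t * fst e = u).
    { apply Rmult_eq_reg_r with E; [|lra]. unfold t. replace ((u * fst e + v * snd e) / E * fst e * E) with ((u * fst e + v * snd e) * fst e) by (field; lra).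
      unfold E. replace ((u * fst e + v * snd e) * fst e) with (u * (fst e * fst e + snd e * snd e) + snd e * (fst e * v - snd e * u)) by ring. rewrite Hpar. ring. }
    assert (X2 : t * snd e = v).
    { apply Rmult_eq_reg_r with E; [|lra]. unfold t. replace ((u * fst e + v * snd e) / E * snd e * E) with ((u * fst e + v * snd e) * snd e) by (field; lra).
      unfold E. replace ((u * fst e + v * snd e) * snd e) with (v * (fst e * fst e + snd e * snd e) - fst e * (fst e * v - snd e * u)) by ring. rewrite Hpar. ring. }
    fold e. apply Cpt_eq; unfold Cadd, Cscale; cbn [fst snd].
    + rewrite Rmult_plus_distr_r, X1. unfold u, edge_pt, Cadd, Cscale. fold e. cbn [fst snd]. ring.
    + rewrite Rmult_plus_distr_r, X2. unfold v, edge_pt, Cadd, Cscale. fold e. cbn [fst snd]. ring.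
Qed.

(** The left half of a small box is convex and misses the polygon, so its points are joined by
    segments. *)
Lemma half_ball_const n c k s P : (2 <= n)%nat -> jordan_polygon n c -> distinct_vertices n c -> (k < n)%nat -> 0 < s < 1 ->
  off_clopen n c P ->
  exists d, 0 < d /\ forall z w, box (edge_pt n c k s) d z -> box (edge_pt n c k s) d w ->
    0 < edge_side n c k z -> 0 < edge_side n c k w -> P z -> P w.
Proof.
  intros Hn HJ HD Hk Hs HP. destruct (edge_neighbourhood n c k s Hn HJ HD Hk Hs) as (d & Hd & H).
  exists d. split; [assumption|]. intros z w Hz Hw Sz Sw. apply (joined_off_clopen n c P z w HP).
  apply segment_joined. intros t Ht Hon. apply (H _ (box_convex _ _ _ _ t Hz Hw Ht)) in Hon.
  unfold edge_side in *. rewrite side_convex in Hon. nra.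
Qed.

Lemma half_ball_nonempty n c k s d : distinct_vertices n c -> (k < n)%nat -> (2 <= n)%nat -> 0 < d ->
  exists w, box (edge_pt n c k s) d w /\ 0 < edge_side n c k w.
Proof.
  intros HD Hk Hn Hd.
  set (e := Csub (c (next n k)) (c k)) in *.
  set (E := fst e * fst e + snd e * snd e).
  assert (HE : 0 < E) by (apply edge_length_pos; assumption).
  set (M := Rabs (fst e) + Rabs (snd e) + 1).
  assert (HM : 0 < M) by (unfold M; pose proof (Rabs_pos (fst e)); pose proof (Rabs_pos (snd e)); lra).
  set (t := d / M). assert (Ht : 0 < t) by now apply Rdiv_lt_0_compat.
  assert (HtM : t * M = d) by (unfold t; field; lra).
  exists (Cadd (edge_pt n c k s) (Cscale t (Crot e))). split.
  - unfold box, Cadd, Cscale, Crot. cbn [fst snd].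
    pose proof (Rabs_pos (fst e)). pose proof (Rabs_pos (snd e)). unfold M in HtM.
    assert (0 <= t * Rabs (fst e)) by (apply Rmult_le_pos; lra).
    assert (0 <= t * Rabs (snd e)) by (apply Rmult_le_pos; lra).
    split.
    + match goal with |- Rabs ?a < _ => replace a with (- (t * snd e)) by ring end.
      rewrite Rabs_Ropp, Rabs_mult, (Rabs_right t) by lra. lra.
    + match goal with |- Rabs ?a < _ => replace a with (t * fst e) by ring end.
      rewrite Rabs_mult, (Rabs_right t) by lra. lra.
  - replace (edge_side n c k (Cadd (edge_pt n c k s) (Cscale t (Crot e)))) with (t * E); [nra|].
    unfold edge_side, side, cross, edge_pt, Crot, E, Cadd, Cscale, e, Csub. cbn [fst snd]. ring.
Qed.

Lemma edge_pt_near n c k s d : 0 < d -> exists r, 0 < r /\ forall s', Rabs (s' - s) < r ->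
  box (edge_pt n c k s) d (edge_pt n c k s').
Proof.
  intros Hd. set (e := Csub (c (next n k)) (c k)).
  set (M := Rabs (fst e) + Rabs (snd e) + 1).
  assert (HM : 0 < M) by (unfold M; pose proof (Rabs_pos (fst e)); pose proof (Rabs_pos (snd e)); lra).
  exists (d / M). split; [now apply Rdiv_lt_0_compat|]. intros s' Hs.
  apply Rlt_div_r in Hs; [|lra]. unfold M in Hs.
  pose proof (Rabs_pos (fst e)). pose proof (Rabs_pos (snd e)). pose proof (Rabs_pos (s' - s)).
  assert (0 <= Rabs (s' - s) * Rabs (fst e)) by (apply Rmult_le_pos; lra).
  assert (0 <= Rabs (s' - s) * Rabs (snd e)) by (apply Rmult_le_pos; lra).
  destruct (Req_dec (s' - s) 0) as [Z|Z].
  { replace s' with s by lra. now apply box_center. }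
  apply Rabs_pos_lt in Z.
  unfold box, edge_pt, Cadd, Cscale. fold e. cbn [fst snd]. split.
  - match goal with |- Rabs ?a < _ => replace a with ((s' - s) * fst e) by ring end. rewrite Rabs_mult. lra.
  - match goal with |- Rabs ?a < _ => replace a with ((s' - s) * snd e) by ring end. rewrite Rabs_mult. lra.
Qed.

(** By constancy on the half box it suffices that points of P accumulate at the edge point from the
    left. *)
Lemma germ_of_point n c k s P : (2 <= n)%nat -> jordan_polygon n c -> distinct_vertices n c -> (k < n)%nat -> 0 < s < 1 ->
  off_clopen n c P ->
  (forall d, 0 < d -> exists w, box (edge_pt n c k s) d w /\ 0 < edge_side n c k w /\ P w) -> germ n c k s P.
Proof.
  intros Hn HJ HD Hk Hs HP H. destruct (half_ball_const n c k s P Hn HJ HD Hk Hs HP) as (d & Hd & Hc).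
  destruct (H d Hd) as (z & Z1 & Z2 & Z3). exists d. split; [assumption|].
  intros w W1 W2. exact (Hc z w Z1 W1 Z2 W2 Z3).
Qed.

Lemma germ_point n c k s P d : distinct_vertices n c -> (k < n)%nat -> (2 <= n)%nat -> 0 < d -> germ n c k s P ->
  exists w, box (edge_pt n c k s) d w /\ 0 < edge_side n c k w /\ P w.
Proof.
  intros HD Hk Hn Hd (d1 & Hd1 & H).
  destruct (half_ball_nonempty n c k s (Rmin d d1) HD Hk Hn) as (w & W1 & W2); [now apply Rmin_glb_lt|].
  exists w. split; [|split; [assumption|]].
  - eapply box_mono; [apply Rmin_l|exact W1].
  - apply H; [|assumption]. eapply box_mono; [apply Rmin_r|exact W1].
Qed.

Lemma germ_along_edge n c k P s1 s2 : (2 <= n)%nat -> jordan_polygon n c -> distinct_vertices n c -> (k < n)%nat ->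
  off_clopen n c P -> 0 < s1 < 1 -> 0 < s2 < 1 -> germ n c k s1 P -> germ n c k s2 P.
Proof.
  intros Hn HJ HD Hk HP H1 H2.
  (* Connectedness carries a germ towards larger parameters; a step backwards is obtained by
     contradiction from a step forwards for the complement of P. *)
  assert (L : forall a b Q, off_clopen n c Q -> 0 < a -> a <= b -> b < 1 -> germ n c k a Q -> germ n c k b Q).
  { clear P HP s1 s2 H1 H2. intros a b P HP Ha Hab Hb.
    apply (interval_connected (fun s => germ n c k s P) a b Hab).
    intros s Hs. destruct (half_ball_const n c k s P Hn HJ HD Hk ltac:(lra) HP) as (d & Hd & Hc).
    destruct (edge_pt_near n c k s (d / 2) ltac:(lra)) as (r & Hr & Hnear).
    exists r. split; [assumption|]. intros s' Hs' Hss. specialize (Hnear s' Hss).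
    assert (Hsub : forall w, box (edge_pt n c k s') (d / 2) w -> box (edge_pt n c k s) d w).
    { intros w Hw. replace d with (d / 2 + d / 2) by field. eapply box_trans; eassumption. }
    split; intros Hg.
    - apply germ_of_point; try assumption; [lra|]. intros d' Hd'.
      destruct (germ_point n c k s' P (d / 2) HD Hk Hn ltac:(lra) Hg) as (z & Z1 & Z2 & Z3).
      destruct (half_ball_nonempty n c k s (Rmin d d') HD Hk Hn) as (w & W1 & W2); [now apply Rmin_glb_lt|].
      exists w. split; [eapply box_mono; [apply Rmin_r|exact W1]|]. split; [assumption|].
      apply (Hc z w); auto. eapply box_mono; [apply Rmin_l|exact W1].
    - apply germ_of_point; try assumption; [lra|]. intros d' Hd'.
      destruct (germ_point n c k s P d HD Hk Hn ltac:(lra) Hg) as (z & Z1 & Z2 & Z3).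
      destruct (half_ball_nonempty n c k s' (Rmin (d / 2) d') HD Hk Hn) as (w & W1 & W2); [apply Rmin_glb_lt; lra|].
      exists w. split; [eapply box_mono; [apply Rmin_r|exact W1]|]. split; [assumption|].
      apply (Hc z w); auto. apply Hsub. eapply box_mono; [apply Rmin_l|exact W1]. }
  intros Hg. destruct (Rle_dec s1 s2) as [Hle|Hle]; [apply (L s1 s2); auto; lra|].
  apply NNPP. intros Hn2.
  assert (HP' : off_clopen n c (fun w => ~ P w)).
  { intros w Hw. destruct (HP w Hw) as (d & Hd & Hc). exists d. split; [assumption|]. intros z Hz.
    specialize (Hc z Hz). tauto. }
  assert (Hg2 : germ n c k s2 (fun w => ~ P w)).
  { apply germ_of_point; try assumption. intros d Hd. apply NNPP. intros Hno. apply Hn2.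
    exists d. split; [assumption|]. intros w W1 W2. apply NNPP. intros W3. apply Hno. now exists w. }
  apply (L s2 s1) in Hg2; try assumption; try lra.
  destruct Hg as (d1 & Hd1 & G1). destruct Hg2 as (d2 & Hd2 & G2).
  destruct (half_ball_nonempty n c k s1 (Rmin d1 d2) HD Hk Hn) as (w & W1 & W2); [now apply Rmin_glb_lt|].
  apply (G2 w); [eapply box_mono; [apply Rmin_r|exact W1]|assumption|].
  apply G1; [eapply box_mono; [apply Rmin_l|exact W1]|assumption].
Qed.

(** * Passing around a vertex *)

Definition circ (V : Cpt) (r f : R) : Cpt := Cadd V (r * cos f, r * sin f).

Lemma polar_coordinates_from u v a : 0 <= a < 2 * PI -> (u <> 0 \/ v <> 0) ->
  exists r f, 0 < r /\ r <= Rabs u + Rabs v /\ a <= f < a + 2 * PI /\ u = r * cos f /\ v = r * sin f.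
Proof.
  intros Ha Huv. pose proof PI_RGT_0.
  assert (H0 : exists r f, 0 < r /\ r <= Rabs u + Rabs v /\ 0 <= f < 2 * PI /\ u = r * cos f /\ v = r * sin f).
  { destruct (Rtotal_order v 0) as [Hv|[Hv|Hv]].
    - destruct (polar_coordinates (- u) (- v) ltac:(lra)) as (r & f & Hr & Hb & Hf & E1 & E2 & _).
      exists r, (f + PI). rewrite neg_cos, neg_sin. rewrite Rabs_Ropp in Hb. rewrite (Rabs_left v) by lra.
      repeat split; lra.
    - destruct Huv as [Hu|Hu]; [|lra]. subst v. rewrite Rabs_R0.
      destruct (Rle_dec 0 u).
      + exists u, 0. rewrite cos_0, sin_0, Rabs_right by lra. repeat split; lra.
      + exists (- u), PI. rewrite cos_PI, sin_PI, Rabs_left by lra. repeat split; lra.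
    - destruct (polar_coordinates u v Hv) as (r & f & Hr & Hb & Hf & E1 & E2 & _).
      exists r, f. rewrite (Rabs_right v) by lra. repeat split; lra. }
  destruct H0 as (r & f & Hr & Hb & Hf & E1 & E2).
  destruct (Rle_dec a f).
  - exists r, f. repeat split; try assumption; lra.
  - exists r, (f + 2 * PI).
    replace (cos (f + 2 * PI)) with (cos f) by (symmetry; pose proof (cos_period f 1) as E; simpl in E; rewrite <- E; f_equal; ring).
    replace (sin (f + 2 * PI)) with (sin f) by (symmetry; pose proof (sin_period f 1) as E; simpl in E; rewrite <- E; f_equal; ring).
    repeat split; try assumption; lra.
Qed.

Lemma circ_joined n c V r a b f1 f2 : a < f1 < b -> a < f2 < b ->
  (forall f, a < f < b -> ~ on_polygon n c (circ V r f)) ->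
  joined_off_polygon n c (circ V r f1) (circ V r f2).
Proof.
  intros H1 H2 Hoff. exists (fun s => circ V r (f1 + s * (f2 - f1))).
  split; [|split; [|split; [|split]]].
  - unfold circ, Cadd. cbn [fst snd]. reg.
  - unfold circ, Cadd. cbn [fst snd]. reg.
  - f_equal. ring.
  - f_equal. ring.
  - intros s Hs. apply Hoff. destruct (Rle_dec f1 f2); split; nra.
Qed.

Lemma circ_near V r f d : 0 < d -> exists t0, 0 < t0 /\ forall t, Rabs t < t0 -> box (circ V r f) d (circ V r (f + t)).
Proof.
  intros Hd.
  assert (C1 : continuity_pt (fun t => r * cos (f + t)) 0) by reg.
  assert (C2 : continuity_pt (fun t => r * sin (f + t)) 0) by reg.
  destruct (C1 d Hd) as (t1 & Ht1 & H1). destruct (C2 d Hd) as (t2 & Ht2 & H2).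
  simpl in H1, H2. unfold Rdist, D_x, no_cond in H1, H2.
  exists (Rmin t1 t2). split; [now apply Rmin_glb_lt|]. intros t Ht.
  pose proof (Rmin_l t1 t2). pose proof (Rmin_r t1 t2).
  destruct (Req_dec t 0) as [->|Hne].
  { rewrite Rplus_0_r. now apply box_center. }
  specialize (H1 t). specialize (H2 t). rewrite Rminus_0_r, Rplus_0_r in H1, H2.
  unfold box, circ, Cadd. cbn [fst snd]. split.
  - replace (fst V + r * cos (f + t) - (fst V + r * cos f)) with (r * cos (f + t) - r * cos f) by ring.
    apply H1. repeat split; auto; lra.
  - replace (snd V + r * sin (f + t) - (snd V + r * sin f)) with (r * sin (f + t) - r * sin f) by ring.
    apply H2. repeat split; auto; lra.
Qed.

Lemma same_direction d : - (2 * PI) < d < 2 * PI -> sin d = 0 -> 0 < cos d -> d = 0.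
Proof.
  intros Hd Hs Hc. pose proof PI_RGT_0.
  destruct (sin_eq_0_0 d Hs) as (k & ->).
  assert (Hk : (-2 < k < 2)%Z) by (split; apply lt_IZR; nra).
  assert (k = -1 \/ k = 0 \/ k = 1)%Z as [ -> | [ -> | -> ] ] by lia.
  - exfalso. replace (-1 * PI) with (- PI) in Hc by ring. rewrite cos_neg, cos_PI in Hc. lra.
  - ring.
  - exfalso. rewrite Rmult_1_l, cos_PI in Hc. lra.
Qed.

Lemma on_ray r f q a : 0 < r -> 0 <= q -> - (2 * PI) < f - a < 2 * PI ->
  r * cos f = q * cos a -> r * sin f = q * sin a -> f = a.
Proof.
  intros Hr Hq Hfa E1 E2.
  assert (f - a = 0); [|lra].
  apply same_direction; [assumption| |].
  - rewrite sin_minus. apply Rmult_eq_reg_l with r; [|lra].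
    replace (r * (sin f * cos a - cos f * sin a)) with (r * sin f * cos a - r * cos f * sin a) by ring.
    rewrite E1, E2. ring.
  - rewrite cos_minus. pose proof (sin2_cos2 a) as SC. unfold Rsqr in SC.
    pose proof (sin2_cos2 f) as SF. unfold Rsqr in SF.
    assert (E : r * (cos f * cos a + sin f * sin a) = q).
    { replace (r * (cos f * cos a + sin f * sin a)) with (r * cos f * cos a + r * sin f * sin a) by ring.
      rewrite E1, E2. replace (q * cos a * cos a + q * sin a * sin a) with (q * (sin a * sin a + cos a * cos a)) by ring. rewrite SC. ring. }
    assert (Eq : q * q = r * r).
    { replace (q * q) with (q * q * (sin a * sin a + cos a * cos a)) by (rewrite SC; ring).
      replace (r * r) with (r * r * (sin f * sin f + cos f * cos f)) by (rewrite SF; ring).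
      replace (q * q * (sin a * sin a + cos a * cos a)) with ((q * sin a) * (q * sin a) + (q * cos a) * (q * cos a)) by ring.
      rewrite <- E1, <- E2. ring. }
    assert (0 < q) by nra. nra.
Qed.

(** Near V only its two edges are met; they leave V along the rays of angle a (outgoing) and b (back
    along the incoming edge). Taking b in (a, a + 2 PI) makes the sector from a to b the left side
    of both edges. *)
Lemma vertex_neighbourhood n c k : (3 <= n)%nat -> jordan_polygon n c -> distinct_vertices n c -> (k < n)%nat ->
  let V := c (next n k) in
  exists a b A B r0, 0 < A /\ 0 < B /\ 0 < r0 /\ r0 <= A /\ r0 <= B /\ a < b < a + 2 * PI /\ 0 <= a < 2 * PI /\
    Csub (c (next n (next n k))) V = (A * cos a, A * sin a) /\
    Csub (c k) V = (B * cos b, B * sin b) /\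
    forall r f, 0 < r < r0 -> a <= f < a + 2 * PI -> (on_polygon n c (circ V r f) <-> f = a \/ f = b).
Proof.
  intros Hn HJ HD Hk V. pose proof PI_RGT_0.
  assert (Hk' : (next n k < n)%nat) by (destruct (next_cases n k Hk); lia).
  assert (Hkk : next n k <> k) by (destruct (next_cases n k Hk); lia).
  pose proof (edge_length_pos n c k ltac:(lia) HD Hk) as L1.
  pose proof (edge_length_pos n c (next n k) ltac:(lia) HD Hk') as L2.
  fold V in L1, L2. cbv zeta in L1, L2.
  set (e := Csub (c (next n (next n k))) V) in *.
  destruct (polar_coordinates_from (fst e) (snd e) 0 ltac:(lra)) as (A & a & HA & _ & Ha & EA1 & EA2).
  { destruct (Req_dec (fst e) 0) as [Z|Z]; [right|now left]. intros Z2. rewrite Z, Z2 in L2. lra. }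
  set (e' := Csub (c k) V).
  destruct (polar_coordinates_from (fst e') (snd e') a ltac:(lra)) as (B & b & HB & _ & Hb & EB1 & EB2).
  { destruct (Req_dec (fst e') 0) as [Z|Z]; [right|now left]. intros Z2.
    unfold e', Csub in Z, Z2. unfold Csub in L1. cbn [fst snd] in *. nra. }
  assert (HVoff : forall j, (j < n)%nat -> j <> k -> j <> next n k -> ~ on_seg (c j) (c (next n j)) V).
  { intros j Hj J1 J2 Hon.
    assert (HV : on_seg (c (next n k)) (c (next n (next n k))) V).
    { exists 0. split; [lra|]. unfold V, Cadd, Cscale. apply Cpt_eq; cbn [fst snd]; ring. }
    destruct (HJ j (next n k) V Hj Hk' J2 Hon HV) as [(E & _)|(E & E2)].
    - destruct (next_cases n k Hk); destruct (next_cases n j Hj); lia.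
    - apply (HD j (next n k)); auto. }
  destruct (finite_separate (fun j z => j <> k -> j <> next n k -> ~ on_seg (c j) (c (next n j)) z) V n) as (d & Hd & Hsep).
  { intros j Hj. destruct (Nat.eq_dec j k) as [->|J1]; [|destruct (Nat.eq_dec j (next n k)) as [->|J2]].
    - exists 1. split; [lra|]. intros z _ Hc. congruence.
    - exists 1. split; [lra|]. intros z _ _ Hc. congruence.
    - destruct (seg_separate _ _ _ (HVoff j Hj J1 J2)) as (d & Hd & H1).
      exists d. split; [assumption|]. intros; now apply H1. }
  set (r0 := Rmin d (Rmin A B)).
  assert (R0 : 0 < r0 /\ r0 <= d /\ r0 <= A /\ r0 <= B).
  { unfold r0. pose proof (Rmin_l d (Rmin A B)). pose proof (Rmin_r d (Rmin A B)).
    pose proof (Rmin_l A B). pose proof (Rmin_r A B). repeat split; try lra. repeat apply Rmin_glb_lt; lra. }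
  destruct R0 as (R0 & Rd & RA & RB).
  assert (OnA : forall r, 0 <= r <= A -> on_seg (c (next n k)) (c (next n (next n k))) (circ V r a)).
  { intros r Hr. exists (r / A). split.
    - split; [apply Rdiv_le_0_compat; lra|]. apply Rle_div_l; lra.
    - fold V. fold e. unfold circ, Cadd, Cscale. cbn [fst snd]. rewrite EA1, EA2. f_equal; field; lra. }
  assert (OnB : forall r, 0 <= r <= B -> on_seg (c k) (c (next n k)) (circ V r b)).
  { intros r Hr. exists (1 - r / B). split.
    - assert (0 <= r / B <= 1); [|lra]. split; [apply Rdiv_le_0_compat; lra|]. apply Rle_div_l; lra.
    - fold V. replace (circ V r b) with (Cadd V (Cscale (r / B) e')).
      + unfold e', Cadd, Cscale, Csub. cbn [fst snd]. f_equal; ring.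
      + unfold circ, Cadd, Cscale. cbn [fst snd]. rewrite EB1, EB2. f_equal; field; lra. }
  (* Equal directions would make the two edges overlap beyond their common endpoint. *)
  assert (Hab : a <> b).
  { intros <-.
    pose proof (OnA (r0 / 2) ltac:(lra)) as O1. pose proof (OnB (r0 / 2) ltac:(lra)) as O2.
    pose proof (sin2_cos2 a) as SC. unfold Rsqr in SC.
    destruct (HJ k (next n k) _ Hk Hk' (not_eq_sym Hkk) O2 O1) as [(_ & E)|(_ & E)].
    - fold V in E. unfold circ, Cadd in E. pose proof (f_equal fst E) as F1. pose proof (f_equal snd E) as F2.
      cbn [fst snd] in F1, F2.
      assert (r0 / 2 * cos a = 0) by lra. assert (r0 / 2 * sin a = 0) by lra. nra.
    - assert (Ec : c k = Cadd V e').
      { unfold e', Cadd, Csub. apply Cpt_eq; cbn [fst snd]; ring. }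
      rewrite Ec in E. unfold circ, Cadd in E. pose proof (f_equal fst E) as F1. pose proof (f_equal snd E) as F2.
      cbn [fst snd] in F1, F2. rewrite EB1 in F1. rewrite EB2 in F2.
      assert ((B - r0 / 2) * cos a = 0) by lra. assert ((B - r0 / 2) * sin a = 0) by lra.
      assert (Z1 : cos a = 0) by (apply (Rmult_eq_reg_l (B - r0 / 2)); lra).
      assert (Z2 : sin a = 0) by (apply (Rmult_eq_reg_l (B - r0 / 2)); lra).
      rewrite Z1, Z2 in SC. lra. }
  exists a, b, A, B, r0. repeat split; try assumption; try lra.
  - apply Cpt_eq; assumption.
  - apply Cpt_eq; assumption.
  - intros (j & Hj & Hon).
    destruct (Nat.eq_dec j k) as [->|J1]; [|destruct (Nat.eq_dec j (next n k)) as [->|J2]].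
    + right. destruct Hon as (s & Hs & E). fold V in E.
      apply (on_ray r f ((1 - s) * B)); try lra; [nra| |].
      * pose proof (f_equal fst E) as F. unfold circ, Cadd, Cscale, Csub in F. cbn [fst snd] in F.
        rewrite Rmult_assoc, <- EB1. unfold e', Csub. cbn [fst snd]. lra.
      * pose proof (f_equal snd E) as F. unfold circ, Cadd, Cscale, Csub in F. cbn [fst snd] in F.
        rewrite Rmult_assoc, <- EB2. unfold e', Csub. cbn [fst snd]. lra.
    + left. destruct Hon as (s & Hs & E). fold V in E. fold e in E.
      apply (on_ray r f (s * A)); try lra; [nra| |].
      * pose proof (f_equal fst E) as F. unfold circ, Cadd, Cscale in F. cbn [fst snd] in F.
        rewrite Rmult_assoc, <- EA1. lra.
      * pose proof (f_equal snd E) as F. unfold circ, Cadd, Cscale in F. cbn [fst snd] in F.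
        rewrite Rmult_assoc, <- EA2. lra.
    + exfalso. apply (Hsep j (circ V r f) Hj); try assumption.
      unfold box, circ, Cadd. cbn [fst snd]. pose proof (COS_bound f). pose proof (SIN_bound f).
      split.
      * replace (fst V + r * cos f - fst V) with (r * cos f) by ring. apply Rabs_def1; nra.
      * replace (snd V + r * sin f - snd V) with (r * sin f) by ring. apply Rabs_def1; nra.
  - intros [->| ->].
    + exists (next n k). split; [assumption|]. apply OnA. lra.
    + exists k. split; [assumption|]. apply OnB. lra.
Qed.

Lemma sector_side n c j V A a r t : c j = V -> Csub (c (next n j)) V = (A * cos a, A * sin a) ->
  edge_side n c j (circ V r (a + t)) = A * r * sin t.
Proof.
  intros <- E. unfold edge_side, side, cross. rewrite E. unfold circ, Cadd, Csub. cbn [fst snd].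
  rewrite cos_plus, sin_plus. pose proof (sin2_cos2 a) as SC. unfold Rsqr in SC.
  transitivity (A * r * sin t * (sin a * sin a + cos a * cos a)); [ring|rewrite SC; ring].
Qed.

Lemma edge_pt_circ n c j V A a r : c j = V -> Csub (c (next n j)) V = (A * cos a, A * sin a) -> 0 < A ->
  edge_pt n c j (r / A) = circ V r a.
Proof.
  intros <- E HA. unfold edge_pt. rewrite E. unfold circ, Cadd, Cscale. cbn [fst snd]. f_equal; field; lra.
Qed.

Lemma sin_small_pos t : 0 < t < 1 -> 0 < sin t.
Proof. intros Ht. pose proof PI2_3_2. apply sin_gt_0; lra. Qed.

(** Inside the left sector an arc around the vertex joins a point left of the incoming edge to a
    point left of the outgoing one, off the polygon. *)
Lemma germ_next n c k P : (3 <= n)%nat -> jordan_polygon n c -> distinct_vertices n c -> (k < n)%nat ->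
  off_clopen n c P -> (forall s, 0 < s < 1 -> germ n c k s P) -> forall s, 0 < s < 1 -> germ n c (next n k) s P.
Proof.
  intros Hn HJ HD Hk HP Hg.
  assert (Hk' : (next n k < n)%nat) by (destruct (next_cases n k Hk); lia).
  destruct (vertex_neighbourhood n c k Hn HJ HD Hk) as (a & b & A & B & r0 & HA & HB & Hr0 & HrA & HrB & Hab & Ha & EA & EB & Hon).
  set (V := c (next n k)) in *.
  set (r := r0 / 2).
  assert (Hr : 0 < r < r0) by (unfold r; lra).
  assert (Hoff : forall f, a < f < b -> ~ on_polygon n c (circ V r f)).
  { intros f Hf Hc. apply (Hon r f Hr ltac:(lra)) in Hc. lra. }
  assert (HrA1 : 0 < r / A < 1) by (split; [apply Rdiv_lt_0_compat; lra|apply Rlt_div_l; lra]).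
  assert (HrB1 : 0 < r / B < 1) by (split; [apply Rdiv_lt_0_compat; lra|apply Rlt_div_l; lra]).
  assert (G : germ n c (next n k) (r / A) P).
  { apply germ_of_point; try assumption; [lia|]. intros d Hd.
    destruct (circ_near V r a d Hd) as (t1 & Ht1 & N1).
    (* The incoming edge is traversed towards V, so its point at distance r from V has parameter 1 -
       r / B. *)
    destruct (Hg (1 - r / B) ltac:(lra)) as (d2 & Hd2 & G2).
    destruct (circ_near V r b d2 Hd2) as (t2 & Ht2 & N2).
    set (t := Rmin (Rmin t1 t2) (Rmin 1 (b - a)) / 2).
    assert (Tb : 0 < t /\ t < t1 /\ t < t2 /\ t < 1 /\ t < b - a).
    { unfold t. assert (0 < Rmin (Rmin t1 t2) (Rmin 1 (b - a))) by (repeat apply Rmin_glb_lt; lra).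
      pose proof (Rmin_l (Rmin t1 t2) (Rmin 1 (b - a))). pose proof (Rmin_r (Rmin t1 t2) (Rmin 1 (b - a))).
      pose proof (Rmin_l t1 t2). pose proof (Rmin_r t1 t2). pose proof (Rmin_l 1 (b - a)). pose proof (Rmin_r 1 (b - a)). lra. }
    destruct Tb as (T0 & T1 & T2 & T3 & T4).
    pose proof (sin_small_pos t ltac:(lra)) as Hsin.
    exists (circ V r (a + t)).
    rewrite (edge_pt_circ n c (next n k) V A a r eq_refl EA HA). split; [|split].
    - apply N1. rewrite Rabs_right; lra.
    - rewrite (sector_side n c (next n k) V A a r t eq_refl EA). repeat apply Rmult_lt_0_compat; lra.
    - apply (joined_off_clopen n c P (circ V r (b + - t)) _ HP).
      + apply (circ_joined n c V r a b); [lra|lra|assumption].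
      + apply G2.
        * replace (edge_pt n c k (1 - r / B)) with (circ V r b).
          { apply N2. rewrite Rabs_Ropp, Rabs_right; lra. }
          assert (EB1 : fst (c k) - fst V = B * cos b) by exact (f_equal fst EB).
          assert (EB2 : snd (c k) - snd V = B * sin b) by exact (f_equal snd EB).
          unfold circ, edge_pt. fold V. unfold Cadd, Cscale, Csub. cbn [fst snd].
          replace (fst V) with (fst (c k) - B * cos b) by lra. replace (snd V) with (snd (c k) - B * sin b) by lra.
          f_equal; field; lra.
        * assert (E : edge_side n c k (circ V r (b + - t)) = B * r * sin t).
          { unfold edge_side. fold V.
            assert (EB1 : fst (c k) = fst V + B * cos b) by (pose proof (f_equal fst EB) as F; cbn in F; lra).
            assert (EB2 : snd (c k) = snd V + B * sin b) by (pose proof (f_equal snd EB) as F; cbn in F; lra).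
            unfold side, cross, circ, Cadd, Csub. cbn [fst snd]. rewrite EB1, EB2.
            rewrite cos_plus, sin_plus, cos_neg, sin_neg. pose proof (sin2_cos2 b) as SC. unfold Rsqr in SC.
            transitivity (B * r * sin t * (sin b * sin b + cos b * cos b)); [ring|rewrite SC; ring]. }
          rewrite E. repeat apply Rmult_lt_0_compat; lra. }
  intros s Hs. apply (germ_along_edge n c (next n k) P (r / A) s); try assumption; lia.
Qed.

Lemma germ_everywhere n c P : (3 <= n)%nat -> jordan_polygon n c -> distinct_vertices n c ->
  off_clopen n c P -> germ n c 0 (1 / 2) P -> forall k s, (k < n)%nat -> 0 < s < 1 -> germ n c k s P.
Proof.
  intros Hn HJ HD HP H0 k. induction k as [|k IH]; intros s Hk Hs.
  - apply (germ_along_edge n c 0 P (1 / 2) s); try assumption; try lia; lra.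
  - rewrite <- (next_lt n k Hk). apply germ_next; try assumption; [lia|].
    intros s' Hs'. apply IH; [lia|assumption].
Qed.

(** * Reflection in the real axis, which exchanges left and right *)

Definition mirror (z : Cpt) : Cpt := (fst z, - snd z).

Lemma mirror_invol z : mirror (mirror z) = z.
Proof. unfold mirror. apply Cpt_eq; cbn [fst snd]; ring. Qed.

Lemma mirror_seg a b z : on_seg a b z -> on_seg (mirror a) (mirror b) (mirror z).
Proof.
  intros (s & Hs & ->). exists s. split; [assumption|].
  unfold mirror, Cadd, Cscale, Csub. cbn [fst snd]. f_equal; ring.
Qed.

Lemma mirror_seg_iff a b z : on_seg (mirror a) (mirror b) z <-> on_seg a b (mirror z).
Proof.
  split; intros H; apply mirror_seg in H; rewrite ?mirror_invol in H; assumption.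
Qed.

Lemma mirror_polygon n c z : on_polygon n (fun k => mirror (c k)) z <-> on_polygon n c (mirror z).
Proof.
  split; intros (k & Hk & H); exists k; (split; [assumption|]); now apply mirror_seg_iff.
Qed.

Lemma mirror_inj a b : mirror a = mirror b -> a = b.
Proof. intros H. rewrite <- (mirror_invol a), H. apply mirror_invol. Qed.

Lemma mirror_jordan n c : jordan_polygon n c -> jordan_polygon n (fun k => mirror (c k)).
Proof.
  intros HJ i j q Hi Hj Hij H1 H2. apply mirror_seg_iff in H1. apply mirror_seg_iff in H2.
  destruct (HJ i j _ Hi Hj Hij H1 H2) as [(E & E2)|(E & E2)]; [left|right]; split; try assumption;
    rewrite <- E2; symmetry; apply mirror_invol.
Qed.

Lemma mirror_distinct n c : distinct_vertices n c -> distinct_vertices n (fun k => mirror (c k)).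
Proof. intros HD i j Hi Hj Hij E. apply (HD i j Hi Hj Hij). now apply mirror_inj. Qed.

Lemma mirror_box w d z : box w d z <-> box (mirror w) d (mirror z).
Proof.
  unfold box, mirror. cbn [fst snd]. replace (- snd z - - snd w) with (- (snd z - snd w)) by ring.
  now rewrite Rabs_Ropp.
Qed.

Lemma mirror_side a b w : side (mirror a) (mirror b) (mirror w) = - side a b w.
Proof. unfold side, cross, mirror, Csub. cbn [fst snd]. ring. Qed.

Lemma mirror_clopen n c P : off_clopen n c P -> off_clopen n (fun k => mirror (c k)) (fun w => P (mirror w)).
Proof.
  intros HP w Hw. rewrite mirror_polygon in Hw. destruct (HP _ Hw) as (d & Hd & H).
  exists d. split; [assumption|]. intros z Hz. apply H. now apply mirror_box in Hz.
Qed.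

Lemma mirror_edge_pt n c k s : edge_pt n (fun k => mirror (c k)) k s = mirror (edge_pt n c k s).
Proof. unfold edge_pt, mirror, Cadd, Cscale, Csub. cbn [fst snd]. f_equal; ring. Qed.

Lemma mirror_germ n c k s P : germ_right n c k s P <-> germ n (fun k => mirror (c k)) k s (fun w => P (mirror w)).
Proof.
  unfold germ, germ_right. rewrite mirror_edge_pt.
  split; intros (d & Hd & H); exists d; (split; [assumption|]); intros w W1 W2.
  - apply H.
    + apply mirror_box. now rewrite mirror_invol.
    + rewrite <- (mirror_invol w) in W2. unfold edge_side in *. rewrite mirror_side in W2. lra.
  - rewrite <- (mirror_invol w). apply H.
    + now apply mirror_box in W1.
    + unfold edge_side in *. rewrite mirror_side. lra.
Qed.

Lemma germ_right_everywhere n c P : (3 <= n)%nat -> jordan_polygon n c -> distinct_vertices n c ->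
  off_clopen n c P -> germ_right n c 0 (1 / 2) P -> forall k s, (k < n)%nat -> 0 < s < 1 -> germ_right n c k s P.
Proof.
  intros Hn HJ HD HP H0 k s Hk Hs. apply mirror_germ. apply mirror_germ in H0.
  apply germ_everywhere; auto using mirror_jordan, mirror_distinct, mirror_clopen.
Qed.

Lemma prev_vertex n k : (k < n)%nat -> exists j, (j < n)%nat /\ next n j = k.
Proof.
  intros Hk. destruct k as [|k].
  - exists (n - 1)%nat. split; [lia|]. destruct (next_cases n (n - 1)%nat ltac:(lia)) as [(L & E)|(L & E)]; lia.
  - exists k. split; [lia|]. apply next_lt. lia.
Qed.

(** On a small circle around the vertex the arc in the left sector is reached from the left germ,
    and the complementary arc from the right germ. *)
Lemma vertex_cover n c k P : (3 <= n)%nat -> jordan_polygon n c -> distinct_vertices n c -> (k < n)%nat ->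
  off_clopen n c P -> (forall j s, (j < n)%nat -> 0 < s < 1 -> germ n c j s P) ->
  (forall j s, (j < n)%nat -> 0 < s < 1 -> germ_right n c j s P) ->
  exists d, 0 < d /\ forall z, box (c (next n k)) d z -> on_polygon n c z \/ P z.
Proof.
  intros Hn HJ HD Hk HP HL HR.
  assert (Hk' : (next n k < n)%nat) by (destruct (next_cases n k Hk); lia).
  destruct (vertex_neighbourhood n c k Hn HJ HD Hk) as (a & b & A & B & r0 & HA & HB & Hr0 & HrA & HrB & Hab & Ha & EA & EB & Hon).
  set (V := c (next n k)) in *.
  exists (r0 / 2). split; [lra|]. intros z (Z1 & Z2).
  destruct (classic (z = V)) as [->|HzV].
  { left. exists (next n k). split; [assumption|]. exists 0. split; [lra|].
    unfold V, Cadd, Cscale. apply Cpt_eq; cbn [fst snd]; ring. }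
  destruct (polar_coordinates_from (fst z - fst V) (snd z - snd V) a Ha) as (r & f & Hr & Hrb & Hf & E1 & E2).
  { destruct (Req_dec (fst z - fst V) 0) as [Q|Q]; [right|now left]. intros Q2. apply HzV. apply Cpt_eq; lra. }
  assert (Ez : z = circ V r f).
  { unfold circ, Cadd. apply Cpt_eq; cbn [fst snd]; lra. }
  assert (Hrr : 0 < r < r0) by lra.
  assert (HrA1 : 0 < r / A < 1) by (split; [apply Rdiv_lt_0_compat; lra|apply Rlt_div_l; lra]).
  subst z. destruct (classic (on_polygon n c (circ V r f))) as [Hp|Hp]; [now left|right].
  assert (Hfab : f <> a /\ f <> b) by (split; intros ->; apply Hp; apply Hon; auto; lra).
  destruct (Rle_dec f b) as [Hfb|Hfb].
  - destruct (HL (next n k) (r / A) Hk' HrA1) as (d & Hd & G).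
    destruct (circ_near V r a d Hd) as (t1 & Ht1 & N1).
    set (t := Rmin t1 (Rmin 1 (b - a)) / 2).
    assert (Tb : 0 < t /\ t < t1 /\ t < 1 /\ t < b - a).
    { unfold t. assert (0 < Rmin t1 (Rmin 1 (b - a))) by (repeat apply Rmin_glb_lt; lra).
      pose proof (Rmin_l t1 (Rmin 1 (b - a))). pose proof (Rmin_r t1 (Rmin 1 (b - a))).
      pose proof (Rmin_l 1 (b - a)). pose proof (Rmin_r 1 (b - a)). lra. }
    apply (joined_off_clopen n c P (circ V r (a + t)) _ HP).
    + apply (circ_joined n c V r a b); [lra|lra|]. intros g Hg Hc. apply (Hon r g Hrr ltac:(lra)) in Hc. lra.
    + apply G; rewrite ?(edge_pt_circ n c (next n k) V A a r eq_refl EA HA).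
      * apply N1. rewrite Rabs_right; lra.
      * rewrite (sector_side n c (next n k) V A a r t eq_refl EA).
        pose proof (sin_small_pos t ltac:(lra)). repeat apply Rmult_lt_0_compat; lra.
  - destruct (HR (next n k) (r / A) Hk' HrA1) as (d & Hd & G).
    destruct (circ_near V r a d Hd) as (t1 & Ht1 & N1).
    set (t := Rmin t1 (Rmin 1 (a + 2 * PI - b)) / 2).
    assert (Tb : 0 < t /\ t < t1 /\ t < 1 /\ t < a + 2 * PI - b).
    { unfold t. assert (0 < Rmin t1 (Rmin 1 (a + 2 * PI - b))) by (repeat apply Rmin_glb_lt; lra).
      pose proof (Rmin_l t1 (Rmin 1 (a + 2 * PI - b))). pose proof (Rmin_r t1 (Rmin 1 (a + 2 * PI - b))).
      pose proof (Rmin_l 1 (a + 2 * PI - b)). pose proof (Rmin_r 1 (a + 2 * PI - b)). lra. }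
    (* The right sector is (b, a + 2 PI). Just below its upper end lies the right side of the
       outgoing edge, which is seen there under the angle a - t. *)
    assert (Eper : circ V r (a + 2 * PI + - t) = circ V r (a + - t)).
    { unfold circ. replace (a + 2 * PI + - t) with (a + - t + 2 * INR 1 * PI) by (simpl; ring).
      now rewrite cos_period, sin_period. }
    apply (joined_off_clopen n c P (circ V r (a + 2 * PI + - t)) _ HP).
    + apply (circ_joined n c V r b (a + 2 * PI)); [lra|lra|]. intros g Hg Hc. apply (Hon r g Hrr ltac:(lra)) in Hc. lra.
    + rewrite Eper. apply G; rewrite ?(edge_pt_circ n c (next n k) V A a r eq_refl EA HA).
      * apply N1. rewrite Rabs_Ropp, Rabs_right; lra.
      * rewrite (sector_side n c (next n k) V A a r (- t) eq_refl EA), sin_neg.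
        pose proof (sin_small_pos t ltac:(lra)).
        assert (0 < A * r * sin t) by (repeat apply Rmult_lt_0_compat; lra). lra.
Qed.

(* The complement of a Jordan polygon has at most two components, one on each
   side of an edge. *)
Lemma germ_cover n c P : (3 <= n)%nat -> jordan_polygon n c -> distinct_vertices n c ->
  off_clopen n c P -> germ n c 0 (1 / 2) P -> germ_right n c 0 (1 / 2) P ->
  forall w, ~ on_polygon n c w -> P w.
Proof.
  intros Hn HJ HD HP HL HR w Hw.
  pose proof (germ_everywhere n c P Hn HJ HD HP HL) as GL.
  pose proof (germ_right_everywhere n c P Hn HJ HD HP HR) as GR.
  (* Being on the polygon or satisfying P is locally constant on the whole plane and true at [c 0];
     the segment from [c 0] to w then finishes the proof. *)
  assert (Hloc : forall q, exists d, 0 < d /\ forall z, box q d z -> ((on_polygon n c z \/ P z) <-> (on_polygon n c q \/ P q))).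
  { intros q. destruct (classic (on_polygon n c q)) as [Hq|Hq].
    - assert (Hex : exists d, 0 < d /\ forall z, box q d z -> on_polygon n c z \/ P z).
      { destruct Hq as (k & Hk & s & Hs & Eq).
        destruct (Req_dec s 0) as [S0|S0]; [|destruct (Req_dec s 1) as [S1|S1]].
        - destruct (prev_vertex n k Hk) as (j & Hj & <-).
          replace q with (c (next n j)) by (rewrite Eq, S0; unfold Cadd, Cscale; apply Cpt_eq; cbn [fst snd]; ring).
          now apply vertex_cover.
        - replace q with (c (next n k)) by (rewrite Eq, S1; unfold Cadd, Cscale, Csub; apply Cpt_eq; cbn [fst snd]; ring).
          now apply vertex_cover.
        - assert (Hs1 : 0 < s < 1) by lra. fold (edge_pt n c k s) in Eq. subst q.
          destruct (edge_neighbourhood n c k s ltac:(lia) HJ HD Hk Hs1) as (d & Hd & Hon).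
          destruct (GL k s Hk Hs1) as (d1 & Hd1 & G1). destruct (GR k s Hk Hs1) as (d2 & Hd2 & G2).
          exists (Rmin d (Rmin d1 d2)). split; [repeat apply Rmin_glb_lt; lra|].
          pose proof (Rmin_l d (Rmin d1 d2)). pose proof (Rmin_r d (Rmin d1 d2)).
          pose proof (Rmin_l d1 d2). pose proof (Rmin_r d1 d2).
          intros z Hz. destruct (Rtotal_order (edge_side n c k z) 0) as [T|[T|T]].
          + right. apply G2; [|assumption]. eapply box_mono; [|exact Hz]. lra.
          + left. apply Hon; [|assumption]. eapply box_mono; [|exact Hz]. lra.
          + right. apply G1; [|assumption]. eapply box_mono; [|exact Hz]. lra. }
      destruct Hex as (d & Hd & H). exists d. split; [assumption|]. intros z Hz. split; intros _; [now left|auto].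
    - destruct (HP q Hq) as (d1 & Hd1 & H1). destruct (polygon_separate n c q Hq) as (d2 & Hd2 & H2).
      exists (Rmin d1 d2). split; [now apply Rmin_glb_lt|].
      intros z Hz. rewrite (H1 z) by (eapply box_mono; [apply Rmin_l|exact Hz]).
      specialize (H2 z (box_mono _ _ _ _ (Rmin_r _ _) Hz)). tauto. }
  set (q := c 0%nat). set (g := fun s => Cadd q (Cscale s (Csub w q))).
  assert (Hend : on_polygon n c (g 1) \/ P (g 1)).
  { apply (interval_connected (fun s => on_polygon n c (g s) \/ P (g s)) 0 1); [lra| |].
    - intros s _. destruct (Hloc (g s)) as (d & Hd & H).
      set (M := Rabs (fst w - fst q) + Rabs (snd w - snd q) + 1).
      assert (P1 := Rabs_pos (fst w - fst q)). assert (P2 := Rabs_pos (snd w - snd q)).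
      assert (HM : 0 < M) by (unfold M; lra).
      exists (d / M). split; [now apply Rdiv_lt_0_compat|]. intros s' _ Hs'. apply H.
      apply Rlt_div_r in Hs'; [|lra]. unfold M in Hs'.
      destruct (Req_dec s' s) as [->|Hne]; [now apply box_center|].
      assert (P3 : 0 < Rabs (s' - s)) by (apply Rabs_pos_lt; lra).
      assert (0 <= Rabs (s' - s) * Rabs (fst w - fst q)) by (apply Rmult_le_pos; lra).
      assert (0 <= Rabs (s' - s) * Rabs (snd w - snd q)) by (apply Rmult_le_pos; lra).
      unfold box, g, Cadd, Cscale, Csub. cbn [fst snd]. split.
      + match goal with |- Rabs ?a < _ => replace a with ((s' - s) * (fst w - fst q)) by ring end. rewrite Rabs_mult. lra.
      + match goal with |- Rabs ?a < _ => replace a with ((s' - s) * (snd w - snd q)) by ring end. rewrite Rabs_mult. lra.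
    - left. exists 0%nat. split; [lia|]. exists 0. split; [lra|].
      unfold g, q, Cadd, Cscale. apply Cpt_eq; cbn [fst snd]; ring. }
  replace (g 1) with w in Hend by (unfold g, Cadd, Cscale, Csub; apply Cpt_eq; cbn [fst snd]; ring).
  tauto.
Qed.

(** * The domain, its exterior and the image of the map *)

Lemma joined_sym n c z w : joined_off_polygon n c z w -> joined_off_polygon n c w z.
Proof.
  intros (g & C1 & C2 & E0 & E1 & H). exists (fun s => g (1 - s)).
  assert (C : continuity (fun s => 1 - s)) by reg.
  split; [|split; [|split; [|split]]].
  - intros s. apply (continuity_pt_comp (fun s => 1 - s) (fun s => fst (g s))); [apply C|apply C1].
  - intros s. apply (continuity_pt_comp (fun s => 1 - s) (fun s => snd (g s))); [apply C|apply C2].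
  - now rewrite Rminus_0_r.
  - now rewrite Rminus_diag.
  - intros s Hs. apply H. lra.
Qed.

Lemma clamp_continuity : continuity (fun s => Rmax 0 (Rmin 1 s)).
Proof.
  intros s eps Heps. exists eps. split; [assumption|]. intros s' (_ & Hs'). simpl in *. unfold Rdist in *.
  eapply Rle_lt_trans; [|exact Hs'].
  unfold Rmax, Rmin. destruct (Rle_dec 1 s); destruct (Rle_dec 1 s'); repeat destruct (Rle_dec 0 _);
    unfold Rabs; repeat destruct (Rcase_abs _); lra.
Qed.

(* The two paths are concatenated as g1 + g2 - w, each frozen outside its half. *)
Lemma joined_trans n c z w y : joined_off_polygon n c z w -> joined_off_polygon n c w y -> joined_off_polygon n c z y.
Proof.
  intros (g1 & A1 & A2 & A3 & A4 & A5) (g2 & B1 & B2 & B3 & B4 & B5).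
  set (cl := fun s => Rmax 0 (Rmin 1 s)).
  assert (Ccl : continuity cl) by exact clamp_continuity.
  set (u1 := fun s => cl (2 * s)). set (u2 := fun s => cl (2 * s - 1)).
  assert (Cu1 : continuity u1).
  { intros s. apply (continuity_pt_comp (fun s => 2 * s) cl); [reg|apply Ccl]. }
  assert (Cu2 : continuity u2).
  { intros s. apply (continuity_pt_comp (fun s => 2 * s - 1) cl); [reg|apply Ccl]. }
  assert (cl0 : forall s, s <= 0 -> cl s = 0).
  { intros s Hs. unfold cl, Rmax, Rmin. destruct (Rle_dec 1 s); destruct (Rle_dec 0 _); lra. }
  assert (cl1 : forall s, 1 <= s -> cl s = 1).
  { intros s Hs. unfold cl, Rmax, Rmin. destruct (Rle_dec 1 s); destruct (Rle_dec 0 _); lra. }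
  assert (clb : forall s, 0 <= cl s <= 1).
  { intros s. unfold cl, Rmax, Rmin. destruct (Rle_dec 1 s); destruct (Rle_dec 0 _); lra. }
  exists (fun s => Csub (Cadd (g1 (u1 s)) (g2 (u2 s))) w).
  split; [|split; [|split; [|split]]].
  - unfold Csub, Cadd. cbn [fst snd]. intros s.
    apply (continuity_pt_minus (fun s => fst (g1 (u1 s)) + fst (g2 (u2 s))) (fun _ => fst w)); [|reg].
    apply (continuity_pt_plus (fun s => fst (g1 (u1 s))) (fun s => fst (g2 (u2 s)))).
    + apply (continuity_pt_comp u1 (fun s => fst (g1 s))); [apply Cu1|apply A1].
    + apply (continuity_pt_comp u2 (fun s => fst (g2 s))); [apply Cu2|apply B1].
  - unfold Csub, Cadd. cbn [fst snd]. intros s.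
    apply (continuity_pt_minus (fun s => snd (g1 (u1 s)) + snd (g2 (u2 s))) (fun _ => snd w)); [|reg].
    apply (continuity_pt_plus (fun s => snd (g1 (u1 s))) (fun s => snd (g2 (u2 s)))).
    + apply (continuity_pt_comp u1 (fun s => snd (g1 s))); [apply Cu1|apply A2].
    + apply (continuity_pt_comp u2 (fun s => snd (g2 s))); [apply Cu2|apply B2].
  - unfold u1, u2. rewrite !cl0 by lra. rewrite A3, B3. unfold Csub, Cadd. apply Cpt_eq; cbn [fst snd]; ring.
  - unfold u1, u2. rewrite !cl1 by lra. rewrite A4, B4. unfold Csub, Cadd. apply Cpt_eq; cbn [fst snd]; ring.
  - intros s Hs. destruct (Rle_dec s (1 / 2)).
    + unfold u2. rewrite cl0 by lra. rewrite B3.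
      replace (Csub (Cadd (g1 (u1 s)) w) w) with (g1 (u1 s)) by (unfold Csub, Cadd; apply Cpt_eq; cbn [fst snd]; ring).
      apply A5. apply clb.
    + unfold u1. rewrite cl1 by lra. rewrite A4.
      replace (Csub (Cadd w (g2 (u2 s))) w) with (g2 (u2 s)) by (unfold Csub, Cadd; apply Cpt_eq; cbn [fst snd]; ring).
      apply B5. apply clb.
Qed.

Lemma polygon_domain_clopen n c : off_clopen n c (polygon_domain n c).
Proof.
  intros w Hw. destruct (polygon_separate n c w Hw) as (d & Hd & H).
  exists d. split; [assumption|]. intros z Hz.
  assert (J : joined_off_polygon n c w z).
  { apply segment_joined. intros s Hs. apply H. apply box_convex; [now apply box_center|assumption|assumption]. }
  split; intros (Hoff & M & HM).
  - split; [assumption|]. exists M. intros y Hy. apply HM. eapply joined_trans; [apply joined_sym; exact J|exact Hy].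
  - split; [now apply H|]. exists M. intros y Hy. apply HM. eapply joined_trans; [exact J|exact Hy].
Qed.

Lemma off_clopen_not n c P : off_clopen n c P -> off_clopen n c (fun w => ~ P w).
Proof.
  intros HP w Hw. destruct (HP w Hw) as (d & Hd & H). exists d. split; [assumption|].
  intros z Hz. specialize (H z Hz). tauto.
Qed.

Lemma off_clopen_or n c P Q : off_clopen n c P -> off_clopen n c Q -> off_clopen n c (fun w => P w \/ Q w).
Proof.
  intros HP HQ w Hw. destruct (HP w Hw) as (d1 & Hd1 & H1). destruct (HQ w Hw) as (d2 & Hd2 & H2).
  exists (Rmin d1 d2). split; [now apply Rmin_glb_lt|]. intros z Hz.
  rewrite (H1 z) by (eapply box_mono; [apply Rmin_l|exact Hz]).
  rewrite (H2 z) by (eapply box_mono; [apply Rmin_r|exact Hz]). tauto.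
Qed.

Lemma polygon_bounded n c : exists B, forall z, on_polygon n c z -> fst z <= B.
Proof.
  destruct (finite_bound (fun k => fst (c k)) n) as (B & HB & H). exists B.
  intros z (k & Hk & s & Hs & ->).
  assert (Hk' : (next n k < n)%nat) by (destruct (next_cases n k Hk); lia).
  pose proof (H k Hk) as H1. pose proof (H _ Hk') as H2. cbv beta in H1, H2.
  apply Rabs_le_between in H1. apply Rabs_le_between in H2.
  unfold Cadd, Cscale, Csub. cbn [fst snd]. nra.
Qed.

(** To the right of the polygon a horizontal ray escapes to infinity, so the component is unbounded;
    the shift by 1 + |M| + |x| along it exceeds any proposed bound M. *)
Lemma far_outside n c : exists B, forall z, B < fst z -> ~ on_polygon n c z /\ ~ polygon_domain n c z.
Proof.
  destruct (polygon_bounded n c) as (B & HB). exists B. intros z Hz. split.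
  - intros H. apply HB in H. lra.
  - intros (_ & M & HM).
    set (w := (fst z + (1 + Rabs M + Rabs (fst z)), snd z)).
    assert (Cnorm2 w <= M).
    { apply HM. apply segment_joined. intros s Hs H. apply HB in H.
      unfold w, Cadd, Cscale, Csub in H. cbn [fst snd] in H.
      pose proof (Rabs_pos M). pose proof (Rabs_pos (fst z)). nra. }
    unfold Cnorm2, w in H. cbn [fst snd] in H.
    pose proof (Rabs_pos M). pose proof (Rle_abs M). pose proof (Rle_abs (- fst z)) as Q. rewrite Rabs_Ropp in Q.
    pose proof (mul_self_ge0 (snd z)). nra.
Qed.

Lemma image_bounded p c x : exists B, forall z, image p c x z -> Rabs (fst z) <= B /\ Rabs (snd z) <= B.
Proof.
  pose proof PI_RGT_0.
  assert (H0 : forall c0 g, exists B, forall X Y, Rabs (hmap c0 (S p) g x X Y) <= B).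
  { intros c0 g. exists (Rabs c0 + bsum (fun k => Rabs (g k)) (S p) * PI). intros X Y.
    pose proof (hmap_target c0 (S p) g x X Y (fun _ => 0) PI _ ltac:(lra)
      (fun k _ => ltac:(rewrite Rminus_0_r; pose proof (th_bounds (X - x k) Y); rewrite Rabs_right; lra))
      (Rle_refl (bsum (fun k => Rabs (g k)) (S p)))) as H1.
    rewrite (bsum_ext (fun k => g k * 0) (fun _ => 0)) in H1 by (intros; ring). rewrite bsum_0 in H1.
    unfold Rdiv in H1. rewrite Rmult_0_l, Rminus_0_r in H1.
    replace (hmap c0 (S p) g x X Y) with ((hmap c0 (S p) g x X Y - c0) + c0) by ring.
    eapply Rle_trans; [apply Rabs_triang|]. lra. }
  destruct (H0 (fst (c (S p))) (fun k => fst (edge_vec c k))) as (B1 & H1).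
  destruct (H0 (snd (c (S p))) (fun k => snd (edge_vec c k))) as (B2 & H2).
  exists (Rmax B1 B2). intros z (X & Y & _ & <-). split.
  - eapply Rle_trans; [apply H1|apply Rmax_l].
  - eapply Rle_trans; [apply H2|apply Rmax_r].
Qed.

(** Orientation gives points of the domain on the normal at the midpoint; constancy on the half box
    extends this to a half-neighbourhood. *)
Lemma germ_positively_oriented n c : (3 <= n)%nat -> jordan_polygon n c -> distinct_vertices n c ->
  positively_oriented n c -> germ n c 0 (1 / 2) (polygon_domain n c).
Proof.
  intros Hn HJ HD HO. destruct (HO 0%nat ltac:(lia)) as (d0 & Hd0 & H).
  apply germ_of_point; try assumption; try lia; [lra|apply polygon_domain_clopen|].
  intros d Hd. set (e := Csub (c (next n 0)) (c 0%nat)) in *.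
  set (M := Rabs (fst e) + Rabs (snd e) + 1).
  assert (P1 := Rabs_pos (fst e)). assert (P2 := Rabs_pos (snd e)).
  assert (HM : 0 < M) by (unfold M; lra).
  set (t := Rmin (d0 / 2) (d / M)).
  assert (Ht : 0 < t) by (apply Rmin_glb_lt; [lra|now apply Rdiv_lt_0_compat]).
  assert (HtM : t * M <= d).
  { apply Rle_trans with (d / M * M); [|right; field; lra]. apply Rmult_le_compat_r; [lra|apply Rmin_r]. }
  assert (Htd : t < d0) by (pose proof (Rmin_l (d0 / 2) (d / M)); unfold t; lra).
  specialize (H t (conj Ht Htd)). eexists. split; [|split; [|exact H]].
  - unfold M in HtM. assert (0 <= t * Rabs (fst e)) by (apply Rmult_le_pos; lra).
    assert (0 <= t * Rabs (snd e)) by (apply Rmult_le_pos; lra).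
    unfold box, edge_pt, Cadd, Cscale, Crot. fold e. cbn [fst snd]. split.
    + match goal with |- Rabs ?a < _ => replace a with (- (t * snd e)) end.
      2:{ unfold e, Csub; cbn [fst snd]. field. }
      rewrite Rabs_Ropp, Rabs_mult, (Rabs_right t) by lra. lra.
    + match goal with |- Rabs ?a < _ => replace a with (t * fst e) end.
      2:{ unfold e, Csub; cbn [fst snd]. field. }
      rewrite Rabs_mult, (Rabs_right t) by lra. lra.
  - pose proof (edge_length_pos n c 0 ltac:(lia) HD ltac:(lia)) as HE. cbv zeta in HE. fold e in HE.
    match goal with |- 0 < ?a => replace a with (t * (fst e * fst e + snd e * snd e)) end; [nra|].
    unfold edge_side, side, cross, Cadd, Cscale, Crot. fold e. unfold Csub. cbn [fst snd].
    unfold e, Csub. cbn [fst snd]. field.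
Qed.

Lemma off_clopen_germ_dichotomy n c P : (3 <= n)%nat -> jordan_polygon n c -> distinct_vertices n c ->
  off_clopen n c P -> germ_right n c 0 (1 / 2) P \/ germ_right n c 0 (1 / 2) (fun w => ~ P w).
Proof.
  intros Hn HJ HD HP.
  destruct (classic (germ_right n c 0 (1 / 2) (fun w => ~ P w))) as [H|H]; [now right|left].
  apply mirror_germ. apply germ_of_point; try lia; try lra; auto using mirror_jordan, mirror_distinct, mirror_clopen.
  intros d Hd. apply NNPP. intros Hno. apply H. apply mirror_germ.
  exists d. split; [assumption|]. intros w W1 W2 W3. apply Hno. now exists w.
Qed.

(** Were the domain also on the right of edge 0, it would be the whole complement, far away points
    included. *)
Lemma outside_germ n c : (3 <= n)%nat -> jordan_polygon n c -> distinct_vertices n c ->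
  positively_oriented n c -> germ_right n c 0 (1 / 2) (fun w => ~ polygon_domain n c w).
Proof.
  intros Hn HJ HD HO. pose proof (germ_positively_oriented n c Hn HJ HD HO) as GL.
  destruct (off_clopen_germ_dichotomy n c _ Hn HJ HD (polygon_domain_clopen n c)) as [G|G]; [|exact G].
  exfalso. destruct (far_outside n c) as (B & HB). destruct (HB (B + 1, 0)) as (F1 & F2); [simpl; lra|].
  apply F2. exact (germ_cover n c _ Hn HJ HD (polygon_domain_clopen n c) GL G _ F1).
Qed.

Lemma edge0_midpoint n c : (2 <= n)%nat -> edge_pt n c 0 (1 / 2) = midpoint (c 0%nat) (c 1%nat).
Proof.
  intros Hn. unfold edge_pt. rewrite next_lt by lia. unfold midpoint, Cadd, Cscale, Csub. cbn [fst snd]. f_equal; field.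
Qed.

Lemma germ_image p c x : (1 <= p)%nat -> increasing (S p) x -> jac_positive (S p) (edge_vec c) x ->
  germ (S (S p)) c 0 (1 / 2) (image p c x).
Proof.
  intros Hp Hx HJac. destruct (left_in_image p c x Hx HJac) as (d & Hd & H).
  exists d. split; [assumption|]. intros w W1 W2. rewrite edge0_midpoint in W1 by lia.
  unfold edge_side in W2. rewrite next_lt in W2 by lia. now apply H.
Qed.

Lemma mirror_image_clopen p c x : (1 <= p)%nat -> increasing (S p) x ->
  jac_positive (S p) (edge_vec (fun k => mirror (c k))) x ->
  off_clopen (S (S p)) c (fun w => image p (fun k => mirror (c k)) x (mirror w)).
Proof.
  intros Hp Hx HJac w Hw.
  assert (Hw' : ~ on_polygon (S (S p)) (fun k => mirror (c k)) (mirror w)) by (now rewrite mirror_polygon, mirror_invol).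
  destruct (image_clopen p _ x Hp Hx HJac _ Hw') as (d & Hd & H). exists d. split; [assumption|].
  intros z Hz. apply H. now apply mirror_box in Hz.
Qed.

(** Reflected back, the image belonging to the reversed polygon would be bounded and lie on the
    right of edge 0, with the domain on its left. Together they would fill the complement, although
    far away points belong to neither. *)
Lemma not_reversed p c x : (1 <= p)%nat -> let n := S (S p) in
  jordan_polygon n c -> distinct_vertices n c -> positively_oriented n c ->
  increasing (S p) x -> ~ jac_positive (S p) (edge_vec (fun k => mirror (c k))) x.
Proof.
  intros Hp n HJ HD HO Hx HJac. assert (Hn : (3 <= n)%nat) by (unfold n; lia).
  pose proof (germ_positively_oriented n c Hn HJ HD HO) as GL.
  pose proof (germ_image p _ x Hp Hx HJac) as GI.
  set (P := fun w => image p (fun k => mirror (c k)) x (mirror w)).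
  assert (GP : germ_right n c 0 (1 / 2) P).
  { apply mirror_germ. destruct GI as (d & Hd & G). exists d. split; [assumption|].
    intros w W1 W2. unfold P. rewrite mirror_invol. now apply G. }
  assert (CP : off_clopen n c P) by now apply mirror_image_clopen.
  destruct (far_outside n c) as (B & HB). destruct (image_bounded p (fun k => mirror (c k)) x) as (B' & HB').
  pose proof (Rmax_l B B'). pose proof (Rmax_r B B').
  destruct (HB (Rmax B B' + 1, 0)) as (F1 & F2); [simpl; lra|].
  assert (H2 : polygon_domain n c (Rmax B B' + 1, 0) \/ P (Rmax B B' + 1, 0)).
  { apply (germ_cover n c (fun w => polygon_domain n c w \/ P w)); try assumption.
    - apply off_clopen_or; [apply polygon_domain_clopen|exact CP].
    - destruct GL as (d & Hd & G). exists d. split; [assumption|]. intros; left; now apply G.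
    - destruct GP as (d & Hd & G). exists d. split; [assumption|]. intros; right; now apply G. }
  destruct H2 as [H2|H2]; [tauto|]. apply HB' in H2. simpl in H2.
  destruct H2 as (H2 & _). pose proof (Rle_abs (Rmax B B' + 1)). lra.
Qed.

Lemma half_plane_mapping p c x : (1 <= p)%nat -> let n := S (S p) in
  jordan_polygon n c -> distinct_vertices n c -> positively_oriented n c ->
  increasing (S p) x -> jac_positive (S p) (edge_vec c) x ->
  (forall X Y X' Y', 0 < Y -> 0 < Y' -> poly_map p c x X Y = poly_map p c x X' Y' -> X = X' /\ Y = Y') /\
  (forall X Y, 0 < Y -> polygon_domain n c (poly_map p c x X Y)) /\
  (forall w, polygon_domain n c w -> image p c x w).
Proof.
  intros Hp n HJ HD HO Hx HJac. assert (Hn : (3 <= n)%nat) by (unfold n; lia).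
  pose proof (germ_positively_oriented n c Hn HJ HD HO) as GL.
  pose proof (outside_germ n c Hn HJ HD HO) as GR.
  pose proof (image_clopen p c x Hp Hx HJac) as CI. fold n in CI.
  pose proof (single_preimage_clopen p c x Hp Hx HJac) as CS. fold n in CS.
  pose proof (germ_image p c x Hp Hx HJac) as GI. fold n in GI.
  (* With image points on both sides of edge 0 the image would contain the whole complement, but it
     is bounded. *)
  assert (GO : germ_right n c 0 (1 / 2) (fun w => ~ image p c x w)).
  { destruct (off_clopen_germ_dichotomy n c _ Hn HJ HD CI) as [G|G]; [|exact G].
    exfalso. destruct (far_outside n c) as (B & HB). destruct (image_bounded p c x) as (B' & HB').
    pose proof (Rmax_l B B'). pose proof (Rmax_r B B').
    destruct (HB (Rmax B B' + 1, 0)) as (F1 & _); [simpl; lra|].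
    pose proof (germ_cover n c _ Hn HJ HD CI GI G _ F1) as H2. apply HB' in H2. simpl in H2.
    destruct H2 as (H2 & _). pose proof (Rle_abs (Rmax B B' + 1)). lra. }
  assert (GS : germ n c 0 (1 / 2) (single_preimage p c x)).
  { destruct (single_preimage_left p c x Hp Hx HJac) as (d & Hd & H).
    - intros E. apply (HD 0%nat 1%nat); try lia. exact E.
    - intros k Hk Hk0. fold n. rewrite <- (edge0_midpoint n c) by lia.
      apply edge_pt_only; try assumption; [lia|lra].
    - intros d Hd. apply mirror_germ in GO.
      destruct (germ_point n _ 0 (1 / 2) _ d (mirror_distinct _ _ HD) ltac:(lia) ltac:(lia) Hd GO) as (w & W1 & W2 & W3).
      exists (mirror w). split; [|exact W3]. rewrite <- (edge0_midpoint n c) by lia.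
      rewrite mirror_edge_pt in W1. apply mirror_box. now rewrite mirror_invol.
    - exists d. split; [assumption|]. intros w W1 W2. rewrite edge0_midpoint in W1 by lia.
      unfold edge_side in W2. rewrite next_lt in W2 by lia. now apply H. }
  (* The implication holds on the left of edge 0 by its conclusion and on the right because its
     premise fails there, hence everywhere off the polygon. The converse inclusion below follows the
     same pattern. *)
  assert (DS : forall w, polygon_domain n c w -> single_preimage p c x w).
  { intros w Hw. assert (Hoff : ~ on_polygon n c w) by apply Hw.
    assert (H : ~ polygon_domain n c w \/ single_preimage p c x w); [|tauto].
    apply (germ_cover n c (fun w => ~ polygon_domain n c w \/ single_preimage p c x w)); try assumption.
    - apply off_clopen_or; [apply off_clopen_not, polygon_domain_clopen|exact CS].
    - destruct GS as (d & Hd & G). exists d. split; [assumption|]. intros; right; now apply G.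
    - destruct GR as (d & Hd & G). exists d. split; [assumption|]. intros; left; now apply G. }
  assert (ID : forall w, image p c x w -> polygon_domain n c w).
  (* The image is open, so an image point on the polygon would bring image points to the right of a
     nearby interior edge point. The parameter [s'] keeps away from the vertices. *)
  { intros w Hw. assert (Hoff : ~ on_polygon n c w).
    { intros (k & Hk & s & Hs & Ew).
      destruct (image_open p c x w HJac Hw) as (d & Hd & Ho).
      fold (edge_pt n c k s) in Ew.
      destruct (edge_pt_near n c k s (d / 2) ltac:(lra)) as (r & Hr & Hnear).
      set (q := Rmin (r / 2) (1 / 4)).
      assert (Hq : 0 < q /\ q <= r / 2 /\ q <= 1 / 4) by (unfold q; repeat split; [apply Rmin_glb_lt; lra|apply Rmin_l|apply Rmin_r]).
      set (s' := if Rle_dec s (1 / 2) then s + q else s - q).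
      assert (Hs' : 0 < s' < 1 /\ Rabs (s' - s) < r).
      { unfold s'. destruct (Rle_dec s (1 / 2)).
        - replace (s + q - s) with q by ring. rewrite Rabs_right; lra.
        - replace (s - q - s) with (- q) by ring. rewrite Rabs_Ropp, Rabs_right; lra. }
      destruct Hs' as (Hs1 & Hs2).
      pose proof (germ_right_everywhere n c _ Hn HJ HD (off_clopen_not _ _ _ CI) GO k s' Hk Hs1) as GK.
      apply mirror_germ in GK.
      destruct (germ_point n _ k s' _ (d / 2) (mirror_distinct _ _ HD) Hk ltac:(lia) ltac:(lra) GK) as (v & V1 & _ & V3).
      apply V3. apply Ho. rewrite mirror_edge_pt in V1. rewrite Ew.
      replace d with (d / 2 + d / 2) by field. eapply box_trans; [apply Hnear; exact Hs2|].
      apply mirror_box. now rewrite mirror_invol. }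
    assert (H : ~ image p c x w \/ polygon_domain n c w); [|tauto].
    apply (germ_cover n c (fun w => ~ image p c x w \/ polygon_domain n c w)); try assumption.
    - apply off_clopen_or; [apply off_clopen_not; exact CI|apply polygon_domain_clopen].
    - destruct GL as (d & Hd & G). exists d. split; [assumption|]. intros; right; now apply G.
    - destruct GO as (d & Hd & G). exists d. split; [assumption|]. intros; left; now apply G. }
  split; [|split].
  - intros X Y X' Y' HY HY' E.
    destruct (DS (poly_map p c x X Y)) as (_ & Hu); [apply ID; now exists X, Y|].
    apply Hu; auto.
  - intros X Y HY. apply ID. now exists X, Y.
  - intros w Hw. apply DS. exact Hw.
Qed.

(** * Splitting a polygon along a diagonal *)

(** For n vertices there are n - 1 finite jumps, the closing edge being at infinity. *)
Definition pos_poly (n : nat) (c : nat -> Cpt) : Prop :=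
  exists x, increasing (n - 1) x /\ jac_positive (n - 1) (edge_vec c) x.

Lemma pos_poly_ext n c c' : (forall k, (k < n)%nat -> c k = c' k) -> pos_poly n c -> pos_poly n c'.
Proof.
  intros E (x & Hx & HJ). exists x. split; [assumption|].
  apply (jac_positive_ext _ (edge_vec c) _ x x); [|reflexivity|assumption].
  intros k Hk. unfold edge_vec. rewrite !E by lia. reflexivity.
Qed.

Definition rot1 (n : nat) (c : nat -> Cpt) (k : nat) : Cpt := c (next n k).

Lemma next_bound n k : (k < n)%nat -> (next n k < n)%nat.
Proof. intros Hk. destruct (next_cases n k Hk); lia. Qed.

Lemma next_inj n i j : (i < n)%nat -> (j < n)%nat -> next n i = next n j -> i = j.
Proof. intros Hi Hj E. destruct (next_cases n i Hi); destruct (next_cases n j Hj); lia. Qed.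

Lemma rot1_jordan n c : jordan_polygon n c -> jordan_polygon n (rot1 n c).
Proof.
  intros HJ i j q Hi Hj Hij H1 H2.
  destruct (HJ (next n i) (next n j) q) as [(E & E2)|(E & E2)]; auto using next_bound.
  - intros E. apply Hij. now apply (next_inj n).
  - left. split; [|exact E2]. apply (next_inj n); auto using next_bound.
  - right. split; [|exact E2]. apply (next_inj n); auto using next_bound.
Qed.

Lemma rot1_distinct n c : distinct_vertices n c -> distinct_vertices n (rot1 n c).
Proof.
  intros HD i j Hi Hj Hij E. apply (HD (next n i) (next n j)); auto using next_bound.
  intros E2. apply Hij. now apply (next_inj n).
Qed.

(** Inversion about the first jump, moved to 0 by a translation, puts edge 0 at infinity and makes
    the former closing edge the last finite one, which is the cyclic relabelling. *)
Lemma rot1_pos_poly n c : (3 <= n)%nat -> pos_poly n c -> pos_poly n (rot1 n c).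
Proof.
  intros Hn (x & Hx & HJ). destruct n as [|[|p]]; try lia.
  replace (S (S p) - 1)%nat with (S p) in * by lia.
  apply (jac_positive_translate _ _ _ (x 0%nat)) in HJ.
  set (z := fun k => x k - x 0%nat) in *.
  assert (Hz0 : z 0%nat = 0) by (unfold z; ring).
  assert (Hz : forall k, (k < p)%nat -> 0 < z (S k)).
  { intros k Hk. unfold z. pose proof (increasing_lt _ _ Hx 0%nat (S k) ltac:(lia)). lra. }
  apply jac_positive_rot in HJ; [|assumption|intros k Hk; specialize (Hz k Hk); lra].
  exists (rot_jumps p z). replace (S (S p) - 1)%nat with (S p) by lia. split.
  - intros k Hk. unfold rot_jumps. rewrite (proj2 (Nat.ltb_lt k p)) by lia.
    pose proof (Hz k ltac:(lia)) as P1. pose proof (Rinv_0_lt_compat _ P1).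
    destruct (Nat.ltb_spec (S k) p) as [Hk2|Hk2]; [|lra].
    apply Ropp_lt_contravar. pose proof (Hz (S k) Hk2). apply Rinv_lt_contravar; [nra|].
    unfold z. specialize (Hx (S k) ltac:(lia)). lra.
  - eapply jac_positive_ext; [|reflexivity|exact HJ].
    intros k Hk. unfold rot_edges.
    change (edge_vec (rot1 (S (S p)) c) k) with (Csub (c (next (S (S p)) (S k))) (c (next (S (S p)) k))).
    destruct (Nat.ltb_spec k p) as [Hk2|Hk2].
    + rewrite (next_lt (S (S p)) k) by lia. rewrite (next_lt (S (S p)) (S k)) by lia.
      unfold edge_vec. reflexivity.
    + replace k with p by lia. rewrite (next_lt (S (S p)) p) by lia. rewrite next_last.
      unfold edge_vec, Csub. cbn [fst snd].
      rewrite (bsum_telescope (fun j => fst (c j))), (bsum_telescope (fun j => snd (c j))). f_equal; ring.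
Qed.

Lemma iter_rot n c j k : (k < n)%nat -> Nat.iter j (rot1 n) c k = c (Nat.iter j (next n) k).
Proof.
  revert k. induction j as [|j IH]; intros k Hk; [reflexivity|].
  simpl. unfold rot1 at 1. rewrite IH by now apply next_bound. f_equal.
  clear IH Hk. induction j as [|j IH]; [reflexivity|]. simpl. now rewrite IH.
Qed.

Lemma iter_next_add n j k : (j + k < n)%nat -> Nat.iter j (next n) k = (j + k)%nat.
Proof.
  induction j as [|j IH]; intros H; [reflexivity|]. simpl. rewrite IH by lia. apply next_lt. lia.
Qed.

Lemma iter_next_full n k : (k < n)%nat -> Nat.iter n (next n) k = k.
Proof.
  intros Hk. transitivity (Nat.iter (k + (1 + (n - 1 - k))) (next n) k); [f_equal; lia|].
  rewrite Nat.iter_add. rewrite (Nat.iter_add 1).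
  rewrite (iter_next_add n (n - 1 - k) k) by lia. replace (n - 1 - k + k)%nat with (n - 1)%nat by lia.
  simpl. destruct (next_cases n (n - 1) ltac:(lia)) as [(L & E)|(L & E)]; [lia|]. rewrite E.
  rewrite iter_next_add by lia. lia.
Qed.

Lemma iter_rot_pos_poly n c j : (3 <= n)%nat -> pos_poly n c -> pos_poly n (Nat.iter j (rot1 n) c).
Proof. intros Hn H. induction j as [|j IH]; [exact H|]. simpl. now apply rot1_pos_poly. Qed.

Lemma iter_rot_jordan n c j : jordan_polygon n c -> jordan_polygon n (Nat.iter j (rot1 n) c).
Proof. intros H. induction j as [|j IH]; [exact H|]. simpl. now apply rot1_jordan. Qed.

Lemma iter_rot_distinct n c j : distinct_vertices n c -> distinct_vertices n (Nat.iter j (rot1 n) c).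
Proof. intros H. induction j as [|j IH]; [exact H|]. simpl. now apply rot1_distinct. Qed.

(** Relabelling n times is the identity, so n - j further relabellings undo j of them. *)
Lemma pos_poly_unrot n c j : (3 <= n)%nat -> (j <= n)%nat -> pos_poly n (Nat.iter j (rot1 n) c) -> pos_poly n c.
Proof.
  intros Hn Hj H. apply (iter_rot_pos_poly _ _ (n - j) Hn) in H. rewrite <- Nat.iter_add in H.
  replace (n - j + j)%nat with n in H by lia.
  eapply pos_poly_ext; [|exact H]. intros k Hk. rewrite iter_rot by assumption. now rewrite iter_next_full.
Qed.

(* The polygon left when the path c_0, ..., c_q is replaced by the diagonal c_0 c_q. *)
Definition outer (q : nat) (c : nat -> Cpt) (k : nat) : Cpt :=
  match k with O => c O | S j => c (q + j)%nat end.

(** The inner polygon c_0, ..., c_q has the diagonal as its closing edge, at infinity; the outer one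
    has it as edge 0, whose jump the cluster replaces. By telescoping, the diagonal is the sum of
    the q inner edges, as the gluing demands. *)
Lemma pos_poly_glue n q c : (2 <= q)%nat -> (q + 2 <= n)%nat ->
  pos_poly (S q) c -> pos_poly (n - q + 1) (outer q c) -> pos_poly n c.
Proof.
  intros Hq Hqn (y & Hy & HJy) (x & Hx & HJx).
  replace (S q - 1)%nat with q in * by lia.
  set (m2 := (n - q - 1)%nat).
  replace (n - q + 1 - 1)%nat with (S m2) in * by (unfold m2; lia).
  apply (jac_positive_translate _ _ _ (x 0%nat)) in HJx.
  set (z := fun k => x k - x 0%nat) in *.
  assert (Hz0 : z 0%nat = 0) by (unfold z; ring).
  assert (Hz : forall k, (k < m2)%nat -> 0 < z (S k)).
  { intros k Hk. unfold z. pose proof (increasing_lt _ _ Hx 0%nat (S k) ltac:(lia)). lra. }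
  destruct (jac_positive_glue q (edge_vec c) y m2 (edge_vec (outer q c)) z) as (eps0 & He0 & G); try assumption; try lia.
  { unfold edge_vec, outer, Csub. cbn [fst snd]. rewrite Nat.add_0_r.
    now rewrite (bsum_telescope (fun k => fst (c k))). }
  { unfold edge_vec, outer, Csub. cbn [fst snd]. rewrite Nat.add_0_r.
    now rewrite (bsum_telescope (fun k => snd (c k))). }
  assert (Hz1 : 0 < z 1%nat) by (apply Hz; unfold m2; lia).
  (* Besides the bound from the gluing, eps has to keep the whole cluster to the left of the next
     outer jump [z 1]. *)
  set (Y := Rabs (y (q - 1)%nat) + 1).
  assert (HY : 0 < Y) by (unfold Y; pose proof (Rabs_pos (y (q - 1)%nat)); lra).
  set (eps := Rmin (eps0 / 2) (z 1%nat / (2 * Y))).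
  assert (Heps : 0 < eps) by (apply Rmin_glb_lt; [lra|apply Rdiv_lt_0_compat; lra]).
  assert (Heps0 : eps < eps0) by (pose proof (Rmin_l (eps0 / 2) (z 1%nat / (2 * Y))); unfold eps; lra).
  assert (HepsY : eps * Y < z 1%nat).
  { apply Rle_lt_trans with (z 1%nat / (2 * Y) * Y); [apply Rmult_le_compat_r; [lra|apply Rmin_r]|].
    replace (z 1%nat / (2 * Y) * Y) with (z 1%nat / 2) by (field; lra). lra. }
  specialize (G eps (conj Heps Heps0)).
  exists (glued q (fun k => eps * y k) z). replace (n - 1)%nat with (q + m2)%nat by (unfold m2; lia). split.
  - intros k Hk. unfold glued. destruct (Nat.ltb_spec k q) as [H1|H1]; destruct (Nat.ltb_spec (S k) q) as [H2|H2]; try lia.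
    + specialize (Hy k H2). apply Rmult_lt_compat_l; lra.
    + replace (S k - q)%nat with 0%nat by lia. replace k with (q - 1)%nat by lia.
      eapply Rle_lt_trans; [|exact HepsY]. apply Rmult_le_compat_l; [lra|]. unfold Y.
      pose proof (Rle_abs (y (q - 1)%nat)). lra.
    + replace (S k - q)%nat with (S (k - q)) by lia. unfold z. specialize (Hx (S (k - q)) ltac:(lia)). lra.
  - eapply jac_positive_ext; [|reflexivity|exact G]. intros k Hk. unfold glued.
    destruct (Nat.ltb_spec k q) as [H1|H1]; [reflexivity|].
    unfold edge_vec, outer. replace (q + S (k - q))%nat with (S k) by lia. replace (q + (k - q))%nat with k by lia. reflexivity.
Qed.

(** The edges allowed at each end are named because the Jordan property of the two parts asks which
    edges share which vertex. The diagonal may run inside or outside; the orientation of the parts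
    is controlled by other means. *)
Definition diagonal_free (n q : nat) (c : nat -> Cpt) : Prop :=
  forall i z, (i < n)%nat -> on_seg (c i) (c (next n i)) z -> on_seg (c 0%nat) (c q) z ->
    (z = c 0%nat /\ (i = 0 \/ S i = n)%nat) \/ (z = c q /\ (i = q \/ S i = q)%nat).

Lemma seg_sym a b z : on_seg a b z -> on_seg b a z.
Proof.
  intros (s & Hs & ->). exists (1 - s). split; [lra|].
  unfold Cadd, Cscale, Csub. apply Cpt_eq; cbn [fst snd]; ring.
Qed.

Lemma inner_jordan n q c : (2 <= q)%nat -> (q + 2 <= n)%nat -> jordan_polygon n c -> diagonal_free n q c ->
  jordan_polygon (S q) c.
Proof.
  intros Hq Hqn HJ HDg i j z Hi Hj Hij H1 H2.
  assert (NX : forall k, (k < q)%nat -> next (S q) k = S k /\ next n k = S k) by (intros; split; apply next_lt; lia).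
  assert (NQ : next (S q) q = 0%nat) by apply next_last.
  destruct (Nat.eq_dec i q) as [->|Hiq]; destruct (Nat.eq_dec j q) as [->|Hjq]; try lia.
  - rewrite NQ in H1. apply seg_sym in H1. destruct (NX j ltac:(lia)) as (N1 & N2). rewrite N1 in H2.
    rewrite <- N2 in H2. rewrite NQ, N1.
    destruct (HDg j z ltac:(lia) H2 H1) as [(E & Hc)|(E & Hc)].
    + left. split; [lia|]. rewrite E. f_equal. lia.
    + right. split; [lia|exact E].
  - rewrite NQ in H2. apply seg_sym in H2. destruct (NX i ltac:(lia)) as (N1 & N2). rewrite N1 in H1.
    rewrite <- N2 in H1. rewrite NQ, N1.
    destruct (HDg i z ltac:(lia) H1 H2) as [(E & Hc)|(E & Hc)].
    + right. split; [lia|]. rewrite E. f_equal. lia.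
    + left. split; [lia|exact E].
  - destruct (NX i ltac:(lia)) as (N1 & N2). destruct (NX j ltac:(lia)) as (N3 & N4).
    rewrite N1 in *. rewrite N3 in *. rewrite <- N2 in H1. rewrite <- N4 in H2.
    destruct (HJ i j z ltac:(lia) ltac:(lia) Hij H1 H2) as [(E & E2)|(E & E2)]; [left|right]; split; try assumption; lia.
Qed.

Lemma outer_edge n q c k : (2 <= q)%nat -> (q + 2 <= n)%nat -> (k < n - q)%nat ->
  outer q c (next (n - q + 1) (S k)) = c (next n (q + k)%nat).
Proof.
  intros Hq Hqn Hk.
  destruct (next_cases (n - q + 1) (S k) ltac:(lia)) as [(L & E)|(L & E)];
  destruct (next_cases n (q + k) ltac:(lia)) as [(L2 & E2)|(L2 & E2)]; try lia; rewrite E, E2.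
  - unfold outer. f_equal. lia.
  - reflexivity.
Qed.

Lemma outer_edge0 n q c : (2 <= q)%nat -> (q + 2 <= n)%nat -> outer q c (next (n - q + 1) 0) = c q.
Proof. intros Hq Hqn. rewrite next_lt by lia. unfold outer. now rewrite Nat.add_0_r. Qed.

Lemma outer_jordan n q c : (2 <= q)%nat -> (q + 2 <= n)%nat -> jordan_polygon n c -> diagonal_free n q c ->
  jordan_polygon (n - q + 1) (outer q c).
Proof.
  intros Hq Hqn HJ HDg.
  assert (A : forall j z, (j < n - q)%nat -> on_seg (c 0%nat) (c q) z -> on_seg (c (q + j)%nat) (c (next n (q + j))) z ->
     (z = c q /\ j = 0%nat) \/ (z = c 0%nat /\ S j = (n - q)%nat)).
  { intros j z Hj H1 H2. destruct (HDg (q + j)%nat z ltac:(lia) H2 H1) as [(E & Hc)|(E & Hc)].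
    - right. split; [assumption|lia].
    - left. split; [assumption|lia]. }
  assert (NX : forall k, (k < n - q)%nat -> (S k < n - q /\ next (n - q + 1) (S k) = S (S k))%nat \/ (S k = n - q /\ next (n - q + 1) (S k) = 0)%nat).
  { intros k Hk. destruct (next_cases (n - q + 1) (S k) ltac:(lia)); lia. }
  assert (N0 : next (n - q + 1) 0 = 1%nat) by (apply next_lt; lia).
  intros i j z Hi Hj Hij H1 H2.
  destruct i as [|i]; destruct j as [|j]; try lia.
  - rewrite outer_edge0 in H1 by lia. rewrite outer_edge in H2 by lia. cbn [outer] in H1, H2 |- *.
    destruct (A j z ltac:(lia) H1 H2) as [(E & ->)|(E & Hc)].
    + left. split; [lia|]. now rewrite Nat.add_0_r.
    + right. split; [|assumption]. destruct (NX j ltac:(lia)); lia.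
  - rewrite outer_edge0 in H2 by lia. rewrite outer_edge in H1 by lia. cbn [outer] in H1, H2 |- *.
    destruct (A i z ltac:(lia) H2 H1) as [(E & ->)|(E & Hc)].
    + right. split; [lia|]. now rewrite Nat.add_0_r.
    + left. split; [|assumption]. destruct (NX i ltac:(lia)); lia.
  - rewrite outer_edge in H1 by lia. rewrite outer_edge in H2 by lia. cbn [outer] in H1, H2 |- *.
    destruct (HJ (q + i)%nat (q + j)%nat z ltac:(lia) ltac:(lia) ltac:(lia) H1 H2) as [(E & E2)|(E & E2)].
    + left. split; [|assumption]. destruct (NX i ltac:(lia)); destruct (next_cases n (q + i) ltac:(lia)); lia.
    + right. split; [|assumption]. destruct (NX j ltac:(lia)); destruct (next_cases n (q + j) ltac:(lia)); lia.
Qed.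

Lemma inner_distinct n q c : (q < n)%nat -> distinct_vertices n c -> distinct_vertices (S q) c.
Proof. intros Hq HD i j Hi Hj. apply HD; lia. Qed.

Lemma outer_distinct n q c : (2 <= q)%nat -> (q + 2 <= n)%nat -> distinct_vertices n c -> distinct_vertices (n - q + 1) (outer q c).
Proof.
  intros Hq Hqn HD i j Hi Hj Hij. destruct i as [|i]; destruct j as [|j]; cbn [outer]; try lia; apply HD; lia.
Qed.

(** * Triangles cut off by two consecutive edges *)

Lemma side_cycle a b z : side a b z = side b z a.
Proof. unfold side, cross, Csub. cbn [fst snd]. ring. Qed.

Lemma side_swap a b z : side b a z = - side a b z.
Proof. unfold side, cross, Csub. cbn [fst snd]. ring. Qed.

Lemma side_left a b : side a b a = 0.
Proof. unfold side, cross, Csub. cbn [fst snd]. ring. Qed.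

Lemma side_right a b : side a b b = 0.
Proof. unfold side, cross, Csub. cbn [fst snd]. ring. Qed.

Lemma side_sum u v w z : side u v z + side v w z + side w u z = side u v w.
Proof. unfold side, cross, Csub. cbn [fst snd]. ring. Qed.

Lemma side_seg a b z : on_seg a b z -> side a b z = 0.
Proof. intros (s & _ & ->). unfold side, cross, Cadd, Cscale, Csub. cbn [fst snd]. ring. Qed.

(** [side v w z], [side w u z] and [side u v z] are the barycentric coordinates of z, up to the
    factor [side u v w]. *)
Lemma on_seg_of_sides u v w z : 0 < side u v w -> side u v z = 0 -> 0 <= side v w z -> 0 <= side w u z ->
  on_seg u v z.
Proof.
  intros HS H1 H2 H3. pose proof (side_sum u v w z) as Hsum.
  exists (side w u z / side u v w). split.
  - split; [apply Rdiv_le_0_compat; lra|]. apply Rle_div_l; lra.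
  - assert (E1 : side u v w * fst z = side v w z * fst u + side w u z * fst v + side u v z * fst w)
      by (unfold side, cross, Csub; cbn [fst snd]; ring).
    assert (E2 : side u v w * snd z = side v w z * snd u + side w u z * snd v + side u v z * snd w)
      by (unfold side, cross, Csub; cbn [fst snd]; ring).
    rewrite H1 in E1, E2. replace (side v w z) with (side u v w - side w u z) in E1, E2 by lra.
    unfold Cadd, Cscale, Csub. apply Cpt_eq; cbn [fst snd]; apply (Rmult_eq_reg_l (side u v w)); try lra.
    + rewrite E1. field. lra.
    + rewrite E2. field. lra.
Qed.

Definition in_triangle (u v w z : Cpt) : Prop := 0 <= side u v z /\ 0 <= side v w z /\ 0 <= side w u z.

Lemma on_seg_trans a b m E P : on_seg a b m -> on_seg a b E -> on_seg m E P -> on_seg a b P.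
Proof.
  intros (s & Hs & ->) (t & Ht & ->) (r & Hr & ->).
  exists (s + r * (t - s)). split.
  - split; nra.
  - unfold Cadd, Cscale, Csub. apply Cpt_eq; cbn [fst snd]; ring.
Qed.

(** On the way from m to E the distance to the line wu does not fall below that of m, so the
    triangle can be left only through uv or vw. *)
Lemma triangle_exit u v w m E : 0 < side u v w ->
  0 < side u v m -> 0 < side v w m -> 0 < side w u m -> side w u m <= side w u E ->
  in_triangle u v w E \/ exists P, on_seg m E P /\ 0 < side w u P /\ (on_seg u v P \/ on_seg v w P).
Proof.
  intros HS H1 H2 H3 H4.
  set (pt := fun t => Cadd m (Cscale t (Csub E m))).
  assert (L : forall a b t, side a b (pt t) = (1 - t) * side a b m + t * side a b E)
    by (intros; apply side_convex).
  destruct (Rle_dec 0 (side u v E)) as [X1|X1]; destruct (Rle_dec 0 (side v w E)) as [X2|X2].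
  - left. unfold in_triangle. lra.
  - right. set (t := side v w m / (side v w m - side v w E)).
    assert (Ht : 0 < t < 1) by (unfold t; split; [apply Rdiv_lt_0_compat; lra|apply Rlt_div_l; lra]).
    assert (Z : side v w (pt t) = 0) by (rewrite L; unfold t; field; lra).
    exists (pt t). split; [exists t; split; [lra|reflexivity]|]. split; [rewrite L; nra|]. right.
    apply (on_seg_of_sides v w u); [now rewrite <- side_cycle|assumption| |]; rewrite L; nra.
  - right. set (t := side u v m / (side u v m - side u v E)).
    assert (Ht : 0 < t < 1) by (unfold t; split; [apply Rdiv_lt_0_compat; lra|apply Rlt_div_l; lra]).
    assert (Z : side u v (pt t) = 0) by (rewrite L; unfold t; field; lra).
    exists (pt t). split; [exists t; split; [lra|reflexivity]|]. split; [rewrite L; nra|]. left.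
    apply (on_seg_of_sides u v w); [assumption|assumption| |]; rewrite L; nra.
  (* Both lines are crossed, and the earlier crossing is the exit point. *)
  - right. apply Rnot_le_lt in X1. apply Rnot_le_lt in X2.
    set (t1 := side u v m / (side u v m - side u v E)).
    set (t2 := side v w m / (side v w m - side v w E)).
    assert (Ht1 : 0 < t1 < 1) by (unfold t1; split; [apply Rdiv_lt_0_compat; lra|apply Rlt_div_l; lra]).
    assert (Ht2 : 0 < t2 < 1) by (unfold t2; split; [apply Rdiv_lt_0_compat; lra|apply Rlt_div_l; lra]).
    assert (Z1 : side u v (pt t1) = 0) by (rewrite L; unfold t1; field; lra).
    assert (Z2 : side v w (pt t2) = 0) by (rewrite L; unfold t2; field; lra).
    destruct (Rle_dec t1 t2) as [Hle|Hle].
    + exists (pt t1). split; [exists t1; split; [lra|reflexivity]|]. split; [rewrite L; nra|]. left.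
      apply (on_seg_of_sides u v w); [assumption|assumption| |]; [|rewrite L; nra].
      rewrite L in Z2 |- *. nra.
    + exists (pt t2). split; [exists t2; split; [lra|reflexivity]|]. split; [rewrite L; nra|]. right.
      apply (on_seg_of_sides v w u); [now rewrite <- side_cycle|assumption| |]; [rewrite L; nra|].
      rewrite L in Z1 |- *. nra.
Qed.

Lemma vertex_on_edge n c i k : jordan_polygon n c -> distinct_vertices n c -> (i < n)%nat -> (k < n)%nat ->
  on_seg (c i) (c (next n i)) (c k) -> i = k \/ next n i = k.
Proof.
  intros HJ HD Hi Hk Hon. destruct (Nat.eq_dec i k) as [->|Hne]; [now left|right].
  assert (Hk2 : on_seg (c k) (c (next n k)) (c k)).
  { exists 0. split; [lra|]. unfold Cadd, Cscale. apply Cpt_eq; cbn [fst snd]; ring. }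
  destruct (HJ i k _ Hi Hk Hne Hon Hk2) as [(E & _)|(E & E2)]; [now symmetry|].
  exfalso. apply (HD i k); auto.
Qed.

(** Take the end of the edge that is at least as far from the line c_2 c_0 as m. On the way to it
    the edge cannot leave the triangle, as it would have to cross edge 0 or edge 1. *)
Lemma triangle_entering_edge n c j m : (3 <= n)%nat -> jordan_polygon n c -> distinct_vertices n c ->
  0 < side (c 0%nat) (c 1%nat) (c 2%nat) -> (2 <= j < n)%nat -> on_seg (c j) (c (next n j)) m ->
  0 < side (c 0%nat) (c 1%nat) m -> 0 < side (c 1%nat) (c 2%nat) m -> 0 < side (c 2%nat) (c 0%nat) m ->
  exists i, (3 <= i < n)%nat /\ in_triangle (c 0%nat) (c 1%nat) (c 2%nat) (c i) /\
    side (c 2%nat) (c 0%nat) m <= side (c 2%nat) (c 0%nat) (c i).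
Proof.
  intros Hn HJ HD HS Hj Hm H1 H2 H3.
  set (u := c 0%nat) in *. set (v := c 1%nat) in *. set (w := c 2%nat) in *.
  assert (N0 : next n 0 = 1%nat) by (apply next_lt; lia).
  assert (N1 : next n 1 = 2%nat) by (apply next_lt; lia).
  assert (Hend : exists i, (i = j \/ i = next n j) /\ side w u m <= side w u (c i)).
  { destruct Hm as (s & Hs & ->). rewrite side_convex.
    destruct (Rle_dec (side w u (c j)) (side w u (c (next n j)))).
    - exists (next n j). split; [now right|nra].
    - exists j. split; [now left|nra]. }
  destruct Hend as (i & Hi & Hle).
  assert (Hin : (i < n)%nat) by (destruct Hi as [-> | ->]; [lia|apply next_bound; lia]).
  assert (HE : on_seg (c j) (c (next n j)) (c i)).
  { destruct Hi as [-> | ->].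
    - exists 0. split; [lra|]. unfold Cadd, Cscale. apply Cpt_eq; cbn [fst snd]; ring.
    - exists 1. split; [lra|]. unfold Cadd, Cscale, Csub. apply Cpt_eq; cbn [fst snd]; ring. }
  destruct (triangle_exit u v w m (c i) HS H1 H2 H3 Hle) as [Htri|(P & HP & HP2 & HP3)].
  - exists i. split; [|now split]. split; [|assumption].
    destruct i as [|[|[|i]]]; try lia.
    + fold u in Hle. rewrite side_right in Hle. lra.
    + destruct Hi as [Hi|Hi]; [lia|]. destruct (next_cases n j ltac:(lia)); lia.
    + fold w in Hle. rewrite side_left in Hle. lra.
  - exfalso. pose proof (on_seg_trans _ _ _ _ _ Hm HE HP) as HPj.
    destruct HP3 as [HP3|HP3].
    + destruct (HJ j 0%nat P ltac:(lia) ltac:(lia) ltac:(lia) HPj) as [(_ & ->)|(E & _)].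
      * now rewrite N0.
      * fold u in HP2. rewrite side_right in HP2. lra.
      * lia.
    + destruct (HJ j 1%nat P ltac:(lia) ltac:(lia) ltac:(lia) HPj) as [(E & _)|(E & ->)].
      * now rewrite N1.
      * destruct (next_cases n j ltac:(lia)); lia.
      * replace (c j) with w in HP2 by (unfold w; f_equal; lia). rewrite side_left in HP2. lra.
Qed.

Lemma finite_argmax (P : nat -> Prop) (f : nat -> R) n : (exists i, (i < n)%nat /\ P i) ->
  exists i, (i < n)%nat /\ P i /\ forall j, (j < n)%nat -> P j -> f j <= f i.
Proof.
  induction n as [|n IH]; intros (i & Hi & HPi); [lia|].
  destruct (classic (exists i, (i < n)%nat /\ P i)) as [Hex|Hex].
  - destruct (IH Hex) as (k & Hk & HPk & Hmax).
    destruct (classic (P n /\ f k <= f n)) as [(HPn & Hle)|Hno].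
    + exists n. split; [lia|]. split; [assumption|]. intros j Hj HPj.
      destruct (Nat.eq_dec j n) as [->|]; [lra|]. specialize (Hmax j ltac:(lia) HPj). lra.
    + exists k. split; [lia|]. split; [assumption|]. intros j Hj HPj.
      destruct (Nat.eq_dec j n) as [->|]; [|apply Hmax; [lia|assumption]].
      apply Rnot_lt_le. intros Hlt. apply Hno. split; [assumption|lra].
  - assert (i = n) as -> by (destruct (Nat.eq_dec i n); [assumption|exfalso; apply Hex; exists i; split; [lia|assumption]]).
    exists n. split; [lia|]. split; [assumption|]. intros j Hj HPj.
    destruct (Nat.eq_dec j n) as [->|]; [lra|]. exfalso. apply Hex. exists j. split; [lia|assumption].
Qed.

(** An edge through an end of the diagonal is incident to that vertex, so only the open diagonal
    remains to be checked. *)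
Lemma diagonal_at_vertex n c q : (2 <= q)%nat -> (q < n)%nat -> jordan_polygon n c -> distinct_vertices n c ->
  (forall i t, (i < n)%nat -> 0 < t < 1 ->
     ~ on_seg (c i) (c (next n i)) (Cadd (c 0%nat) (Cscale t (Csub (c q) (c 0%nat))))) ->
  diagonal_free n q c.
Proof.
  intros Hq Hqn HJ HD H i z Hi H1 (t & Ht & Ez).
  destruct (Req_dec t 0) as [T0|T0]; [|destruct (Req_dec t 1) as [T1|T1]].
  - assert (E : z = c 0%nat) by (rewrite Ez, T0; unfold Cadd, Cscale; apply Cpt_eq; cbn [fst snd]; ring).
    left. split; [assumption|]. rewrite E in H1.
    destruct (vertex_on_edge n c i 0 HJ HD Hi ltac:(lia) H1) as [->|E2]; [now left|].
    right. destruct (next_cases n i Hi); lia.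
  - assert (E : z = c q) by (rewrite Ez, T1; unfold Cadd, Cscale, Csub; apply Cpt_eq; cbn [fst snd]; ring).
    right. split; [assumption|]. rewrite E in H1.
    destruct (vertex_on_edge n c i q HJ HD Hi ltac:(lia) H1) as [->|E2]; [now left|].
    right. destruct (next_cases n i Hi); lia.
  - exfalso. apply (H i t Hi); [lra|]. now rewrite <- Ez.
Qed.

(** An edge meeting the open diagonal either enters the triangle, and then brings a vertex into it,
    or lies along the line of the diagonal. In the second case its ends are not in the open
    diagonal, so it covers c_0 and c_2, which are not neighbours when n >= 4. *)
Lemma ear_diagonal n c : (4 <= n)%nat -> jordan_polygon n c -> distinct_vertices n c ->
  0 < side (c 0%nat) (c 1%nat) (c 2%nat) ->
  (forall i, (3 <= i < n)%nat -> ~ in_triangle (c 0%nat) (c 1%nat) (c 2%nat) (c i)) ->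
  diagonal_free n 2 c.
Proof.
  intros Hn HJ HD HS Hclean. apply diagonal_at_vertex; try assumption; try lia.
  set (u := c 0%nat) in *. set (v := c 1%nat) in *. set (w := c 2%nat) in *.
  intros i t Hi Ht Hon. set (m := Cadd u (Cscale t (Csub w u))) in *.
  assert (N0 : next n 0 = 1%nat) by (apply next_lt; lia).
  assert (N1 : next n 1 = 2%nat) by (apply next_lt; lia).
  assert (L1 : side u v m = t * side u v w) by (unfold m; rewrite side_convex, side_left; ring).
  assert (L2 : side v w m = (1 - t) * side u v w).
  { unfold m. rewrite side_convex, side_right, (side_cycle u v w). ring. }
  assert (L3 : side w u m = 0) by (unfold m; rewrite side_convex, side_left, side_right; ring).
  assert (P1 : 0 < side u v m) by (rewrite L1; nra). assert (P2 : 0 < side v w m) by (rewrite L2; nra).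
  destruct (Nat.eq_dec i 0) as [->|I0].
  { rewrite N0 in Hon. apply side_seg in Hon. fold u v in Hon. lra. }
  destruct (Nat.eq_dec i 1) as [->|I1].
  { rewrite N1 in Hon. apply side_seg in Hon. fold w v in Hon. lra. }
  assert (Hclean2 : forall k, (k < n)%nat -> (2 <= k \/ k = 0)%nat -> in_triangle u v w (c k) -> c k = u \/ c k = w).
  { intros k Hk Hk2 Htri. destruct Hk2 as [Hk2| ->]; [|now left].
    destruct (Nat.eq_dec k 2) as [->|K2]; [now right|]. exfalso. apply (Hclean k); [lia|assumption]. }
  assert (Hnext : (next n i < n)%nat /\ (2 <= next n i \/ next n i = 0)%nat) by (destruct (next_cases n i Hi); lia).
  set (a := c i) in *. set (b := c (next n i)) in *.
  assert (Ha : in_triangle u v w a -> a = u \/ a = w) by (apply Hclean2; lia).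
  assert (Hb : in_triangle u v w b -> b = u \/ b = w) by (apply Hclean2; lia).
  destruct Hon as (s & Hs & Em).
  assert (Lab : forall x y, side x y m = (1 - s) * side x y a + s * side x y b) by (intros; rewrite Em; apply side_convex).
  (* an endpoint strictly above the line w u gives a point of the edge inside the triangle *)
  assert (ABOVE : forall E, on_seg a b E -> 0 < side w u E -> False).
  { intros E HE HpE.
    set (K := 2 * (Rabs (side u v E) + Rabs (side v w E) + side u v m + side v w m + 1)).
    pose proof (Rabs_pos (side u v E)). pose proof (Rabs_pos (side v w E)).
    set (d := Rmin (1 / 2) (Rmin (side u v m / K) (side v w m / K))).
    assert (HK : 0 < K) by (unfold K; lra).
    assert (Hd : 0 < d) by (repeat apply Rmin_glb_lt; [lra| |]; apply Rdiv_lt_0_compat; lra).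
    assert (Hd1 : d <= 1 / 2) by apply Rmin_l.
    assert (Hd2 : d * K <= side u v m).
    { apply Rle_trans with (side u v m / K * K); [|right; field; lra]. apply Rmult_le_compat_r; [lra|].
      eapply Rle_trans; [apply Rmin_r|apply Rmin_l]. }
    assert (Hd3 : d * K <= side v w m).
    { apply Rle_trans with (side v w m / K * K); [|right; field; lra]. apply Rmult_le_compat_r; [lra|].
      eapply Rle_trans; [apply Rmin_r|apply Rmin_r]. }
    set (m' := Cadd m (Cscale d (Csub E m))).
    assert (Hm' : on_seg a b m').
    { apply (on_seg_trans a b m E); [exists s; now split|assumption|exists d; split; [lra|reflexivity]]. }
    assert (B : forall e f, 0 < e -> Rabs f <= Rabs (side u v E) + Rabs (side v w E) -> e <= side u v m + side v w m -> d * K <= e -> 0 < (1 - d) * e + d * f).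
    { intros e f He Hf Hee Hde. apply Rabs_le_between in Hf. unfold K in Hde. nra. }
    destruct (triangle_entering_edge n c i m' ltac:(lia) HJ HD HS ltac:(lia) Hm') as (k & Hk & Htri & _).
    - fold u v. unfold m'. rewrite side_convex. apply B; lra.
    - fold v w. unfold m'. rewrite side_convex. apply B; lra.
    - fold w u. unfold m'. rewrite side_convex, L3. nra.
    - exact (Hclean k Hk Htri). }
  assert (Oa : on_seg a b a) by (exists 0; split; [lra|unfold Cadd, Cscale; apply Cpt_eq; cbn [fst snd]; ring]).
  assert (Ob : on_seg a b b) by (exists 1; split; [lra|unfold Cadd, Cscale, Csub; apply Cpt_eq; cbn [fst snd]; ring]).
  assert (Sa : side w u a <= 0) by (apply Rnot_lt_le; intros Hlt; exact (ABOVE a Oa Hlt)).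
  assert (Sb : side w u b <= 0) by (apply Rnot_lt_le; intros Hlt; exact (ABOVE b Ob Hlt)).
  pose proof (Lab w u) as L4. rewrite L3 in L4.
  pose proof (Lab u v) as M1. pose proof (Lab v w) as M2.
  assert (NOTM : m <> u /\ m <> w).
  { split; intros E; rewrite E in *; [rewrite side_left in P1|rewrite side_right in P2]; lra. }
  destruct NOTM as (NU & NW).
  destruct (Req_dec s 0) as [S0|S0].
  { assert (m = a) by (rewrite Em, S0; unfold Cadd, Cscale; apply Cpt_eq; cbn [fst snd]; ring).
    destruct Ha; try congruence. replace a with m by assumption. unfold in_triangle. lra. }
  destruct (Req_dec s 1) as [S1|S1].
  { assert (m = b) by (rewrite Em, S1; unfold Cadd, Cscale, Csub; apply Cpt_eq; cbn [fst snd]; ring).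
    destruct Hb; try congruence. replace b with m by assumption. unfold in_triangle. lra. }
  (* Neither end is above the line, and m, strictly between them, is on it; so the edge lies along
     the line. *)
  assert (Za : side w u a = 0) by nra. assert (Zb : side w u b = 0) by nra.
  pose proof (side_left u v). pose proof (side_right v w).
  assert (POS : forall z, side w u z = 0 -> (in_triangle u v w z -> z = u \/ z = w) -> side u v z <= 0 \/ side v w z <= 0).
  { intros z Hz Hz2. destruct (Rle_dec (side u v z) 0); [now left|]. destruct (Rle_dec (side v w z) 0); [now right|].
    exfalso. destruct Hz2 as [->| ->]; [unfold in_triangle; lra| |]; lra. }
  assert (COV : forall z, side w u z = 0 -> side u v z <= 0 \/ side v w z <= 0 -> side u v z <= 0 \/ side u v w <= side u v z).
  { intros z Hz [Hz2|Hz2]; [now left|right]. pose proof (side_sum u v w z). lra. }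
  assert (ONLINE : forall z, side w u z = 0 -> exists t', z = Cadd u (Cscale t' (Csub w u)) /\ side u v z = t' * side u v w).
  { intros z Hz. exists (side u v z / side u v w). split; [|field; lra].
    pose proof (side_sum u v w z) as Hsum.
    assert (E1 : side u v w * fst z = side v w z * fst u + side w u z * fst v + side u v z * fst w)
      by (unfold side, cross, Csub; cbn [fst snd]; ring).
    assert (E2 : side u v w * snd z = side v w z * snd u + side w u z * snd v + side u v z * snd w)
      by (unfold side, cross, Csub; cbn [fst snd]; ring).
    rewrite Hz in E1, E2. replace (side v w z) with (side u v w - side u v z) in E1, E2 by lra.
    unfold Cadd, Cscale, Csub. apply Cpt_eq; cbn [fst snd]; apply (Rmult_eq_reg_l (side u v w)); try lra.
    - rewrite E1. field. lra.
    - rewrite E2. field. lra. }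
  destruct (ONLINE a Za) as (ta & Ea & Eta). destruct (ONLINE b Zb) as (tb & Eb & Etb).
  assert (Tm : t = (1 - s) * ta + s * tb).
  { apply (Rmult_eq_reg_r (side u v w)); [|lra]. rewrite <- L1, M1, Eta, Etb. ring. }
  assert (Ta : ta <= 0 \/ 1 <= ta).
  { destruct (COV a Za (POS a Za Ha)) as [Q|Q]; rewrite Eta in Q; [left|right]; nra. }
  assert (Tb : tb <= 0 \/ 1 <= tb).
  { destruct (COV b Zb (POS b Zb Hb)) as [Q|Q]; rewrite Etb in Q; [left|right]; nra. }
  assert (Both : (ta <= 0 /\ 1 <= tb) \/ (1 <= ta /\ tb <= 0)) by (destruct Ta, Tb; try (left; lra); try (right; lra); exfalso; nra).
  assert (Hab : tb - ta <> 0) by lra.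
  assert (PT : forall r, 0 <= r <= 1 -> on_seg a b (Cadd u (Cscale r (Csub w u)))).
  { intros r Hr. exists ((r - ta) / (tb - ta)). split.
    - destruct Both as [(B1 & B2)|(B1 & B2)].
      + split; [apply Rdiv_le_0_compat; lra|apply Rle_div_l; lra].
      + replace ((r - ta) / (tb - ta)) with ((ta - r) / (ta - tb)) by (field; lra).
        split; [apply Rdiv_le_0_compat; lra|apply Rle_div_l; lra].
    - rewrite Ea, Eb. unfold Cadd, Cscale, Csub. apply Cpt_eq; cbn [fst snd]; field; lra. }
  assert (Ou : on_seg a b u).
  { replace u with (Cadd u (Cscale 0 (Csub w u))) by (unfold Cadd, Cscale; apply Cpt_eq; cbn [fst snd]; ring). apply PT. lra. }
  assert (Ow : on_seg a b w).
  { replace w with (Cadd u (Cscale 1 (Csub w u))) by (unfold Cadd, Cscale, Csub; apply Cpt_eq; cbn [fst snd]; ring). apply PT. lra. }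
  destruct (vertex_on_edge n c i 0 HJ HD Hi ltac:(lia) Ou) as [E|E]; [lia|].
  destruct (vertex_on_edge n c i 2 HJ HD Hi ltac:(lia) Ow) as [E2|E2]; [|lia].
  subst i. rewrite next_lt in E by lia. lia.
Qed.

(* The vertex of the triangle farthest from the side c_0 c_2 is seen from c_1. *)
Lemma farthest_diagonal n c q : (4 <= n)%nat -> jordan_polygon n c -> distinct_vertices n c ->
  0 < side (c 0%nat) (c 1%nat) (c 2%nat) -> (3 <= q < n)%nat ->
  in_triangle (c 0%nat) (c 1%nat) (c 2%nat) (c q) ->
  (forall i, (3 <= i < n)%nat -> in_triangle (c 0%nat) (c 1%nat) (c 2%nat) (c i) ->
     side (c 2%nat) (c 0%nat) (c i) <= side (c 2%nat) (c 0%nat) (c q)) ->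
  0 < side (c 0%nat) (c 1%nat) (c q) /\ 0 < side (c 1%nat) (c 2%nat) (c q) /\
  diagonal_free n (q - 1) (rot1 n c).
Proof.
  intros Hn HJ HD HS Hq (T1 & T2 & T3) Hmax.
  assert (N0 : next n 0 = 1%nat) by (apply next_lt; lia).
  assert (N1 : next n 1 = 2%nat) by (apply next_lt; lia).
  assert (P1 : 0 < side (c 0%nat) (c 1%nat) (c q)).
  { destruct (Rle_lt_or_eq_dec _ _ T1) as [H|H]; [assumption|exfalso].
    assert (Hon : on_seg (c 0%nat) (c (next n 0)) (c q)) by (rewrite N0; now apply (on_seg_of_sides _ _ (c 2%nat))).
    destruct (vertex_on_edge n c 0 q HJ HD ltac:(lia) ltac:(lia) Hon); lia. }
  assert (P2 : 0 < side (c 1%nat) (c 2%nat) (c q)).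
  { destruct (Rle_lt_or_eq_dec _ _ T2) as [H|H]; [assumption|exfalso].
    assert (Hon : on_seg (c 1%nat) (c (next n 1)) (c q)).
    { rewrite N1. apply (on_seg_of_sides _ _ (c 0%nat)); try assumption; [now rewrite <- side_cycle|now symmetry]. }
    destruct (vertex_on_edge n c 1 q HJ HD ltac:(lia) ltac:(lia) Hon); lia. }
  split; [assumption|]. split; [assumption|].
  apply diagonal_at_vertex; try lia; [now apply rot1_jordan|now apply rot1_distinct|].
  intros i t Hi Ht Hon.
  assert (R0 : rot1 n c 0 = c 1%nat) by (unfold rot1; now rewrite N0).
  assert (Rq : rot1 n c (q - 1) = c q) by (unfold rot1; rewrite next_lt by lia; f_equal; lia).
  rewrite R0, Rq in Hon. unfold rot1 in Hon.
  set (j := next n i) in *. assert (Hj : (j < n)%nat) by (apply next_bound; lia).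
  set (u := c 0%nat) in *. set (v := c 1%nat) in *. set (w := c 2%nat) in *.
  set (m := Cadd v (Cscale t (Csub (c q) v))) in *.
  assert (M1 : side u v m = t * side u v (c q)) by (unfold m; rewrite side_convex, side_right; ring).
  assert (M2 : side v w m = t * side v w (c q)) by (unfold m; rewrite side_convex, side_left; ring).
  assert (M3 : side w u m = (1 - t) * side u v w + t * side w u (c q)).
  { unfold m. rewrite side_convex. rewrite (side_cycle w u v). ring. }
  pose proof (side_sum u v w (c q)) as Hsum.
  assert (G1 : 0 < side u v m) by (rewrite M1; nra).
  assert (G2 : 0 < side v w m) by (rewrite M2; nra).
  assert (G3 : side w u (c q) < side w u m) by (rewrite M3; nra).
  destruct (Nat.eq_dec j 0) as [J0|J0].
  { rewrite J0, N0 in Hon. apply side_seg in Hon. fold u v in Hon. lra. }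
  destruct (Nat.eq_dec j 1) as [J1|J1].
  { rewrite J1, N1 in Hon. apply side_seg in Hon. fold v w in Hon. lra. }
  (* The point m of the open segment from c_1 to c_q is strictly farther from the line c_2 c_0 than
     c_q. An edge through it would produce a vertex in the triangle at least as far as m, against
     the choice of c_q. *)
  destruct (triangle_entering_edge n c j m ltac:(lia) HJ HD HS ltac:(lia) Hon G1 G2 ltac:(fold w u; lra)) as (k & Hk & Htri & Hle).
  specialize (Hmax k Hk Htri). fold w u in Hle. lra.
Qed.

(** * The Poisson integral of a step function *)

(** Real and imaginary part of i (1 + z) / (1 - z). This sends exp(it) to -cot(t/2), and 1, the
    point where the sequence of arcs begins and ends, to infinity. *)
Definition cayley_x (z : Cpt) : R := - 2 * snd z / ((1 - fst z) * (1 - fst z) + snd z * snd z).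
Definition cayley_y (z : Cpt) : R := (1 - Cnorm2 z) / ((1 - fst z) * (1 - fst z) + snd z * snd z).

Lemma Defs_RInt_eq f a b l : is_RInt f a b l -> Defs.RInt f a b = l.
Proof.
  intros H. assert (ex : ex_RInt f a b) by now exists l.
  unfold Defs.RInt. destruct (excluded_middle_informative _) as [Hi|Hi].
  - rewrite <- RInt_Reals. now apply is_RInt_unique.
  - exfalso. apply Hi. constructor. now apply ex_RInt_Reals_0.
Qed.

Lemma disk_facts z : in_unit_disk z -> -1 < fst z < 1 /\ 0 < (1 - fst z) * (1 - fst z) + snd z * snd z.
Proof.
  unfold in_unit_disk, Cnorm2. intros H. pose proof (mul_self_ge0 (snd z)).
  assert (-1 < fst z < 1) by (split; nra). split; [assumption|]. nra.
Qed.

Lemma cayley_y_pos z : in_unit_disk z -> 0 < cayley_y z.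
Proof.
  intros H. destruct (disk_facts z H). unfold cayley_y. apply Rdiv_lt_0_compat; [unfold in_unit_disk in H; lra|assumption].
Qed.

Lemma poisson_den_pos z t : in_unit_disk z ->
  0 < (cos t - fst z) * (cos t - fst z) + (sin t - snd z) * (sin t - snd z).
Proof.
  intros H. unfold in_unit_disk, Cnorm2 in H.
  pose proof (mul_self_ge0 (cos t - fst z)) as P1. pose proof (mul_self_ge0 (sin t - snd z)) as P2.
  pose proof (sin2_cos2 t) as SC. unfold Rsqr in SC.
  apply Rnot_le_lt. intros Hle.
  assert (E1 : cos t - fst z = 0) by nra. assert (E2 : sin t - snd z = 0) by nra.
  replace (fst z) with (cos t) in H by lra. replace (snd z) with (sin t) in H by lra. lra.
Qed.

Lemma poisson_continuous z t : in_unit_disk z -> continuous (poisson_kernel z) t.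
Proof.
  intros H. apply continuity_pt_filterlim. unfold poisson_kernel.
  pose proof (poisson_den_pos z t H). reg. lra.
Qed.

(* Twice the argument of the Cayley image of [z], seen from the boundary point
   -cot (t/2) corresponding to exp(it). *)
Definition poisson_primitive (z : Cpt) (t : R) : R :=
  2 * th (cayley_x z + cos (t / 2) / sin (t / 2)) (cayley_y z).

Lemma half_sin_pos t : 0 < t < 2 * PI -> 0 < sin (t / 2).
Proof. intros Ht. apply sin_gt_0; lra. Qed.

(** Conformal invariance of harmonic measure, checked with half angles. The key identity is |exp(it)
    - z|^2 = |1 - z|^2 ((s Y)^2 + (X s + c)^2) for s = sin(t/2) and c = cos(t/2). *)
Lemma poisson_primitive_derive z t : in_unit_disk z -> 0 < t < 2 * PI ->
  is_derive (poisson_primitive z) t (poisson_kernel z t).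
Proof.
  intros Hz Ht. pose proof (half_sin_pos t Ht) as Hs. pose proof (cayley_y_pos z Hz) as HY.
  destruct (disk_facts z Hz) as (_ & HD). pose proof (poisson_den_pos z t Hz) as HP.
  unfold poisson_primitive, th. auto_derive; [unfold Rdiv in *; repeat split; lra|].
  change (t * / 2) with (t / 2).
  set (Y := cayley_y z) in *. set (X := cayley_x z).
  set (s := sin (t / 2)) in *. set (c := cos (t / 2)).
  assert (SC : s * s + c * c = 1) by (pose proof (sin2_cos2 (t / 2)) as E; unfold Rsqr in E; exact E).
  assert (Ec : cos t = c * c - s * s).
  { replace t with (2 * (t / 2)) at 1 by field. rewrite cos_2a. reflexivity. }
  assert (Es : sin t = 2 * s * c).
  { replace t with (2 * (t / 2)) at 1 by field. rewrite sin_2a. reflexivity. }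
  unfold poisson_kernel.
  set (D := (1 - fst z) * (1 - fst z) + snd z * snd z) in *.
  set (P := (cos t - fst z) * (cos t - fst z) + (sin t - snd z) * (sin t - snd z)) in *.
  assert (EY : Y * D = 1 - Cnorm2 z) by (unfold Y, cayley_y; fold D; field; lra).
  assert (EX : X * D = - 2 * snd z) by (unfold X, cayley_x; fold D; field; lra).
  assert (KEY : P = D * ((s * Y) * (s * Y) + (X * s + c) * (X * s + c))).
  { apply Rmult_eq_reg_l with D; [|lra].
    transitivity (s * s * (Y * D) * (Y * D) + (X * D * s + c * D) * (X * D * s + c * D)); [|ring].
    rewrite EX, EY. unfold P. rewrite Ec, Es.
    transitivity (D * ((s * s + c * c) * (s * s + c * c) + (fst z * fst z + snd z * snd z) - 2 * fst z * (c * c - s * s) - 4 * snd z * s * c)); [ring|].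
    rewrite SC. unfold D, Cnorm2.
    replace (1 * 1 + (fst z * fst z + snd z * snd z) - 2 * fst z * (c * c - s * s) - 4 * snd z * s * c) with
      ((1 + (fst z * fst z + snd z * snd z)) * (s * s + c * c) - 2 * fst z * (c * c - s * s) - 4 * snd z * s * c) by (rewrite SC; ring).
    ring. }
  assert (HQ : 0 < (s * Y) * (s * Y) + (X * s + c) * (X * s + c)).
  { assert (0 < s * Y) by now apply Rmult_lt_0_compat. pose proof (mul_self_ge0 (X * s + c)). nra. }
  rewrite KEY, <- EY.
  transitivity (Y * (s * s + c * c) / (s * Y * (s * Y) + (X * s + c) * (X * s + c))).
  2:{ rewrite SC. field. lra. }
  assert (0 < s * s) by nra. assert (0 < Y * Y) by nra.
  field. repeat split; try lra.
Qed.

Lemma poisson_inner_integral z a b : in_unit_disk z -> 0 < a -> a <= b -> b < 2 * PI ->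
  is_RInt (poisson_kernel z) a b (poisson_primitive z b - poisson_primitive z a).
Proof.
  intros Hz Ha Hab Hb. apply (is_RInt_derive (poisson_primitive z) (poisson_kernel z)).
  - intros t Ht. rewrite Rmin_left, Rmax_right in Ht by lra. apply poisson_primitive_derive; [assumption|lra].
  - intros t _. now apply poisson_continuous.
Qed.

Lemma cot_large a : 0 < a < 1 -> / a <= cos (a / 2) / sin (a / 2).
Proof.
  intros Ha. pose proof PI2_3_2.
  assert (Hs : 0 < sin (a / 2)) by (apply sin_gt_0; lra).
  assert (Hs2 : sin (a / 2) < a / 2) by (apply sin_lt_x; lra).
  pose proof (sin2_cos2 (a / 2)) as SC. unfold Rsqr in SC.
  assert (Hc : 0 < cos (a / 2)) by (apply cos_gt_0; lra).
  assert (Hc2 : 1 / 2 <= cos (a / 2)) by nra.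
  apply Rmult_le_reg_r with (sin (a / 2)); [assumption|].
  replace (cos (a / 2) / sin (a / 2) * sin (a / 2)) with (cos (a / 2)) by (field; lra).
  apply Rmult_le_reg_l with a; [lra|]. rewrite <- Rmult_assoc, Rinv_r, Rmult_1_l by lra. nra.
Qed.

(** The cotangent blows up at both ends of [0, 2 PI], where the primitive has the limits 0 and 2 PI;
    the linear rate comes from cot(a/2) >= 1/a. *)
Lemma poisson_primitive_ends z : in_unit_disk z -> exists a0, 0 < a0 < 1 /\ forall a, 0 < a < a0 ->
  Rabs (poisson_primitive z a - 0) <= 4 * cayley_y z * a /\
  Rabs (poisson_primitive z (2 * PI - a) - 2 * PI) <= 4 * cayley_y z * a.
Proof.
  intros Hz. pose proof (cayley_y_pos z Hz) as HY. set (X := cayley_x z) in *. set (Y := cayley_y z) in *.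
  pose proof (Rabs_pos X) as HX0.
  (* Makes 1/a exceed 2 (|X| + 1), so that after the shift by X at least 1 / (2 a) of the cotangent
     is left. *)
  exists (/ (2 * (Rabs X + 1))).
  assert (H1 : 0 < / (2 * (Rabs X + 1))) by (apply Rinv_0_lt_compat; lra).
  split.
  { split; [assumption|]. rewrite <- Rinv_1. apply Rinv_lt_contravar; lra. }
  intros a Ha.
  assert (Ha1 : a < 1).
  { apply Rlt_le_trans with (/ (2 * (Rabs X + 1))); [lra|]. rewrite <- Rinv_1. apply Rinv_le_contravar; lra. }
  pose proof (cot_large a ltac:(lra)) as Hcot.
  assert (Hia : 2 * (Rabs X + 1) < / a).
  { rewrite <- (Rinv_inv (2 * (Rabs X + 1))). apply Rinv_lt_contravar; [|lra]. apply Rmult_lt_0_compat; lra. }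
  assert (HXb : - Rabs X <= X <= Rabs X) by (apply Rabs_le_between; lra).
  assert (Haa : a * / a = 1) by (apply Rinv_r; lra).
  assert (Hd : 0 < / (2 * a)) by (apply Rinv_0_lt_compat; lra).
  assert (Hd2 : / (2 * a) = / a / 2) by (field; lra).
  unfold poisson_primitive. fold X Y. split.
  - pose proof (th_small (X + cos (a / 2) / sin (a / 2)) Y (/ (2 * a)) (2 * Y * a) Hd HY) as T.
    specialize (T ltac:(right; field; lra) ltac:(lra)).
    rewrite Rminus_0_r in *. rewrite Rabs_mult, (Rabs_right 2) by lra. lra.
  - replace ((2 * PI - a) / 2) with (- (a / 2) + PI) by field.
    rewrite neg_cos, neg_sin, cos_neg, sin_neg.
    assert (Hs : 0 < sin (a / 2)) by (pose proof PI2_3_2; apply sin_gt_0; lra).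
    replace (- cos (a / 2) / - - sin (a / 2)) with (- (cos (a / 2) / sin (a / 2))) by (field; lra).
    pose proof (th_large (X + - (cos (a / 2) / sin (a / 2))) Y (/ (2 * a)) (2 * Y * a) Hd HY) as T.
    specialize (T ltac:(right; field; lra) ltac:(lra)).
    match goal with |- Rabs (2 * ?u - _) <= _ => replace (2 * u - 2 * PI) with (2 * (u - PI)) by ring end.
    rewrite Rabs_mult, (Rabs_right 2) by lra. lra.
Qed.

Lemma poisson_bounded z : in_unit_disk z -> exists M, 0 < M /\ forall t, 0 <= t <= 2 * PI -> Rabs (poisson_kernel z t) <= M.
Proof.
  intros Hz. pose proof PI_RGT_0.
  destruct (continuity_ab_maj (fun t => Rabs (poisson_kernel z t)) 0 (2 * PI) ltac:(lra)) as (t0 & Hmax & _).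
  - intros t _. apply (continuity_pt_comp (poisson_kernel z) Rabs); [|apply Rcontinuity_abs].
    apply continuity_pt_filterlim. now apply poisson_continuous.
  - exists (Rabs (poisson_kernel z t0) + 1). split; [pose proof (Rabs_pos (poisson_kernel z t0)); lra|].
    intros t Ht. specialize (Hmax t Ht). simpl in Hmax. lra.
Qed.

Lemma poisson_ex_RInt z a b : in_unit_disk z -> ex_RInt (poisson_kernel z) a b.
Proof. intros Hz. apply (ex_RInt_continuous (poisson_kernel z)). intros; now apply poisson_continuous. Qed.

Lemma poisson_small_integral z M a b : in_unit_disk z -> a <= b ->
  (forall t, a <= t <= b -> Rabs (poisson_kernel z t) <= M) ->
  forall l, is_RInt (poisson_kernel z) a b l -> Rabs l <= (b - a) * M.
Proof.
  intros Hz Hab HM l Hl.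
  apply (norm_RInt_le_const (poisson_kernel z) a b l M Hab); assumption.
Qed.

Lemma vanish_of_linear_bound r K a0 : 0 < a0 -> 0 <= K -> (forall a, 0 < a < a0 -> Rabs r <= K * a) -> r = 0.
Proof.
  intros Ha0 HK H. destruct (Req_dec r 0) as [E|E]; [exact E|exfalso].
  apply Rabs_pos_lt in E.
  set (a := Rmin (a0 / 2) (Rabs r / (2 * (K + 1)))).
  assert (Ha : 0 < a) by (apply Rmin_glb_lt; [lra|apply Rdiv_lt_0_compat; lra]).
  assert (Hb : a < a0) by (pose proof (Rmin_l (a0 / 2) (Rabs r / (2 * (K + 1)))); unfold a; lra).
  assert (Hc : a <= Rabs r / (2 * (K + 1))) by apply Rmin_r.
  specialize (H a (conj Ha Hb)).
  apply Rle_div_r in Hc; [|lra]. nra.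
Qed.

(** Over an initial arc of length a the integral is O(a), the kernel being bounded, and the
    primitive at a is O(a) as well; letting a tend to 0 moves the lower limit to 0. *)
Lemma poisson_left_integral z b : in_unit_disk z -> 0 < b < 2 * PI ->
  is_RInt (poisson_kernel z) 0 b (poisson_primitive z b).
Proof.
  intros Hz Hb. destruct (poisson_ex_RInt z 0 b Hz) as (l & Hl).
  destruct (poisson_primitive_ends z Hz) as (a0 & Ha0 & He).
  destruct (poisson_bounded z Hz) as (M & HM & HB). pose proof (cayley_y_pos z Hz) as HY.
  assert (E : l - poisson_primitive z b = 0).
  { apply (vanish_of_linear_bound _ (M + 4 * cayley_y z) (Rmin a0 b)); [apply Rmin_glb_lt; lra|lra|].
    intros a Ha. pose proof (Rmin_l a0 b). pose proof (Rmin_r a0 b).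
    destruct (poisson_ex_RInt z 0 a Hz) as (l1 & Hl1).
    pose proof (poisson_inner_integral z a b Hz ltac:(lra) ltac:(lra) ltac:(lra)) as Hl2.
    pose proof (is_RInt_Chasles _ _ _ _ _ _ Hl1 Hl2) as Hsum.
    apply (is_RInt_unique (V := R_CompleteNormedModule)) in Hsum.
    rewrite (is_RInt_unique (V := R_CompleteNormedModule) _ _ _ _ Hl) in Hsum.
    assert (Hl1b : Rabs l1 <= (a - 0) * M).
    { apply (poisson_small_integral z M 0 a Hz); [lra| |assumption]. intros t Ht. apply HB. lra. }
    destruct (He a ltac:(lra)) as (E1 & _). rewrite Rminus_0_r in E1.
    unfold plus in Hsum; simpl in Hsum. rewrite Hsum.
    replace (l1 + (poisson_primitive z b - poisson_primitive z a) - poisson_primitive z b) with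
      (l1 + - poisson_primitive z a) by ring.
    eapply Rle_trans; [apply Rabs_triang|]. rewrite Rabs_Ropp. lra. }
  replace (poisson_primitive z b) with l by lra. exact Hl.
Qed.

Lemma poisson_right_integral z b : in_unit_disk z -> 0 < b < 2 * PI ->
  is_RInt (poisson_kernel z) b (2 * PI) (2 * PI - poisson_primitive z b).
Proof.
  intros Hz Hb. destruct (poisson_ex_RInt z b (2 * PI) Hz) as (l & Hl).
  destruct (poisson_primitive_ends z Hz) as (a0 & Ha0 & He).
  destruct (poisson_bounded z Hz) as (M & HM & HB). pose proof (cayley_y_pos z Hz) as HY.
  assert (E : l - (2 * PI - poisson_primitive z b) = 0).
  { apply (vanish_of_linear_bound _ (M + 4 * cayley_y z) (Rmin a0 (2 * PI - b))); [apply Rmin_glb_lt; lra|lra|].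
    intros a Ha. pose proof (Rmin_l a0 (2 * PI - b)). pose proof (Rmin_r a0 (2 * PI - b)).
    destruct (poisson_ex_RInt z (2 * PI - a) (2 * PI) Hz) as (l1 & Hl1).
    pose proof (poisson_inner_integral z b (2 * PI - a) Hz ltac:(lra) ltac:(lra) ltac:(lra)) as Hl2.
    pose proof (is_RInt_Chasles _ _ _ _ _ _ Hl2 Hl1) as Hsum.
    apply (is_RInt_unique (V := R_CompleteNormedModule)) in Hsum.
    rewrite (is_RInt_unique (V := R_CompleteNormedModule) _ _ _ _ Hl) in Hsum.
    assert (Hl1b : Rabs l1 <= (2 * PI - (2 * PI - a)) * M).
    { apply (poisson_small_integral z M (2 * PI - a) (2 * PI) Hz); [lra| |assumption]. intros t Ht. apply HB. lra. }
    destruct (He a ltac:(lra)) as (_ & E1).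
    unfold plus in Hsum; simpl in Hsum. rewrite Hsum.
    replace (poisson_primitive z (2 * PI - a) - poisson_primitive z b + l1 - (2 * PI - poisson_primitive z b)) with
      (l1 + (poisson_primitive z (2 * PI - a) - 2 * PI)) by ring.
    eapply Rle_trans; [apply Rabs_triang|]. lra. }
  replace (2 * PI - poisson_primitive z b) with l by lra. exact Hl.
Qed.

(** * The step function on the circle and its jumps on the line *)

(** The angle that the Cayley transform sends to x_j, solved from -cot(t/2) = x_j. Index 0 and the
    indices beyond p + 1 give the two angles of the boundary point 1. *)
Definition jump_angle (p : nat) (x : nat -> R) (k : nat) : R :=
  match k with
  | O => 0
  | S j => if Nat.leb j p then PI + 2 * atan (x j) else 2 * PI
  end.

Lemma jump_angle_bounds p x j : (j <= p)%nat -> 0 < jump_angle p x (S j) < 2 * PI.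
Proof.
  intros Hj. unfold jump_angle. rewrite (proj2 (Nat.leb_le j p) Hj). pose proof (atan_bound (x j)). lra.
Qed.

Lemma jump_angle_last p x : jump_angle p x (S (S p)) = 2 * PI.
Proof. unfold jump_angle. now rewrite (proj2 (Nat.leb_gt (S p) p)) by lia. Qed.

Lemma jump_angle_increasing p x : increasing (S p) x -> forall k, (k < S (S p))%nat -> jump_angle p x k < jump_angle p x (S k).
Proof.
  intros Hx k Hk. destruct k as [|j].
  - apply (jump_angle_bounds p x 0). lia.
  - destruct (Nat.eq_dec j p) as [->|Hne].
    + rewrite jump_angle_last. apply (jump_angle_bounds p x p). lia.
    + unfold jump_angle. rewrite (proj2 (Nat.leb_le j p)), (proj2 (Nat.leb_le (S j) p)) by lia.
      pose proof (atan_increasing (x j) (x (S j)) (Hx j ltac:(lia))). lra.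
Qed.

Lemma poisson_primitive_jump p z x j : (j <= p)%nat ->
  poisson_primitive z (jump_angle p x (S j)) = 2 * th (cayley_x z - x j) (cayley_y z).
Proof.
  intros Hj. unfold poisson_primitive, jump_angle. rewrite (proj2 (Nat.leb_le j p) Hj).
  replace ((PI + 2 * atan (x j)) / 2) with (PI / 2 + atan (x j)) by field.
  do 2 f_equal.
  assert (Hc : 0 < cos (atan (x j))) by (apply cos_gt_0; pose proof (atan_bound (x j)); lra).
  rewrite cos_plus, sin_plus, cos_PI2, sin_PI2.
  pose proof (tan_atan (x j)) as E. unfold tan in E.
  replace (x j) with (sin (atan (x j)) / cos (atan (x j))) at 5 by exact E. field. lra.
Qed.

(** The integral of the Poisson kernel from angle 0 up to the k-th jump angle. *)
Definition cumulative_arg (p : nat) (z : Cpt) (x : nat -> R) (k : nat) : R :=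
  match k with
  | O => 0
  | S j => if Nat.leb j p then 2 * th (cayley_x z - x j) (cayley_y z) else 2 * PI
  end.

Lemma poisson_arc_integral p z x k : in_unit_disk z -> increasing (S p) x -> (k < S (S p))%nat ->
  is_RInt (poisson_kernel z) (jump_angle p x k) (jump_angle p x (S k))
    (cumulative_arg p z x (S k) - cumulative_arg p z x k).
Proof.
  intros Hz Hx Hk.
  assert (CA : forall j, (j <= p)%nat -> cumulative_arg p z x (S j) = poisson_primitive z (jump_angle p x (S j))).
  { intros j Hj. rewrite poisson_primitive_jump by assumption. unfold cumulative_arg.
    now rewrite (proj2 (Nat.leb_le j p) Hj). }
  assert (CL : cumulative_arg p z x (S (S p)) = 2 * PI).
  { unfold cumulative_arg. now rewrite (proj2 (Nat.leb_gt (S p) p)) by lia. }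
  destruct k as [|j].
  - rewrite CA by lia. change (cumulative_arg p z x 0) with 0. rewrite Rminus_0_r.
    apply poisson_left_integral; [assumption|]. apply jump_angle_bounds. lia.
  - destruct (Nat.eq_dec j p) as [->|Hne].
    + rewrite CL, jump_angle_last, CA by lia. apply poisson_right_integral; [assumption|].
      apply jump_angle_bounds. lia.
    + rewrite !CA by lia. pose proof (jump_angle_bounds p x j ltac:(lia)).
      pose proof (jump_angle_bounds p x (S j) ltac:(lia)).
      pose proof (jump_angle_increasing p x Hx (S j) ltac:(lia)).
      apply poisson_inner_integral; try assumption; lra.
Qed.

Lemma bsum_by_parts (v T : nat -> R) m :
  bsum (fun k => v k * (T (S k) - T k)) (S m) =
  v m * T (S m) - v 0%nat * T 0%nat - bsum (fun k => (v (S k) - v k) * T (S k)) m.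
Proof.
  induction m as [|m IH]; [simpl; ring|].
  change (bsum (fun k => v k * (T (S k) - T k)) (S (S m))) with
    (bsum (fun k => v k * (T (S k) - T k)) (S m) + v (S m) * (T (S (S m)) - T (S m))).
  rewrite IH. simpl. ring.
Qed.

(** Summation by parts turns values weighted by arcs into jumps weighted by arguments; the last
    value, which receives the full 2 PI, becomes the constant of [hmap]. *)
Lemma poisson_step_integral p z x (v : nat -> R) (G : R -> R) : in_unit_disk z -> increasing (S p) x ->
  (forall k s, (k < S (S p))%nat -> jump_angle p x k < s < jump_angle p x (S k) -> G s = v k) ->
  / (2 * PI) * Defs.RInt (fun t => poisson_kernel z t * G t) 0 (2 * PI) =
  hmap (v (S p)) (S p) (fun k => v (S k) - v k) x (cayley_x z) (cayley_y z).
Proof.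
  intros Hz Hx HG. pose proof PI_RGT_0.
  assert (H0 : forall m, (m <= S (S p))%nat ->
    is_RInt (fun t => poisson_kernel z t * G t) 0 (jump_angle p x m)
      (bsum (fun k => v k * (cumulative_arg p z x (S k) - cumulative_arg p z x k)) m)).
  { induction m as [|m IH]; intros Hm.
    - change (jump_angle p x 0) with 0. simpl bsum. apply (is_RInt_point (fun t => poisson_kernel z t * G t) 0).
    - simpl bsum. eapply (is_RInt_Chasles (fun t => poisson_kernel z t * G t)); [apply IH; lia|].
      pose proof (jump_angle_increasing p x Hx m ltac:(lia)) as Hlt.
      apply (is_RInt_ext (fun t => scal (v m) (poisson_kernel z t))).
      + intros t Ht. rewrite Rmin_left, Rmax_right in Ht by lra. rewrite (HG m t) by (lia || assumption).
        unfold scal; simpl; unfold mult; simpl. ring.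
      + apply (is_RInt_scal (poisson_kernel z)). apply poisson_arc_integral; try assumption; lia. }
  specialize (H0 (S (S p)) (Nat.le_refl _)). rewrite jump_angle_last in H0.
  rewrite (Defs_RInt_eq _ _ _ _ H0), bsum_by_parts.
  change (cumulative_arg p z x 0) with 0.
  assert (CL : cumulative_arg p z x (S (S p)) = 2 * PI).
  { unfold cumulative_arg. now rewrite (proj2 (Nat.leb_gt (S p) p)) by lia. }
  rewrite CL. unfold hmap.
  rewrite (bsum_ext (fun k => (v (S k) - v k) * cumulative_arg p z x (S k))
    (fun k => 2 * ((v (S k) - v k) * th (cayley_x z - x k) (cayley_y z)))).
  2:{ intros k Hk. unfold cumulative_arg. rewrite (proj2 (Nat.leb_le k p)) by lia. ring. }
  rewrite bsum_scal. field. lra.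
Qed.

Lemma cayley_injective z w : in_unit_disk z -> in_unit_disk w ->
  cayley_x z = cayley_x w -> cayley_y z = cayley_y w -> z = w.
Proof.
  intros Hz Hw EX EY.
  assert (INV : forall u, in_unit_disk u ->
    let X := cayley_x u in let Y := cayley_y u in
    u = ((X * X + Y * Y - 1) / (X * X + (Y + 1) * (Y + 1)), - 2 * X / (X * X + (Y + 1) * (Y + 1)))).
  { intros u Hu X Y. pose proof (cayley_y_pos u Hu) as HY. destruct (disk_facts u Hu) as (H1 & HD).
    assert (HN : 0 < X * X + (Y + 1) * (Y + 1)) by (pose proof (mul_self_ge0 X); unfold Y; nra).
    set (D := (1 - fst u) * (1 - fst u) + snd u * snd u) in *.
    assert (E1 : X * D = - 2 * snd u) by (unfold X, cayley_x; fold D; field; lra).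
    assert (E2 : Y * D = 1 - (fst u * fst u + snd u * snd u)) by (unfold Y, cayley_y, Cnorm2; fold D; field; lra).
    (* In complex terms |w + i|^2 |1 - z|^2 = 4, since the image w satisfies w + i = 2 i / (1 - z).
       The inverse map is (w - i) / (w + i). *)
    assert (E3 : (X * X + (Y + 1) * (Y + 1)) * D = 4).
    { apply Rmult_eq_reg_r with D; [|lra].
      transitivity (X * D * (X * D) + (Y * D + D) * (Y * D + D)); [ring|]. rewrite E1, E2. unfold D. ring. }
    apply Cpt_eq; cbn [fst snd].
    - apply Rmult_eq_reg_r with (X * X + (Y + 1) * (Y + 1)); [|lra].
      replace ((X * X + Y * Y - 1) / (X * X + (Y + 1) * (Y + 1)) * (X * X + (Y + 1) * (Y + 1))) with
        (X * X + (Y + 1) * (Y + 1) - 2 * Y - 2) by (field; lra).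
      apply Rmult_eq_reg_r with D; [|lra].
      replace ((X * X + (Y + 1) * (Y + 1) - 2 * Y - 2) * D) with ((X * X + (Y + 1) * (Y + 1)) * D - 2 * (Y * D) - 2 * D) by ring.
      rewrite Rmult_assoc, E3, E2. unfold D. ring.
    - apply Rmult_eq_reg_r with (X * X + (Y + 1) * (Y + 1)); [|lra].
      replace (- 2 * X / (X * X + (Y + 1) * (Y + 1)) * (X * X + (Y + 1) * (Y + 1))) with (- 2 * X) by (field; lra).
      apply Rmult_eq_reg_r with D; [|lra]. rewrite Rmult_assoc, E3.
      replace (- 2 * X * D) with (- 2 * (X * D)) by ring. rewrite E1. ring. }
  rewrite (INV z Hz), (INV w Hw), EX, EY. reflexivity.
Qed.

Lemma cayley_surjective X Y : 0 < Y -> exists z, in_unit_disk z /\ cayley_x z = X /\ cayley_y z = Y.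
Proof.
  intros HY. set (N := X * X + (Y + 1) * (Y + 1)).
  assert (HN : 0 < N) by (unfold N; pose proof (mul_self_ge0 X); nra).
  exists ((X * X + Y * Y - 1) / N, - 2 * X / N).
  assert (E1 : (1 - (X * X + Y * Y - 1) / N) * (1 - (X * X + Y * Y - 1) / N) + - 2 * X / N * (- 2 * X / N) = 4 / N).
  { apply Rmult_eq_reg_r with (N * N); [|nra].
    transitivity ((N - (X * X + Y * Y - 1)) * (N - (X * X + Y * Y - 1)) + 4 * X * X); [field; lra|].
    transitivity (4 * N); [unfold N; ring|field; lra]. }
  assert (E2 : 1 - Cnorm2 ((X * X + Y * Y - 1) / N, - 2 * X / N) = 4 * Y / N).
  { unfold Cnorm2. cbn [fst snd]. apply Rmult_eq_reg_r with (N * N); [|nra].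
    transitivity (N * N - (X * X + Y * Y - 1) * (X * X + Y * Y - 1) - 4 * X * X); [field; lra|].
    transitivity (4 * Y * N); [unfold N; ring|field; lra]. }
  split; [|split].
  - unfold in_unit_disk. assert (0 < 4 * Y / N) by (apply Rdiv_lt_0_compat; lra). lra.
  - unfold cayley_x. cbn [fst snd]. rewrite E1. field. lra.
  - unfold cayley_y. cbn [fst snd]. rewrite E1, E2. field. lra.
Qed.

(** * Existence of good jump points *)

Definition dot (a b : Cpt) : R := fst a * fst b + snd a * snd b.

(** A corner of the convex hull of the vertices. The property passes to any polygon formed by some
    of these vertices that keeps c_k, which suits an induction by cutting. *)
Definition exposed (n : nat) (c : nat -> Cpt) (k : nat) : Prop :=
  exists f, forall j, (j < n)%nat -> j <> k -> dot f (c k) < dot f (c j).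

(** A vertex of largest modulus works with the functional given by -c_k; strictness comes from |c_k
    - c_j|^2 > 0. *)
Lemma exposed_exists n c : (1 <= n)%nat -> distinct_vertices n c -> exists k, (k < n)%nat /\ exposed n c k.
Proof.
  intros Hn HD.
  destruct (finite_argmax (fun _ => True) (fun k => dot (c k) (c k)) n) as (k & Hk & _ & Hmax).
  { exists 0%nat. split; [lia|exact I]. }
  exists k. split; [assumption|]. exists (- fst (c k), - snd (c k)). intros j Hj Hjk.
  specialize (Hmax j Hj I). simpl in Hmax.
  assert (Hne : fst (c k) <> fst (c j) \/ snd (c k) <> snd (c j)).
  { destruct (Req_dec (fst (c k)) (fst (c j))) as [E1|E1]; [right|now left]. intros E2.
    apply (HD j k Hj Hk Hjk). apply Cpt_eq; auto. }
  unfold dot in *. cbn [fst snd].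
  pose proof (mul_self_ge0 (fst (c k) - fst (c j))). pose proof (mul_self_ge0 (snd (c k) - snd (c j))).
  destruct Hne as [H1|H1].
  - assert (0 < (fst (c k) - fst (c j)) * (fst (c k) - fst (c j))) by (assert (fst (c k) - fst (c j) <> 0) by lra; nra). lra.
  - assert (0 < (snd (c k) - snd (c j)) * (snd (c k) - snd (c j))) by (assert (snd (c k) - snd (c j) <> 0) by lra; nra). lra.
Qed.

(** Without a turn both neighbours would lie on one line with the vertex and, by the functional, on
    the same side of it, so that the two edges would overlap. *)
Lemma exposed_turn n c l : (3 <= n)%nat -> jordan_polygon n c -> distinct_vertices n c -> (l < n)%nat ->
  exposed n c (next n l) -> side (c l) (c (next n l)) (c (next n (next n l))) <> 0.
Proof.
  intros Hn HJ HD Hl (f & Hf) Hside.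
  assert (H1 : (next n l < n)%nat) by now apply next_bound.
  assert (H2 : (next n (next n l) < n)%nat) by now apply next_bound.
  assert (Hne : l <> next n l /\ next n (next n l) <> next n l /\ next n (next n l) <> l).
  { destruct (next_cases n l Hl); destruct (next_cases n (next n l) H1); lia. }
  destruct Hne as (N1 & N2 & N3).
  pose proof (Hf l Hl N1) as F1. pose proof (Hf _ H2 N2) as F2.
  set (u := c l) in *. set (v := c (next n l)) in *. set (w := c (next n (next n l))) in *.
  set (a := dot f u - dot f v). set (b := dot f w - dot f v).
  assert (Ha : 0 < a) by (unfold a; lra). assert (Hb : 0 < b) by (unfold b; lra).
  assert (E1 : a * (fst w - fst v) = b * (fst u - fst v)).
  { assert (Hz : a * (fst w - fst v) - b * (fst u - fst v) = snd f * side u v w).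
    { unfold a, b, dot, side, cross, Csub. cbn [fst snd]. ring. }
    rewrite Hside in Hz. lra. }
  assert (E2 : a * (snd w - snd v) = b * (snd u - snd v)).
  { assert (Hz : a * (snd w - snd v) - b * (snd u - snd v) = - fst f * side u v w).
    { unfold a, b, dot, side, cross, Csub. cbn [fst snd]. ring. }
    rewrite Hside in Hz. lra. }
  (* the point v + b/(a+b) (u - v) = v + a/(a+b) (w - v) is on both edges *)
  set (z := Cadd v (Cscale (b / (a + b)) (Csub u v))).
  assert (Hba : 0 < b / (a + b) < 1) by (split; [apply Rdiv_lt_0_compat; lra|apply Rlt_div_l; lra]).
  assert (Hab : 0 < a / (a + b) < 1) by (split; [apply Rdiv_lt_0_compat; lra|apply Rlt_div_l; lra]).
  assert (O1 : on_seg u v z).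
  { apply seg_sym. exists (b / (a + b)). split; [lra|reflexivity]. }
  assert (O2 : on_seg v w z).
  { exists (a / (a + b)). split; [lra|]. unfold z, Cadd, Cscale, Csub. apply Cpt_eq; cbn [fst snd].
    - replace (a / (a + b) * (fst w - fst v)) with (a * (fst w - fst v) / (a + b)) by (field; lra). rewrite E1. field. lra.
    - replace (a / (a + b) * (snd w - snd v)) with (a * (snd w - snd v) / (a + b)) by (field; lra). rewrite E2. field. lra. }
  destruct (HJ l (next n l) z Hl H1 N1 O1 O2) as [(_ & E)|(E & _)]; [|congruence].
  fold v in E. assert (Ez : dot f z = dot f v) by now rewrite E.
  assert (Ez2 : dot f z = dot f v + b / (a + b) * a) by (unfold z, a, dot, Cadd, Cscale, Csub; cbn [fst snd]; ring).
  assert (0 < b / (a + b) * a) by (apply Rmult_lt_0_compat; lra). lra.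
Qed.

Lemma exposed_mirror n c k : exposed n c k -> exposed n (fun j => mirror (c j)) k.
Proof.
  intros (f & Hf). exists (mirror f). intros j Hj Hjk. specialize (Hf j Hj Hjk).
  unfold dot, mirror in *. cbn [fst snd]. lra.
Qed.

(* Cutting off an ear c_0 c_1 c_2 leaves a polygon of the same orientation:
   otherwise c_1, joined both to infinity and to the side c_0 c_2 off the
   remaining polygon, would be in the bounded image of its mapping. *)
Lemma ear_not_reversed n c : (4 <= n)%nat -> jordan_polygon n c -> distinct_vertices n c ->
  0 < side (c 0%nat) (c 1%nat) (c 2%nat) ->
  (forall i, (3 <= i < n)%nat -> ~ in_triangle (c 0%nat) (c 1%nat) (c 2%nat) (c i)) ->
  exposed n c 1 -> ~ pos_poly (n - 2 + 1) (fun k => mirror (outer 2 c k)).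
Proof.
  intros Hn HJ HD HS Hclean (f & Hf) (x & Hx & HJac).
  set (p := (n - 3)%nat). assert (Hp : (1 <= p)%nat) by (unfold p; lia).
  replace (n - 2 + 1 - 1)%nat with (S p) in * by (unfold p; lia).
  set (B := outer 2 c) in *. set (n' := S (S p)).
  assert (Hn' : (n - 2 + 1 = n')%nat) by (unfold n', p; lia).
  pose proof (mirror_image_clopen p B x Hp Hx HJac) as CP.
  set (P := fun w => image p (fun k => mirror (B k)) x (mirror w)) in *.
  destruct (left_in_image p (fun k => mirror (B k)) x Hx HJac) as (d & Hd & Hleft).
  set (u := c 0%nat) in *. set (v := c 1%nat) in *. set (w := c 2%nat) in *.
  assert (B0 : B 0%nat = u) by reflexivity. assert (B1 : B 1%nat = w) by reflexivity.
  cbv beta in Hleft. rewrite B0, B1 in Hleft.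
  assert (BE : forall z, on_polygon n' B z -> on_seg u w z \/ exists j, (2 <= j < n)%nat /\ on_seg (c j) (c (next n j)) z).
  { intros z (k & Hk & Hz). rewrite <- Hn' in Hz. destruct k as [|k].
    - left. unfold B in Hz. rewrite outer_edge0 in Hz by lia. exact Hz.
    - right. unfold B in Hz. rewrite outer_edge in Hz by (unfold n', p in Hk; lia).
      exists (2 + k)%nat. split; [unfold n', p in Hk; lia|exact Hz]. }
  set (mid := midpoint u w).
  set (pt := fun r => Cadd mid (Cscale r (Csub v mid))).
  assert (Smid : side u v mid = side u v w / 2 /\ side v w mid = side u v w / 2 /\ side w u mid = 0).
  { unfold mid, midpoint, side, cross, Cscale, Cadd, Csub. cbn [fst snd]. repeat split; field. }
  destruct Smid as (S1 & S2 & S3).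
  assert (Lpt : forall a b r, side a b (pt r) = (1 - r) * side a b mid + r * side a b v) by (intros; apply side_convex).
  assert (L1 : forall r, side u v (pt r) = (1 - r) * (side u v w / 2)) by (intros; rewrite Lpt, S1, side_right; ring).
  assert (L2 : forall r, side v w (pt r) = (1 - r) * (side u v w / 2)) by (intros; rewrite Lpt, S2, side_left; ring).
  assert (L3 : forall r, side w u (pt r) = r * side u v w) by (intros; rewrite Lpt, S3, (side_cycle w u v); ring).
  (* The segment from the middle of the diagonal to c_1 runs through the triangle, which contains no
     further vertex and hence is not entered by any remaining edge. *)
  assert (Hoff : forall r, 0 < r <= 1 -> ~ on_polygon n' B (pt r)).
  { intros r Hr Hon. apply BE in Hon. destruct Hon as [Hon|(j & Hj & Hon)].
    - apply seg_sym, side_seg in Hon. rewrite L3 in Hon. nra.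
    - destruct (Req_dec r 1) as [->|R1].
      + replace (pt 1) with (c 1%nat) in Hon by (unfold pt, Cadd, Cscale, Csub; apply Cpt_eq; cbn [fst snd]; fold v; ring).
        destruct (vertex_on_edge n c j 1 HJ HD ltac:(lia) ltac:(lia) Hon) as [E|E]; [lia|].
        destruct (next_cases n j ltac:(lia)); lia.
      + destruct (triangle_entering_edge n c j (pt r) ltac:(lia) HJ HD HS Hj Hon) as (i & Hi & Htri & _).
        * fold u v. rewrite L1. nra.
        * fold v w. rewrite L2. nra.
        * fold w u. rewrite L3. nra.
        * exact (Hclean i Hi Htri). }
  set (M := Rabs (fst v - fst mid) + Rabs (snd v - snd mid) + 1).
  assert (M1 := Rabs_pos (fst v - fst mid)). assert (M2 := Rabs_pos (snd v - snd mid)).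
  assert (HM : 0 < M) by (unfold M; lra).
  set (s := Rmin 1 (d / M)).
  assert (Hs : 0 < s <= 1) by (split; [apply Rmin_glb_lt; [lra|now apply Rdiv_lt_0_compat]|apply Rmin_l]).
  assert (HsM : s * M <= d).
  { apply Rle_trans with (d / M * M); [apply Rmult_le_compat_r; [lra|apply Rmin_r]|right; field; lra]. }
  (* The triangle lies to the right of c_0 c_2 as an edge of the remaining polygon, hence to the
     left of it after reflection. *)
  assert (Ps : P (pt s)).
  { apply Hleft.
    - replace (midpoint (mirror u) (mirror w)) with (mirror mid) by (unfold mid, midpoint, mirror, Cscale, Cadd; cbn [fst snd]; f_equal; ring).
      apply mirror_box. rewrite !mirror_invol.
      unfold M in HsM. assert (0 <= s * Rabs (fst v - fst mid)) by (apply Rmult_le_pos; lra).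
      assert (0 <= s * Rabs (snd v - snd mid)) by (apply Rmult_le_pos; lra).
      unfold box, pt, Cadd, Cscale, Csub. cbn [fst snd]. split.
      + match goal with |- Rabs ?a < _ => replace a with (s * (fst v - fst mid)) by ring end.
        rewrite Rabs_mult, (Rabs_right s) by lra. lra.
      + match goal with |- Rabs ?a < _ => replace a with (s * (snd v - snd mid)) by ring end.
        rewrite Rabs_mult, (Rabs_right s) by lra. lra.
    - rewrite mirror_side, side_swap, L3, Ropp_involutive. nra. }
  assert (Pv : P v).
  { apply (joined_off_clopen n' B P (pt s) v CP); [|assumption]. apply segment_joined. intros t Ht.
    replace (Cadd (pt s) (Cscale t (Csub v (pt s)))) with (pt (s + t * (1 - s))).
    - apply Hoff. split; nra.
    - unfold pt, Cadd, Cscale, Csub. apply Cpt_eq; cbn [fst snd]; ring. }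
  (* The remaining polygon lies strictly above c_1 for the functional f, so the ray from c_1 in the
     direction -f escapes off it. *)
  assert (Hup : forall z, on_polygon n' B z -> dot f v < dot f z).
  { assert (SEG : forall a b z, dot f v < dot f a -> dot f v < dot f b -> on_seg a b z -> dot f v < dot f z).
    { intros a b z Ha Hb (t & Ht & ->).
      replace (dot f (Cadd a (Cscale t (Csub b a)))) with ((1 - t) * dot f a + t * dot f b) by (unfold dot, Cadd, Cscale, Csub; cbn [fst snd]; ring).
      destruct (Rle_dec t (1 / 2)); nra. }
    intros z Hz. apply BE in Hz. destruct Hz as [Hz|(j & Hj & Hz)].
    - apply (SEG u w); try assumption; apply Hf; lia.
    - assert (Hjn : (next n j < n)%nat) by (apply next_bound; lia).
      apply (SEG _ _ z (Hf j ltac:(lia) ltac:(lia)) (Hf (next n j) Hjn ltac:(destruct (next_cases n j ltac:(lia)); lia)) Hz). }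
  destruct (image_bounded p (fun k => mirror (B k)) x) as (K & HK).
  set (E := dot f f).
  assert (HE : 0 < E).
  { pose proof (mul_self_ge0 (fst f)). pose proof (mul_self_ge0 (snd f)).
    destruct (Req_dec E 0) as [Z|Z]; [exfalso|unfold E, dot in *; lra].
    assert (Z2 : fst f = 0 /\ snd f = 0) by (unfold E, dot in Z; split; nra).
    destruct Z2 as (Z2 & Z3). specialize (Hf 0%nat ltac:(lia) ltac:(lia)).
    unfold dot in Hf. rewrite Z2, Z3 in Hf. lra. }
  (* Length of the escape, measured by f: at [far] the functional exceeds in modulus the bound
     imposed on it by an image whose coordinates are at most [K]. *)
  set (W := Rabs (dot f v) + (Rabs (fst f) + Rabs (snd f)) * Rabs K + 1).
  assert (W1 := Rabs_pos (dot f v)). assert (W2 := Rabs_pos K). assert (W3 := Rabs_pos (fst f)). assert (W4 := Rabs_pos (snd f)).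
  assert (HW : 0 < W) by (unfold W; nra).
  set (far := Cadd v (Cscale (- (W / E)) f)).
  assert (HWE : 0 < W / E) by (apply Rdiv_lt_0_compat; assumption).
  assert (Pfar : P far).
  { apply (joined_off_clopen n' B P v far CP); [|assumption]. apply segment_joined. intros t Ht Hon.
    apply Hup in Hon.
    replace (dot f (Cadd v (Cscale t (Csub far v)))) with (dot f v - t * (W / E * E)) in Hon
      by (unfold far, E, dot, Cadd, Cscale, Csub; cbn [fst snd]; ring).
    assert (0 <= t * (W / E * E)); [|lra]. apply Rmult_le_pos; [lra|]. apply Rmult_le_pos; lra. }
  apply HK in Pfar. unfold mirror in Pfar. cbn [fst snd] in Pfar. rewrite Rabs_Ropp in Pfar.
  assert (Dfar : dot f far = dot f v - W).
  { replace W with (W / E * E) at 1 by (field; lra). unfold far, E, dot, Cadd, Cscale; cbn [fst snd]. ring. }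
  assert (Dbound : Rabs (dot f far) <= (Rabs (fst f) + Rabs (snd f)) * Rabs K).
  { unfold dot. eapply Rle_trans; [apply Rabs_triang|]. rewrite !Rabs_mult, Rmult_plus_distr_r.
    pose proof (Rle_abs K). apply Rplus_le_compat; apply Rmult_le_compat_l; lra. }
  rewrite Dfar in Dbound. apply Rabs_le_between in Dbound.
  pose proof (Rle_abs (dot f v)). unfold W in Dbound. lra.
Qed.

Lemma iter_next_inj n l i j : (i < n)%nat -> (j < n)%nat -> Nat.iter l (next n) i = Nat.iter l (next n) j -> i = j.
Proof.
  intros Hi Hj. induction l as [|l IH]; [tauto|]. simpl. intros E. apply IH.
  assert (B : forall k, (k < n)%nat -> (Nat.iter l (next n) k < n)%nat).
  { intros k Hk. clear IH E. induction l as [|l IHl]; [assumption|]. simpl. now apply next_bound. }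
  apply (next_inj n); auto.
Qed.

(** The statement for the induction. It asks for one left turn at a corner of the convex hull,
    because such a turn can be read off on the parts of a cut polygon, unlike
    [positively_oriented]. *)
Definition exposed_left_turn_pos (n : nat) : Prop := forall c, jordan_polygon n c -> distinct_vertices n c ->
  exposed n c 1 -> 0 < side (c 0%nat) (c 1%nat) (c 2%nat) -> pos_poly n c.

(** Relabelling l times moves the corner with the left turn to index 1. *)
Lemma pos_poly_any_vertex n c l : (3 <= n)%nat -> exposed_left_turn_pos n ->
  jordan_polygon n c -> distinct_vertices n c -> (l < n)%nat -> exposed n c (next n l) ->
  0 < side (c l) (c (next n l)) (c (next n (next n l))) -> pos_poly n c.
Proof.
  intros Hn IH HJ HD Hl (f & Hf) HS.
  assert (I0 : Nat.iter l (next n) 0%nat = l) by (rewrite iter_next_add; lia).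
  assert (I1 : Nat.iter l (next n) 1%nat = next n l).
  { replace 1%nat with (next n 0) by (apply next_lt; lia). now rewrite Nat.iter_swap, I0. }
  assert (I2 : Nat.iter l (next n) 2%nat = next n (next n l)).
  { replace 2%nat with (next n 1) by (apply next_lt; lia). now rewrite Nat.iter_swap, I1. }
  apply (pos_poly_unrot n c l Hn ltac:(lia)). apply IH.
  - now apply iter_rot_jordan.
  - now apply iter_rot_distinct.
  - exists f. intros j Hj Hj1. rewrite !iter_rot by lia. rewrite I1. apply Hf.
    + clear - Hj. induction l as [|l IHl]; [assumption|]. simpl. now apply next_bound.
    + rewrite <- I1. intros E. apply Hj1. apply (iter_next_inj n l); [assumption|lia|assumption].
  - rewrite !iter_rot by lia. now rewrite I0, I1, I2.
Qed.

Lemma exposed_left_turn n : (3 <= n)%nat -> exposed_left_turn_pos n.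
Proof.
  induction n as [n IH] using (well_founded_ind Nat.lt_wf_0). intros Hn c HJ HD Hexp HS.
  assert (TRI : pos_poly 3 c).
  { exists INR. simpl Nat.sub. split.
    - intros k Hk. rewrite S_INR. lra.
    - apply jac_positive_triangle; [simpl; lra|].
      unfold edge_vec. unfold side in HS.
      replace (cross (Csub (c 1%nat) (c 0%nat)) (Csub (c 2%nat) (c 1%nat))) with (cross (Csub (c 1%nat) (c 0%nat)) (Csub (c 2%nat) (c 0%nat))); [assumption|].
      unfold cross, Csub. cbn [fst snd]. ring. }
  destruct (Nat.eq_dec n 3) as [->|Hn3]; [exact TRI|].
  assert (Hn4 : (4 <= n)%nat) by lia.
  destruct (classic (exists i, (i < n)%nat /\ ((3 <= i)%nat /\ in_triangle (c 0%nat) (c 1%nat) (c 2%nat) (c i)))) as [Hin|Hin].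
  (* A vertex lies in the triangle: the cut from c_1 to the farthest such vertex c_q leaves c_1
     exposed in both parts, and the left turns there are the inequalities [P1] and [P2]. One
     relabelling makes c_1 the start of the diagonal, so that c_q gets the index q - 1. *)
  - destruct (finite_argmax _ (fun i => side (c 2%nat) (c 0%nat) (c i)) n Hin) as (q & Hq & (Hq3 & Htri) & Hmax).
    destruct (farthest_diagonal n c q Hn4 HJ HD HS ltac:(lia) Htri) as (P1 & P2 & HDg).
    { intros i Hi Hi2. apply Hmax; [lia|]. split; [lia|assumption]. }
    pose proof (rot1_jordan n c HJ) as HJr. pose proof (rot1_distinct n c HD) as HDr.
    apply (pos_poly_unrot n c 1 Hn ltac:(lia)). change (Nat.iter 1 (rot1 n) c) with (rot1 n c).
    assert (R : forall k, (k < n - 1)%nat -> rot1 n c k = c (S k)) by (intros k Hk; unfold rot1; rewrite next_lt by lia; reflexivity).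
    assert (RL : rot1 n c (n - 1) = c 0%nat).
    { unfold rot1. destruct (next_cases n (n - 1) ltac:(lia)) as [(L & E)|(L & E)]; [lia|now rewrite E]. }
    destruct Hexp as (f & Hf).
    assert (Hf' : forall k, (0 < k < n)%nat -> dot f (rot1 n c 0) < dot f (rot1 n c k)).
    { intros k Hk. rewrite R by lia. unfold rot1. apply Hf; [apply next_bound; lia|].
      destruct (next_cases n k ltac:(lia)); lia. }
    apply (pos_poly_glue n (q - 1)); try lia.
    + apply (pos_poly_any_vertex (S (q - 1)) _ (q - 1)); try lia.
      * apply IH; lia.
      * apply (inner_jordan n); try lia; assumption.
      * apply (inner_distinct n); try lia; assumption.
      * rewrite next_last. exists f. intros j Hj Hj0. apply Hf'. lia.
      * rewrite next_last, next_lt by lia. rewrite !R by lia. replace (S (q - 1)) with q by lia.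
        rewrite side_cycle. exact P2.
    + apply (pos_poly_any_vertex (n - (q - 1) + 1) _ (n - (q - 1))); try lia.
      * apply IH; lia.
      * apply outer_jordan; try lia; assumption.
      * apply outer_distinct; try lia; assumption.
      * rewrite Nat.add_1_r, next_last. exists f. intros j Hj Hj0. destruct j as [|j]; [lia|].
        cbn [outer]. apply Hf'. lia.
      * rewrite Nat.add_1_r, next_last, next_lt by lia.
        replace (n - (q - 1))%nat with (S (n - q)) by lia. cbn [outer].
        replace (q - 1 + (n - q))%nat with (n - 1)%nat by lia. rewrite RL.
        rewrite Nat.add_0_r, !R by lia. replace (S (q - 1)) with q by lia. exact P1.
  (* No vertex lies in the triangle: the ear is cut off and the rest has lost c_1. It has an exposed
     vertex of its own, and a right turn there would make the mirrored rest positive. *)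
  - assert (Hclean : forall i, (3 <= i < n)%nat -> ~ in_triangle (c 0%nat) (c 1%nat) (c 2%nat) (c i)).
    { intros i Hi Ht. apply Hin. exists i. split; [lia|]. split; [lia|assumption]. }
    pose proof (ear_diagonal n c Hn4 HJ HD HS Hclean) as HDg.
    apply (pos_poly_glue n 2); try lia; [exact TRI|].
    set (B := outer 2 c). set (n' := (n - 2 + 1)%nat).
    assert (HJB : jordan_polygon n' B) by (apply outer_jordan; try lia; assumption).
    assert (HDB : distinct_vertices n' B) by (apply outer_distinct; try lia; assumption).
    assert (Hn' : (3 <= n')%nat) by (unfold n'; lia).
    destruct (exposed_exists n' B ltac:(lia) HDB) as (k & Hk & Hexk).
    destruct (prev_vertex n' k Hk) as (l & Hl & <-).
    pose proof (exposed_turn n' B l Hn' HJB HDB Hl Hexk) as Hturn.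
    destruct (Rtotal_order (side (B l) (B (next n' l)) (B (next n' (next n' l)))) 0) as [Hneg|[Hz|Hpos]]; [|congruence|].
    + exfalso. apply (ear_not_reversed n c Hn4 HJ HD HS Hclean Hexp). fold B. fold n'.
      apply (pos_poly_any_vertex n' _ l Hn'); auto using mirror_jordan, mirror_distinct, exposed_mirror.
      * apply IH; unfold n'; lia.
      * rewrite mirror_side. lra.
    + apply (pos_poly_any_vertex n' _ l Hn'); auto. apply IH; unfold n'; lia.
Qed.

Theorem theorem1 (n : nat) (c : nat -> Cpt) :
  (3 <= n)%nat ->
  distinct_vertices n c ->
  jordan_polygon n c ->
  positively_oriented n c ->
  exists t : nat -> R,
    t 0%nat = 0 /\ t n = 2 * PI /\
    (forall k, (k < n)%nat -> t k < t (S k)) /\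
    forall F : R -> Cpt,
      (forall (k : nat) (s : R), (1 <= k <= n)%nat ->
         t (k - 1)%nat < s < t k -> F s = c (k - 1)%nat) ->
      (forall z w, in_unit_disk z -> in_unit_disk w ->
         poisson_integral F z = poisson_integral F w -> z = w) /\
      (forall z, in_unit_disk z -> polygon_domain n c (poisson_integral F z)) /\
      (forall w, polygon_domain n c w ->
         exists z, in_unit_disk z /\ poisson_integral F z = w).
Proof.
  intros Hn HD HJ HO.
  assert (Hpos : pos_poly n c).
  { destruct (exposed_exists n c ltac:(lia) HD) as (k & Hk & Hexk).
    destruct (prev_vertex n k Hk) as (l & Hl & <-).
    pose proof (exposed_turn n c l Hn HJ HD Hl Hexk) as Hturn.
    (* A right turn at the exposed vertex would give good jump points to the mirrored polygon,
       against the orientation. *)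
    destruct (Rtotal_order (side (c l) (c (next n l)) (c (next n (next n l)))) 0) as [Hneg|[Hz|Hgt]]; [|congruence|].
    - exfalso.
      assert (Hrev : pos_poly n (fun j => mirror (c j))).
      { apply (pos_poly_any_vertex n _ l Hn); auto using mirror_jordan, mirror_distinct, exposed_mirror.
        - now apply exposed_left_turn.
        - rewrite mirror_side. lra. }
      destruct Hrev as (x & Hx & HJac). destruct n as [|[|p]]; try lia.
      replace (S (S p) - 1)%nat with (S p) in * by lia.
      now apply (not_reversed p c x ltac:(lia) HJ HD HO Hx).
    - apply (pos_poly_any_vertex n _ l Hn); auto. now apply exposed_left_turn. }
  destruct Hpos as (x & Hx & HJac). destruct n as [|[|p]]; try lia.
  replace (S (S p) - 1)%nat with (S p) in * by lia.
  destruct (half_plane_mapping p c x ltac:(lia) HJ HD HO Hx HJac) as (Hinj & Hinto & Honto).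
  exists (jump_angle p x). split; [reflexivity|]. split; [apply jump_angle_last|].
  split; [now apply jump_angle_increasing|].
  intros F HF.
  (* After the Cayley transform the Poisson integral is the half-plane map. Arcs are numbered from 1
     here and from 0 in [poisson_step_integral], hence [S k]. *)
  assert (EP : forall z, in_unit_disk z -> poisson_integral F z = poly_map p c x (cayley_x z) (cayley_y z)).
  { intros z Hz. unfold poisson_integral, poly_map. f_equal.
    - apply (poisson_step_integral p z x (fun k => fst (c k)) (fun t => fst (F t)) Hz Hx).
      intros k s Hk Hs. rewrite (HF (S k) s); [now rewrite Nat.sub_succ, Nat.sub_0_r|lia|].
      now rewrite Nat.sub_succ, Nat.sub_0_r.
    - apply (poisson_step_integral p z x (fun k => snd (c k)) (fun t => snd (F t)) Hz Hx).
      intros k s Hk Hs. rewrite (HF (S k) s); [now rewrite Nat.sub_succ, Nat.sub_0_r|lia|].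
      now rewrite Nat.sub_succ, Nat.sub_0_r. }
  split; [|split].
  - intros z w Hz Hw E. rewrite !EP in E by assumption.
    destruct (Hinj _ _ _ _ (cayley_y_pos z Hz) (cayley_y_pos w Hw) E) as (E1 & E2).
    now apply cayley_injective.
  - intros z Hz. rewrite EP by assumption. apply Hinto. now apply cayley_y_pos.
  - intros w Hw. destruct (Honto w Hw) as (X & Y & HY & E).
    destruct (cayley_surjective X Y HY) as (z & Hz & E1 & E2).
    exists z. split; [assumption|]. rewrite EP, E1, E2 by assumption. exact E.
Qed.
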